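(* Let $n\in\mathbb{N}$ and let $u\in\mathcal{S}_{\psi,\omega}(\mathbb{R})$. Let $(k,\kappa)$ be an admissible tempered Sonine-Weyl pair of order $n$ with associated Laplace symbol $\Phi(s):=\mathcal{L}\{\kappa\}(s)$. Then the Weighted Weyl-Sonine integral $\mathfrak{I}^{(k)}_{\psi,\omega}$ and the Weighted Weyl-Sonine derivative $\mathfrak{D}^{(\kappa)}_{\psi,\omega}$ of order $n$ satisfy the following spectral relations: 1. (Integral) $$\mathcal{F}_{\psi,\omega}\{\mathfrak{I}^{(k)}_{\psi,\omega}u\}(\xi)=\frac{1}{(i\xi)^n\,\Phi(i\xi)}\cdot\mathcal{F}_{\psi,\omega}\{u\}(\xi).$$ 2. (Derivative) $$\mathcal{F}_{\psi,\omega}[\mathfrak{D}^{(\kappa)}_{\psi,\omega}u](\xi)=(i\xi)^n\,\Phi(i\xi)\cdot\mathcal{F}_{\psi,\omega}[u](\xi).$$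
   Context: Standing assumptions: $\omega\in C^\infty(\mathbb{R})$ is strictly positive; $\psi\in C^\infty(\mathbb{R})$ is real-valued with $\psi(\mathbb{R})=\mathbb{R}$ and $\psi'(t)>0$ for all $t$. Structure operators: $(M_\omega f)(t)=\omega(t)f(t)$, $(Q_\psi f)(t)=f(\psi(t))$, $(Q_\psi^{-1}g)(t)=g(\psi^{-1}(t))$. Weighted Schwartz space: $\mathcal{S}_{\psi,\omega}(\mathbb{R})=\{u:\mathbb{R}\to\mathbb{C}\mid \exists f\in\mathcal{S}(\mathbb{R}),\ u(t)=f(\psi(t))/\omega(t)\}$. Weighted Fourier transform: $[\mathcal{F}_{\psi,\omega}f](\xi)=\frac{1}{\sqrt{2\pi}}\int_{-\infty}^\infty e^{-i\xi\psi(t)}\omega(t)f(t)\psi'(t)\,dt$, equivalently $\mathcal{F}_{\psi,\omega}=\mathcal{F}\circ Q_\psi^{-1}\circ M_\omega$, where $\mathcal{F}g(\xi)=\frac{1}{\sqrt{2\pi}}\int_{\mathbb{R}}e^{-i\xi y}g(y)\,dy$ is the classical Fourier transform; via this factorization it extends to functions or distributions $w$ for which $Q_\psi^{-1}M_\omega w$ is a tempered distribution. Admissible tempered (Sonine-Weyl) pair of order $n$: a pair $(k,\kappa)$ of tempered distributions on $\mathbb{R}$ such that (1) both are supported in $[0,\infty)$; (2) $k*\kappa=\frac{t_+^{n-1}}{(n-1)!}$ in $\mathcal{S}'(\mathbb{R})$, where $\langle t_+^{\lambda},\phi\rangle=\int_0^\infty t^\lambda\phi(t)\,dt$ (for $n=1$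 the right-hand side is the Heaviside function); (3) the Laplace transform $\hat k(s)$, $\mathrm{Re}(s)>0$, satisfies algebraic growth/decay conditions at infinity consistent with a fractional order strictly between $n-1$ and $n$. Spectral symbol: $\Phi(s)=\mathcal{L}\{\kappa\}(s)$ for $\mathrm{Re}(s)>0$ (Laplace transform). By (2), $\mathcal{L}\{k\}(s)=\frac{1}{s^n\Phi(s)}$. The symbols $\Phi(i\xi)$ and $\frac{1}{(i\xi)^n\Phi(i\xi)}$ denote the boundary values of $\mathcal{L}\{\kappa\}(s)$ and $\mathcal{L}\{k\}(s)$ as $s\to i\xi$ with $\mathrm{Re}(s)\to0^+$, and the identities are understood in the sense of (tempered) distributions in $\xi$. Weighted Weyl-Sonine integral: $\mathfrak{I}^{(k)}_{\psi,\omega}u(t)=\frac{1}{\omega(t)}\int_{-\infty}^t k(\psi(t)-\psi(\tau))\,\omega(\tau)u(\tau)\psi'(\tau)\,d\tau$, i.e. $\mathfrak{I}^{(k)}_{\psi,\omega}=M_\omega^{-1}Q_\psi(k* )Q_\psi^{-1}M_\omega$, where $(k* )$ is convolution on $\mathbb{R}$. Weighted Weyl-Sonine derivative of order $n$: $\mathfrak{D}^{(\kappa)}_{\psi,\omega}u(t)=\frac{1}{\omega(t)}\left(\frac{1}{\psi'(t)}\frac{d}{dt}\right)^n\int_{-\infty}^t\kappa(\psi(t)-\psi(\tau))\,\omega(\tau)u(\tau)\psi'(\tau)\,d\tau$, i.e. $\mathfrak{D}^{(\kappa)}_{\psi,\omega}=M_\omega^{-1}Q_\psi\left(\frac{d^n}{dy^n}\circ(\kappa*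 )\right)Q_\psi^{-1}M_\omega$. When $k,\kappa$ are not functions, the conjugated convolution forms are the definitions. *)

(* Defs.v *)
From Stdlib Require Import Arith Reals ClassicalEpsilon.
From Coquelicot Require Import Coquelicot.

Open Scope R_scope.

(** * Complex-valued functions of a real variable *)

Definition smooth (f : R -> R) : Prop :=
  forall (n : nat) (x : R), ex_derive_n f n x.

Definition Csmooth (f : R -> C) : Prop :=
  smooth (fun x => Re (f x)) /\ smooth (fun x => Im (f x)).

Definition CDerive_n (f : R -> C) (n : nat) (x : R) : C :=
  (Derive_n (fun y => Re (f y)) n x, Derive_n (fun y => Im (f y)) n x).

Definition is_CInt (f : R -> C) (Fa Fb : (R -> Prop) -> Prop) (z : C) : Prop :=
  is_RInt_gen (fun x => Re (f x)) Fa Fb (Re z) /\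
  is_RInt_gen (fun x => Im (f x)) Fa Fb (Im z).

Definition CInt (f : R -> C) (Fa Fb : (R -> Prop) -> Prop) : C :=
  (RInt_gen (fun x => Re (f x)) Fa Fb, RInt_gen (fun x => Im (f x)) Fa Fb).

Definition minfty : (R -> Prop) -> Prop := Rbar_locally m_infty.
Definition pinfty : (R -> Prop) -> Prop := Rbar_locally p_infty.

Definition Cexp (z : C) : C :=
  (exp (Re z) * cos (Im z), exp (Re z) * sin (Im z)).

(** * Schwartz functions and tempered distributions *)

Definition schwartz (f : R -> C) : Prop :=
  Csmooth f /\
  forall a b : nat, exists M : R, forall x : R,
    Rabs x ^ a * Cmod (CDerive_n f b x) <= M.

(** Functionals are total on [R -> C]; only their values on Schwartz functions
    are meaningful, and [dist_eq] is equality in S'(R). *)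
Definition functional : Type := (R -> C) -> C.

Definition dist_eq (S T : functional) : Prop :=
  forall phi, schwartz phi -> S phi = T phi.

(** The last clause bounds [T] by finitely many Schwartz seminorms: [B] ranges
    over the common bounds of the seminorms of [phi] with indices up to [N]. *)
Definition tempered (T : functional) : Prop :=
  (forall phi chi, schwartz phi -> schwartz chi ->
     T (fun x => (phi x + chi x)%C) = (T phi + T chi)%C) /\
  (forall (c : C) phi, schwartz phi ->
     T (fun x => (c * phi x)%C) = (c * T phi)%C) /\
  (exists (N : nat) (M : R), forall phi, schwartz phi -> forall B : R,
     (forall a b : nat, (a <= N)%nat -> (b <= N)%nat -> forall x : R,
        Rabs x ^ a * Cmod (CDerive_n phi b x) <= B) ->
     Cmod (T phi) <= M * B).

(** supp T is contained in [0,+oo), i.e. T vanishes on test functions with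
    compact support in (-oo,0). *)
Definition supported_nonneg (T : functional) : Prop :=
  forall phi, Csmooth phi ->
    (exists a b : R, a <= b < 0 /\
       forall t, (t < a \/ b < t) -> phi t = RtoC 0) ->
    T phi = RtoC 0.

(** The pairing <T, g> for T supported in [0,+oo) and g agreeing with a Schwartz
    function h near [0,+oo): it is <T, h>, which does not depend on h because of
    the support of T. The function g itself may grow at -oo. *)
Definition half_line_pairing (T : functional) (g : R -> C) : C :=
  T (epsilon (inhabits (fun _ => RtoC 0))
       (fun h => schwartz h /\
          exists delta, 0 < delta /\ forall t, - delta < t -> h t = g t)).

(** Convolution in S'(R) of two distributions supported in [0,+oo):
    <S * T, phi> = <S_x, <T_y, phi (x + y)>>. *)
Definition dist_conv (S T : functional) : functional := fun phi =>
  half_line_pairing S (fun x => T (fun y => phi (x + y))).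

(** [t_+^(n-1) / (n-1)!], for [1 <= n]. *)
Definition t_plus (n : nat) : functional := fun phi =>
  CInt (fun t => (RtoC (t ^ (n - 1) / INR (fact (n - 1))) * phi t)%C)
       (at_point 0) pinfty.

Definition laplace (T : functional) (s : C) : C :=
  half_line_pairing T (fun t => Cexp (- s * RtoC t)%C).

(** Convolution of a tempered distribution with a Schwartz function. *)
Definition conv (T : functional) (f : R -> C) : R -> C := fun y =>
  T (fun t => f (y - t)).

(** Product of a distribution with a multiplier. *)
Definition dist_mul (h : R -> C) (T : functional) : functional := fun phi =>
  T (fun x => (h x * phi x)%C).

(** [T] is the tempered distribution defined by the function [g]. *)
Definition is_dist_of_fun (g : R -> C) (T : functional) : Prop :=
  tempered T /\
  forall phi, schwartz phi ->
    is_CInt (fun x => (g x * phi x)%C) minfty pinfty (T phi).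

(** [T] is the limit in S'(R), as sigma -> 0+, of the functions
    [xi |-> G (sigma + i xi)]. *)
Definition is_boundary_value (G : C -> C) (T : functional) : Prop :=
  tempered T /\
  forall phi, schwartz phi ->
    exists J : R -> C,
      (forall sigma, 0 < sigma ->
         is_CInt (fun xi => (G (sigma, xi) * phi xi)%C) minfty pinfty
           (J sigma)) /\
      filterlim J (at_right 0) (locally (T phi)).

(** * Fourier transform *)

Definition fourier (g : R -> C) (xi : R) : C :=
  (RtoC (/ sqrt (2 * PI)) *
   CInt (fun y => Cexp (- Ci * RtoC (xi * y)) * g y) minfty pinfty)%C.

Definition dist_fourier (T : functional) : functional := fun phi =>
  T (fourier phi).

(** * Admissible tempered Sonine-Weyl pairs *)

(** [G] has algebraic order [-alpha] at infinity in the right half-plane: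
    [|G s| = |s|^(-alpha + o(1))]. *)
Definition algebraic_order (G : C -> C) (alpha : R) : Prop :=
  forall eps, 0 < eps -> exists A, 0 < A /\
    forall s : C, 0 < Re s -> A <= Cmod s ->
      Rpower (Cmod s) (- alpha - eps) <= Cmod (G s)
        <= Rpower (Cmod s) (- alpha + eps).

Definition admissible_pair (n : nat) (k kappa : functional) : Prop :=
  (tempered k /\ tempered kappa) /\
  (supported_nonneg k /\ supported_nonneg kappa) /\
  dist_eq (dist_conv k kappa) (t_plus n) /\
  (exists alpha, INR n - 1 < alpha < INR n /\
     algebraic_order (laplace k) alpha).

(** * Weighted structure *)

Definition inverse (psi : R -> R) (y : R) : R :=
  epsilon (inhabits 0) (fun t => psi t = y).

Definition M_op (omega : R -> R) (f : R -> C) : R -> C := fun t =>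
  (RtoC (omega t) * f t)%C.

Definition M_inv (omega : R -> R) (f : R -> C) : R -> C := fun t =>
  (RtoC (/ omega t) * f t)%C.

Definition Q_op (psi : R -> R) (f : R -> C) : R -> C := fun t => f (psi t).

Definition Q_inv (psi : R -> R) (g : R -> C) : R -> C := fun t =>
  g (inverse psi t).

Definition weighted_schwartz (psi omega : R -> R) (u : R -> C) : Prop :=
  exists f, schwartz f /\ forall t, u t = (f (psi t) / RtoC (omega t))%C.

Definition weighted_fourier (psi omega : R -> R) (f : R -> C) (xi : R) : C :=
  (RtoC (/ sqrt (2 * PI)) *
   CInt (fun t => Cexp (- Ci * RtoC (xi * psi t)) *
                  (RtoC (omega t) * f t * RtoC (Derive psi t)))
        minfty pinfty)%C.

(** The extension of the weighted Fourier transform, through the factorization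
    F o Q^-1 o M, to the functions [w] for which [Q^-1 M w] is a tempered
    distribution: [T] is the transform of [w]. *)
Definition is_weighted_fourier (psi omega : R -> R) (w : R -> C)
    (T : functional) : Prop :=
  exists W, is_dist_of_fun (Q_inv psi (M_op omega w)) W /\
    dist_eq (dist_fourier W) T.

Definition weyl_sonine_integral (psi omega : R -> R) (k : functional)
    (u : R -> C) : R -> C :=
  M_inv omega (Q_op psi (conv k (Q_inv psi (M_op omega u)))).

Definition weyl_sonine_derivative (psi omega : R -> R) (n : nat)
    (kappa : functional) (u : R -> C) : R -> C :=
  M_inv omega (Q_op psi
    (CDerive_n (conv kappa (Q_inv psi (M_op omega u))) n)).

(* Main.v *)
(** With [f = (omega u) o psi^-1], the weighted operators reduce to the unweighted
    ones: [conv k f] and the [n]-th derivative of [conv kappa f], which is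
    [conv kappa f^(n)].  For a tempered [T] supported in [[0,+oo)], the boundary value
    of its Laplace transform on the imaginary axis is [phi |-> T (sqrt (2 pi) phi^)],
    because [T] commutes with [int e^(-(sigma + i xi) t) phi(xi) dxi] and
    [e^(-sigma t) phi^] tends to [phi^] near [[0,+oo)].  On the other side,
    [int (T * f) phi^ = T (t |-> int f(x - t) phi^(x) dx)], and the multiplication formula
    turns the inner integral into [sqrt (2 pi) (f^ phi)^ (t)], so no Fourier inversion is
    needed.  Finally, testing [k * kappa = t_+^(n-1) / (n-1)!] on a Schwartz function equal to
    [e^(-s t)] near [[0,+oo)] gives [L k (s) L kappa (s) = s^(-n)], which identifies
    [1 / (s^n Phi s)] with [L k (s)], and [(f^(n))^ = (i xi)^n f^] accounts for the
    derivative. *)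

Require Import Defs.
From Stdlib Require Import Arith Reals Lra Lia FunctionalExtensionality ClassicalEpsilon.
From Coquelicot Require Import Coquelicot.
Open Scope R_scope.

(** * Calculus of complex-valued functions of a real variable *)

(** A tempered functional is opaque: only its linearity on Schwartz functions and one seminorm bound
    are available. Every exchange of [T] with an integral therefore comes from one result,
    [tempered_CInt], for integrands that are Schwartz in the variable seen by [T] and, uniformly in
    each seminorm, Lipschitz and [O(1/(1+x^2))] in the integration variable. This decay rate is
    convenient because the primitive [atan] makes all tails explicit. Taking integration itself as
    [T] turns the same result into Fubini for Schwartz integrands, and this is how the
    multiplication formula is obtained.

    The second obstacle is on the negative half-line: [e^(-s t)] grows there, while
    [supported_nonneg] speaks only of compactly supported test functions. A smooth cutoff, equal to
    1 on [[-1/2,+oo)] and to 0 on [(-oo,-1]], settles both: it makes the exponential Schwartz, and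
    its translates truncate a Schwartz function that vanishes near [[0,+oo)]. *)

Definition Cder (f : R -> C) (x : R) (l : C) : Prop :=
  is_derive (fun y => Re (f y)) x (Re l) /\ is_derive (fun y => Im (f y)) x (Im l).

Lemma C_eq (z w : C) : Re z = Re w -> Im z = Im w -> z = w.
Proof. destruct z, w; simpl; intros; subst; reflexivity. Qed.

Lemma Cmod_le_sum (z : C) : Cmod z <= Rabs (Re z) + Rabs (Im z).
Proof.
  replace z with (RtoC (Re z) + Ci * RtoC (Im z))%C at 1.
  - eapply Rle_trans; [apply Cmod_triangle|].
    rewrite Cmod_mult, Cmod_Ci, !Cmod_R; lra.
  - apply C_eq; simpl; ring.
Qed.

Lemma im_le_Cmod (z : C) : Rabs (Im z) <= Cmod z.
Proof.
  eapply Rle_trans; [|apply Rmax_Cmod]. apply Rmax_r.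
Qed.

Lemma is_derive_eq (f : R -> R) (x l l' : R) : is_derive f x l -> l = l' -> is_derive f x l'.
Proof. intros H <-; exact H. Qed.

Lemma Cder_eq f x l l' : Cder f x l -> l = l' -> Cder f x l'.
Proof. intros H <-; exact H. Qed.

Lemma Cder_const c x : Cder (fun _ => c) x (RtoC 0).
Proof. split; apply (is_derive_const (K := R_AbsRing) (V := R_NormedModule)). Qed.

Lemma Cder_plus f g x a b : Cder f x a -> Cder g x b ->
  Cder (fun y => f y + g y)%C x (a + b)%C.
Proof.
  intros [H1 H2] [H3 H4]; split;
  [apply (is_derive_plus (K := R_AbsRing) (V := R_NormedModule) _ _ _ _ _ H1 H3)
  |apply (is_derive_plus (K := R_AbsRing) (V := R_NormedModule) _ _ _ _ _ H2 H4)].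
Qed.

Lemma is_derive_mult_R (f g : R -> R) x a b : is_derive f x a -> is_derive g x b ->
  is_derive (fun y => f y * g y) x (a * g x + f x * b).
Proof.
  intros H1 H2. apply (is_derive_mult (K := R_AbsRing) f g x a b H1 H2).
  intros n m; apply Rmult_comm.
Qed.

Lemma Cder_mult f g x a b : Cder f x a -> Cder g x b ->
  Cder (fun y => f y * g y)%C x (a * g x + f x * b)%C.
Proof.
  intros [H1 H2] [H3 H4]; split; simpl.
  - eapply is_derive_eq.
    + apply (is_derive_minus (K := R_AbsRing) (V := R_NormedModule)).
      * apply (is_derive_mult_R _ _ _ _ _ H1 H3).
      * apply (is_derive_mult_R _ _ _ _ _ H2 H4).
    + unfold minus, plus, opp; simpl; unfold Re, Im; ring.
  - eapply is_derive_eq.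
    + apply (is_derive_plus (K := R_AbsRing) (V := R_NormedModule)).
      * apply (is_derive_mult_R _ _ _ _ _ H1 H4).
      * apply (is_derive_mult_R _ _ _ _ _ H2 H3).
    + unfold plus; simpl; unfold Re, Im; ring.
Qed.

Lemma Cder_scal c f x a : Cder f x a -> Cder (fun y => c * f y)%C x (c * a)%C.
Proof.
  intros H. eapply Cder_eq. apply (Cder_mult _ _ _ _ _ (Cder_const c x) H). ring.
Qed.

Lemma Cder_minus f g x a b : Cder f x a -> Cder g x b ->
  Cder (fun y => f y - g y)%C x (a - b)%C.
Proof.
  intros H1 H2. eapply Cder_eq.
  - apply Cder_plus; [exact H1|].
    replace (fun y => (- g y)%C) with (fun y => (- RtoC 1 * g y)%C).
    + apply Cder_scal, H2.
    + apply functional_extensionality; intros y. ring.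
  - ring.
Qed.

Lemma Cder_RtoC (f : R -> R) x a : is_derive f x a -> Cder (fun y => RtoC (f y)) x (RtoC a).
Proof. intros H; split; simpl; [exact H|]. apply (is_derive_const (K := R_AbsRing) (V := R_NormedModule)). Qed.

Lemma Cder_id x : Cder (fun y => RtoC y) x (RtoC 1).
Proof. apply Cder_RtoC. apply (is_derive_id (K := R_AbsRing)). Qed.

Lemma Cder_comp (f : R -> C) (g : R -> R) x l m : Cder f (g x) l -> is_derive g x m ->
  Cder (fun y => f (g y)) x (RtoC m * l)%C.
Proof.
  intros [H1 H2] H; split; simpl.
  - eapply is_derive_eq.
    apply (is_derive_comp (fun y => Re (f y)) g x _ _ H1 H).
    unfold scal; simpl; unfold mult; simpl; unfold Re, Im; ring.
  - eapply is_derive_eq.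
    apply (is_derive_comp (fun y => Im (f y)) g x _ _ H2 H).
    unfold scal; simpl; unfold mult; simpl; unfold Re, Im; ring.
Qed.

Lemma Cexp_mult_RtoC (s : C) (y : R) :
  Cexp (s * RtoC y)%C = (exp (Re s * y) * cos (Im s * y), exp (Re s * y) * sin (Im s * y)).
Proof. unfold Cexp; apply C_eq; simpl; unfold Re, Im; f_equal; f_equal; ring. Qed.

Lemma Cder_Cexp (s : C) (t : R) :
  Cder (fun y => Cexp (s * RtoC y)%C) t (s * Cexp (s * RtoC t))%C.
Proof.
  replace (fun y => Cexp (s * RtoC y)%C) with
   (fun y => (exp (Re s * y) * cos (Im s * y), exp (Re s * y) * sin (Im s * y)) : C)
   by (apply functional_extensionality; intros; now rewrite Cexp_mult_RtoC).
  rewrite Cexp_mult_RtoC. destruct s as [a b].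
  split; simpl; auto_derive; trivial; ring.
Qed.

Lemma Cexp_plus z w : Cexp (z + w)%C = (Cexp z * Cexp w)%C.
Proof.
  destruct z, w. unfold Cexp; apply C_eq; simpl; rewrite exp_plus, ?cos_plus, ?sin_plus; ring.
Qed.

Lemma Cexp_0 : Cexp (RtoC 0) = RtoC 1.
Proof. unfold Cexp; simpl. rewrite exp_0, cos_0, sin_0. apply C_eq; simpl; ring. Qed.

Lemma Cmod_Cexp z : Cmod (Cexp z) = exp (Re z).
Proof.
  unfold Cexp, Cmod; simpl.
  match goal with |- sqrt ?a = _ => replace a with (exp (Re z) * exp (Re z)) end.
  - apply sqrt_square. left; apply exp_pos.
  - generalize (sin2_cos2 (Im z)). unfold Rsqr. intros H.
    transitivity (exp (Re z) * exp (Re z) * (sin (Im z) * sin (Im z) + cos (Im z) * cos (Im z))).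
    + rewrite H; ring.
    + ring.
Qed.

Lemma Cmod_Cexp_imag x : Cmod (Cexp (- Ci * RtoC x)) = 1.
Proof. rewrite Cmod_Cexp. simpl. rewrite <- exp_0. f_equal; ring. Qed.

Lemma CDerive_n_0 f : CDerive_n f 0 = f.
Proof. apply functional_extensionality; intros x. apply C_eq; reflexivity. Qed.

Lemma CDerive_n_1 f g : (forall x, Cder f x (g x)) -> CDerive_n f 1 = g.
Proof.
  intros H. apply functional_extensionality; intros x. apply C_eq; simpl.
  - apply is_derive_unique, H.
  - apply is_derive_unique, H.
Qed.

Lemma CDerive_n_comp f m n : CDerive_n (CDerive_n f m) n = CDerive_n f (n + m).
Proof.
  apply functional_extensionality; intros x. apply C_eq; simpl.
  - rewrite <- Derive_n_comp. reflexivity.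
  - rewrite <- Derive_n_comp. reflexivity.
Qed.

Lemma CDerive_n_succ f g n : (forall x, Cder f x (g x)) ->
  CDerive_n f (S n) = CDerive_n g n.
Proof.
  intros H. rewrite <- (CDerive_n_1 _ _ H), CDerive_n_comp. f_equal; lia.
Qed.

(** If every member of a class has a derivative in the class, all iterated derivatives stay there
    and can be differentiated again. Smoothness is thus proved by exhibiting an invariant class,
    without a formula for the n-th derivative. *)
Lemma Csmooth_class (P : (R -> C) -> Prop) :
  (forall f, P f -> exists g, (forall x, Cder f x (g x)) /\ P g) ->
  forall f, P f -> Csmooth f.
Proof.
  intros HP f Hf.
  assert (H : forall n, P (CDerive_n f n)).
  { induction n as [|n IH]; [now rewrite CDerive_n_0|].
    destruct (HP _ IH) as [g [Hg Pg]].
    replace (S n) with (1 + n)%nat by lia.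
    rewrite <- CDerive_n_comp, (CDerive_n_1 _ _ Hg). exact Pg. }
  split; intros n x; (destruct n as [|n]; [exact I|]);
  destruct (HP _ (H n)) as [g [Hg _]].
  - exists (Re (g x)). apply Hg.
  - exists (Im (g x)). apply Hg.
Qed.

Lemma Cder_CDerive_n f : Csmooth f -> forall n x,
  Cder (CDerive_n f n) x (CDerive_n f (S n) x).
Proof.
  intros [H1 H2] n x; split; simpl; apply Derive_correct.
  - apply (H1 (S n)).
  - apply (H2 (S n)).
Qed.

Lemma Cder_D f : Csmooth f -> forall x, Cder f x (CDerive_n f 1 x).
Proof. intros H x. rewrite <- (CDerive_n_0 f) at 1. now apply Cder_CDerive_n. Qed.

Lemma Csmooth_CDerive_n f m : Csmooth f -> Csmooth (CDerive_n f m).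
Proof.
  intros H. apply (Csmooth_class (fun g => exists m, g = CDerive_n f m)); [|eauto].
  intros g [k ->]. exists (CDerive_n f (S k)). split; [|eauto].
  now apply Cder_CDerive_n.
Qed.

Lemma CDerive_n_S f n : CDerive_n f (S n) = CDerive_n (CDerive_n f 1) n.
Proof. rewrite CDerive_n_comp. f_equal; lia. Qed.

Lemma Csmooth_plus f g : Csmooth f -> Csmooth g -> Csmooth (fun x => f x + g x)%C.
Proof.
  intros Hf Hg. apply (Csmooth_class (fun h => exists f g, Csmooth f /\ Csmooth g /\
    h = fun x => (f x + g x)%C)); [|eauto 6].
  clear. intros h [f [g [Hf [Hg ->]]]].
  exists (fun x => CDerive_n f 1 x + CDerive_n g 1 x)%C. split.
  - intros x. apply Cder_plus; now apply Cder_D.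
  - do 2 eexists. split; [|split; [|reflexivity]]; now apply Csmooth_CDerive_n.
Qed.

Lemma Csmooth_const c : Csmooth (fun _ => c).
Proof.
  apply (Csmooth_class (fun h => exists c, h = fun _ => c)); [|eauto].
  intros h [d ->]. exists (fun _ => RtoC 0). split; [|eauto]. intros; apply Cder_const.
Qed.

Lemma Csmooth_id : Csmooth (fun x => RtoC x).
Proof.
  apply (Csmooth_class (fun h => (h = fun x => RtoC x) \/ Csmooth h)); [|eauto].
  intros h [->|H].
  - exists (fun _ => RtoC 1). split; [apply Cder_id|right; apply Csmooth_const].
  - exists (CDerive_n h 1). split; [now apply Cder_D|right; now apply Csmooth_CDerive_n].
Qed.

(** Products alone are not closed under differentiation; their finite sums are, and they form the
    class handed to [Csmooth_class]. *)
Inductive sum_of_products : (R -> C) -> Prop :=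
| sop_mult f g : Csmooth f -> Csmooth g -> sum_of_products (fun x => f x * g x)%C
| sop_plus f g : sum_of_products f -> sum_of_products g ->
    sum_of_products (fun x => f x + g x)%C.

Lemma Csmooth_mult f g : Csmooth f -> Csmooth g -> Csmooth (fun x => f x * g x)%C.
Proof.
  intros Hf Hg. apply (Csmooth_class sum_of_products); [|now constructor].
  clear. induction 1 as [f g Hf Hg|f g Hf [f' [Hf' Sf]] Hg [g' [Hg' Sg]]].
  - exists (fun x => CDerive_n f 1 x * g x + f x * CDerive_n g 1 x)%C. split.
    + intros x. apply Cder_mult; now apply Cder_D.
    + constructor; constructor; trivial; now apply Csmooth_CDerive_n.
  - exists (fun x => f' x + g' x)%C. split; [|now constructor].
    intros x; apply Cder_plus; trivial.
Qed.

Lemma Csmooth_scal c f : Csmooth f -> Csmooth (fun x => c * f x)%C.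
Proof. intros; apply Csmooth_mult; trivial. apply Csmooth_const. Qed.

Lemma CDerive_n_plus f g n : Csmooth f -> Csmooth g ->
  CDerive_n (fun x => f x + g x)%C n = fun x => (CDerive_n f n x + CDerive_n g n x)%C.
Proof.
  revert f g; induction n as [|n IH]; intros f g Hf Hg.
  - rewrite !CDerive_n_0. reflexivity.
  - rewrite (CDerive_n_succ _ (fun x => CDerive_n f 1 x + CDerive_n g 1 x)%C).
    + rewrite IH by now apply Csmooth_CDerive_n. rewrite (CDerive_n_S f n), (CDerive_n_S g n). reflexivity.
    + intros x. apply Cder_plus; now apply Cder_D.
Qed.

Lemma CDerive_n_scal c f n : Csmooth f ->
  CDerive_n (fun x => c * f x)%C n = fun x => (c * CDerive_n f n x)%C.
Proof.
  revert f; induction n as [|n IH]; intros f Hf.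
  - rewrite !CDerive_n_0. reflexivity.
  - rewrite (CDerive_n_succ _ (fun x => c * CDerive_n f 1 x)%C).
    + rewrite IH by now apply Csmooth_CDerive_n. rewrite (CDerive_n_S f n). reflexivity.
    + intros x. apply Cder_scal; now apply Cder_D.
Qed.

(* Differentiating once and using the induction hypothesis on [f' g] and [f g']
   avoids the binomial formula. *)
Lemma Leibniz_bound n : forall f g x A B, Csmooth f -> Csmooth g ->
  (forall i, (i <= n)%nat -> Cmod (CDerive_n f i x) <= A) ->
  (forall i, (i <= n)%nat -> Cmod (CDerive_n g i x) <= B) ->
  Cmod (CDerive_n (fun y => f y * g y)%C n x) <= 2 ^ n * (A * B).
Proof.
  induction n as [|n IH]; intros f g x A B Hf Hg HA HB.
  - rewrite CDerive_n_0, Cmod_mult.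
    specialize (HA 0%nat (le_n _)). specialize (HB 0%nat (le_n _)).
    rewrite CDerive_n_0 in HA, HB. simpl. rewrite Rmult_1_l.
    apply Rmult_le_compat; trivial; apply Cmod_ge_0.
  - assert (Sf := Csmooth_CDerive_n f 1 Hf). assert (Sg := Csmooth_CDerive_n g 1 Hg).
    rewrite (CDerive_n_succ _ (fun x => CDerive_n f 1 x * g x + f x * CDerive_n g 1 x)%C)
      by (intros y; apply Cder_mult; now apply Cder_D).
    rewrite CDerive_n_plus by now apply Csmooth_mult.
    eapply Rle_trans; [apply Cmod_triangle|].
    assert (H1 := IH (CDerive_n f 1) g x A B Sf Hg).
    assert (H2 := IH f (CDerive_n g 1) x A B Hf Sg).
    replace (2 ^ S n * (A * B)) with (2 ^ n * (A * B) + 2 ^ n * (A * B)) by (simpl; ring).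
    apply Rplus_le_compat; [apply H1|apply H2]; intros i Hi;
    rewrite <- ?CDerive_n_S; (apply HA || apply HB); lia.
Qed.

Lemma CDerive_n_comp_affine f a b n : Csmooth f ->
  CDerive_n (fun x => f (a + b * x)) n =
  fun x => (RtoC (b ^ n) * CDerive_n f n (a + b * x))%C.
Proof.
  revert f; induction n as [|n IH]; intros f Hf.
  - rewrite !CDerive_n_0. simpl. apply functional_extensionality; intros; ring.
  - rewrite (CDerive_n_succ _ (fun x => RtoC b * CDerive_n f 1 (a + b * x))%C).
    + rewrite CDerive_n_scal.
      * rewrite IH by now apply Csmooth_CDerive_n.
        apply functional_extensionality; intros x. rewrite (CDerive_n_S f n).
        simpl. rewrite RtoC_mult. ring.
      * apply (Csmooth_class (fun h => exists m c, h = fun x => (c * CDerive_n f m (a + b * x))%C)).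
        -- intros h [m [c ->]]. exists (fun x => (c * (b * CDerive_n f (S m) (a + b * x)))%C).
           split.
           ++ intros x. apply Cder_scal. apply (Cder_comp _ (fun x => a + b * x)).
              ** now apply Cder_CDerive_n.
              ** auto_derive; trivial; ring.
           ++ exists (S m), (c * b)%C. apply functional_extensionality; intros; ring.
        -- exists 1%nat, (RtoC 1). apply functional_extensionality; intros; ring.
    + intros x. apply (Cder_comp _ (fun x => a + b * x)).
      * now apply Cder_D.
      * auto_derive; trivial; ring.
Qed.

Lemma Csmooth_comp_affine f a b : Csmooth f -> Csmooth (fun x => f (a + b * x)).
Proof.
  intros Hf.
  apply (Csmooth_class (fun h => exists m c, h = fun x => (c * CDerive_n f m (a + b * x))%C)).
  - intros h [m [c ->]]. exists (fun x => (c * (b * CDerive_n f (S m) (a + b * x)))%C).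
    split.
    + intros x. apply Cder_scal. apply (Cder_comp _ (fun x => a + b * x)).
      * now apply Cder_CDerive_n.
      * auto_derive; trivial; ring.
    + exists (S m), (c * b)%C. apply functional_extensionality; intros; ring.
  - exists 0%nat, (RtoC 1). rewrite CDerive_n_0. apply functional_extensionality; intros; ring.
Qed.

Lemma CDerive_n_Cexp s n : CDerive_n (fun t => Cexp (s * RtoC t)%C) n =
  fun t => (s ^ n * Cexp (s * RtoC t))%C.
Proof.
  induction n as [|n IH].
  - rewrite CDerive_n_0. apply functional_extensionality; intros; simpl; ring.
  - replace (S n) with (1 + n)%nat by lia. rewrite <- CDerive_n_comp, IH.
    apply CDerive_n_1. intros x. eapply Cder_eq.
    + apply Cder_scal, Cder_Cexp.
    + simpl. ring.
Qed.

Lemma Csmooth_Cexp s : Csmooth (fun t => Cexp (s * RtoC t)%C).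
Proof.
  apply (Csmooth_class (fun h => exists c, h = fun t => (c * Cexp (s * RtoC t))%C)).
  - intros h [c ->]. exists (fun t => (c * (s * Cexp (s * RtoC t)))%C). split.
    + intros x. apply Cder_scal, Cder_Cexp.
    + exists (c * s)%C. apply functional_extensionality; intros; ring.
  - exists (RtoC 1). apply functional_extensionality; intros; ring.
Qed.

(** The mean value theorem has no complex form, so it is applied to the real and the imaginary part,
    each with its own intermediate point; this costs the factor 2. *)
Lemma Cder_bound f g B a b : (forall x, Rmin a b <= x <= Rmax a b -> Cder f x (g x)) ->
  (forall x, Rmin a b <= x <= Rmax a b -> Cmod (g x) <= B) ->
  Cmod (f b - f a)%C <= 2 * B * Rabs (b - a).
Proof.
  intros Hf HB.
  eapply Rle_trans; [apply Cmod_le_sum|].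
  destruct (MVT_gen (fun y => Re (f y)) a b (fun y => Re (g y))) as [c [Hc Ec]].
  - intros x Hx. apply Hf; lra.
  - intros x Hx. apply continuity_pt_filterlim. apply (ex_derive_continuous (K := R_AbsRing) (V := R_NormedModule)).
    exists (Re (g x)). apply Hf; lra.
  - destruct (MVT_gen (fun y => Im (f y)) a b (fun y => Im (g y))) as [d [Hd Ed]].
    + intros x Hx. apply Hf; lra.
    + intros x Hx. apply continuity_pt_filterlim. apply (ex_derive_continuous (K := R_AbsRing) (V := R_NormedModule)).
      exists (Im (g x)). apply Hf; lra.
    + simpl in *. unfold Re, Im in *.
      change (fst (f b) + - fst (f a)) with (fst (f b) - fst (f a)).
      change (snd (f b) + - snd (f a)) with (snd (f b) - snd (f a)).
      rewrite Ec, Ed, !Rabs_mult.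
      assert (Rabs (fst (g c)) <= B) by (eapply Rle_trans; [apply re_le_Cmod|auto]).
      assert (Rabs (snd (g d)) <= B) by (eapply Rle_trans; [apply im_le_Cmod|auto]).
      generalize (Rabs_pos (b - a)). nra.
Qed.

(** [Cder_bound] is used twice: for [x |-> f x - (x - a) * f1 a], and for its derivative
    [f1 x - f1 a]. Hence the constant 4. *)
Lemma Taylor2_bound f f1 f2 B a b :
  (forall x, Rmin a b <= x <= Rmax a b -> Cder f x (f1 x)) ->
  (forall x, Rmin a b <= x <= Rmax a b -> Cder f1 x (f2 x)) ->
  (forall x, Rmin a b <= x <= Rmax a b -> Cmod (f2 x) <= B) ->
  Cmod (f b - f a - RtoC (b - a) * f1 a)%C <= 4 * B * Rabs (b - a) ^ 2.
Proof.
  intros H1 H2 HB.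
  assert (H := Cder_bound (fun x => f x - RtoC (x - a) * f1 a)%C (fun x => f1 x - f1 a)%C
     (2 * B * Rabs (b - a)) a b).
  replace (f b - f a - RtoC (b - a) * f1 a)%C with
   ((f b - RtoC (b - a) * f1 a) - (f a - RtoC (a - a) * f1 a))%C.
  - replace (4 * B * Rabs (b - a) ^ 2) with (2 * (2 * B * Rabs (b - a)) * Rabs (b - a)) by ring.
    apply H.
    + intros x Hx. eapply Cder_eq.
      * apply Cder_minus; [apply H1; trivial|]. apply Cder_mult; [|apply Cder_const].
        apply (Cder_RtoC (fun y => y - a) x 1). auto_derive; trivial; ring.
      * cbv beta; ring.
    + intros x Hx.
      assert (HB0 : 0 <= B) by (eapply Rle_trans; [apply Cmod_ge_0|apply (HB a)]; unfold Rmin, Rmax; destruct Rle_dec; lra).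
      assert (Hs : forall y, Rmin a x <= y <= Rmax a x -> Rmin a b <= y <= Rmax a b).
      { intros y. revert Hx. unfold Rmin, Rmax; repeat destruct Rle_dec; lra. }
      eapply Rle_trans; [apply (Cder_bound f1 f2 B a x); auto|].
      apply Rmult_le_compat_l; [lra|].
      revert Hx. unfold Rmin, Rmax, Rabs; repeat destruct Rle_dec; repeat destruct Rcase_abs; lra.
  - rewrite Rminus_diag. ring.
Qed.

(** * Seminorms, multipliers and continuous operators on the Schwartz space *)

Definition seminorm_le (N : nat) (f : R -> C) (B : R) : Prop :=
  forall a b : nat, (a <= N)%nat -> (b <= N)%nat -> forall x : R,
    Rabs x ^ a * Cmod (CDerive_n f b x) <= B.

(** The order is abstract because the bounds to be merged are real constants in most places and
    natural numbers in [Scont_of_seminorms]. *)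
Lemma finite_bound_directed {T : Type} (le : T -> T -> Prop) (P : nat -> T -> Prop) :
  (forall A B, exists C, le A C /\ le B C) ->
  (forall n A B, P n A -> le A B -> P n B) -> (forall n, exists A, P n A) ->
  forall N, exists A, forall n, (n <= N)%nat -> P n A.
Proof.
  intros dir mono H N. induction N as [|N [A IH]].
  - destruct (H 0%nat) as [A HA]. exists A. intros n Hn. now replace n with 0%nat by lia.
  - destruct (H (S N)) as [B HB]. destruct (dir A B) as [D [HAD HBD]]. exists D. intros n Hn.
    destruct (Nat.eq_dec n (S N)) as [->|Hne].
    + exact (mono _ _ _ HB HBD).
    + exact (mono _ _ _ (IH n ltac:(lia)) HAD).
Qed.

Lemma finite_bound (P : nat -> R -> Prop) :
  (forall n A B, P n A -> A <= B -> P n B) -> (forall n, exists A, P n A) ->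
  forall N, exists A, forall n, (n <= N)%nat -> P n A.
Proof.
  apply finite_bound_directed. intros A B. exists (Rmax A B). split; [apply Rmax_l|apply Rmax_r].
Qed.

Lemma seminorm_le_weaken N N' f B B' :
  (N' <= N)%nat -> B <= B' -> seminorm_le N f B -> seminorm_le N' f B'.
Proof.
  intros HN HB H a b Ha Hb x. eapply Rle_trans; [apply H; lia|exact HB].
Qed.

Lemma seminorm_le_pos N f B : seminorm_le N f B -> 0 <= B.
Proof.
  intros H. eapply Rle_trans; [|apply (H 0%nat 0%nat (Nat.le_0_l _) (Nat.le_0_l _) 0)].
  simpl. rewrite Rmult_1_l. apply Cmod_ge_0.
Qed.

Lemma schwartz_seminorm f : schwartz f -> forall N, exists B, seminorm_le N f B.
Proof.
  intros [_ H] N.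
  destruct (finite_bound (fun a B => forall b, (b <= N)%nat -> forall x : R,
    Rabs x ^ a * Cmod (CDerive_n f b x) <= B)) with (N := N) as [B HB].
  - intros n A B HA HAB b Hb x. eapply Rle_trans; [now apply HA|exact HAB].
  - intros a. apply (finite_bound (fun b B => forall x : R,
      Rabs x ^ a * Cmod (CDerive_n f b x) <= B)).
    + intros n A B HA HAB x. eapply Rle_trans; [now apply HA|exact HAB].
    + intros b. apply H.
  - exists B. intros a b Ha Hb. now apply HB.
Qed.

Lemma schwartz_of_seminorm f : Csmooth f -> (forall N, exists B, seminorm_le N f B) -> schwartz f.
Proof.
  intros Hf H. split; [exact Hf|]. intros a b.
  destruct (H (max a b)) as [B HB]. exists B. apply HB; lia.
Qed.

Lemma schwartz_smooth f : schwartz f -> Csmooth f.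
Proof. now intros [H _]. Qed.

Lemma Rabs_pow_pos x a : 0 <= Rabs x ^ a.
Proof. apply pow_le, Rabs_pos. Qed.

Lemma seminorm_le_plus N f g A B : Csmooth f -> Csmooth g -> seminorm_le N f A ->
  seminorm_le N g B -> seminorm_le N (fun x => f x + g x)%C (A + B).
Proof.
  intros Hf Hg HA HB a b Ha Hb x. rewrite CDerive_n_plus by trivial.
  specialize (HA a b Ha Hb x). specialize (HB a b Ha Hb x).
  assert (H := Cmod_triangle (CDerive_n f b x) (CDerive_n g b x)).
  apply Rmult_le_compat_l with (r := Rabs x ^ a) in H; [|apply Rabs_pow_pos]. lra.
Qed.

Lemma seminorm_le_scal N c f B : Csmooth f -> seminorm_le N f B ->
  seminorm_le N (fun x => c * f x)%C (Cmod c * B).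
Proof.
  intros Hf HB a b Ha Hb x. rewrite CDerive_n_scal, Cmod_mult by trivial.
  specialize (HB a b Ha Hb x).
  apply Rmult_le_compat_l with (r := Cmod c) in HB; [|apply Cmod_ge_0]. lra.
Qed.

Lemma schwartz_plus f g : schwartz f -> schwartz g -> schwartz (fun x => f x + g x)%C.
Proof.
  intros Hf Hg. assert (Sf := schwartz_smooth f Hf). assert (Sg := schwartz_smooth g Hg).
  apply schwartz_of_seminorm; [now apply Csmooth_plus|]. intros N.
  destruct (schwartz_seminorm f Hf N) as [A HA]. destruct (schwartz_seminorm g Hg N) as [B HB].
  exists (A + B). now apply seminorm_le_plus.
Qed.

Lemma schwartz_scal c f : schwartz f -> schwartz (fun x => c * f x)%C.
Proof.
  intros Hf. assert (Sf := schwartz_smooth f Hf).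
  apply schwartz_of_seminorm; [now apply Csmooth_scal|]. intros N.
  destruct (schwartz_seminorm f Hf N) as [A HA].
  exists (Cmod c * A). now apply seminorm_le_scal.
Qed.

Lemma Cminus_fun f g : (fun x : R => f x - g x)%C = (fun x => f x + (- RtoC 1) * g x)%C.
Proof. apply functional_extensionality; intros; ring. Qed.

Lemma schwartz_minus f g : schwartz f -> schwartz g -> schwartz (fun x => f x - g x)%C.
Proof. intros. rewrite Cminus_fun. apply schwartz_plus; trivial. now apply schwartz_scal. Qed.

Lemma seminorm_le_CDerive_n N m f B : seminorm_le (m + N) f B -> seminorm_le N (CDerive_n f m) B.
Proof.
  intros H a b Ha Hb x. rewrite CDerive_n_comp. apply H; lia.
Qed.

Lemma schwartz_CDerive_n m f : schwartz f -> schwartz (CDerive_n f m).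
Proof.
  intros Hf. apply schwartz_of_seminorm.
  - apply Csmooth_CDerive_n, schwartz_smooth, Hf.
  - intros N. destruct (schwartz_seminorm f Hf (m + N)) as [B HB].
    exists B. now apply seminorm_le_CDerive_n.
Qed.

Lemma pow_1_plus_le y m : 0 <= y -> (1 + y) ^ m <= 2 ^ m * (1 + y ^ m).
Proof.
  intros Hy. destruct (Rle_dec y 1) as [H|H].
  - assert ((1 + y) ^ m <= 2 ^ m) by (apply pow_incr; lra).
    assert (0 <= y ^ m) by now apply pow_le.
    assert (0 < 2 ^ m) by (apply pow_lt; lra). nra.
  - assert ((1 + y) ^ m <= (2 * y) ^ m) by (apply pow_incr; lra).
    rewrite Rpow_mult_distr in H0.
    assert (0 < 2 ^ m) by (apply pow_lt; lra). nra.
Qed.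

(** The weight [1 + Rabs x] never vanishes and can be divided by, unlike [Rabs x]. *)
Lemma seminorm_le_weight N f B m j x : seminorm_le N f B -> (m <= N)%nat -> (j <= N)%nat ->
  (1 + Rabs x) ^ m * Cmod (CDerive_n f j x) <= 2 ^ N * (2 * B).
Proof.
  intros H Hm Hj.
  assert (H0 := H 0%nat j (Nat.le_0_l _) Hj x). simpl in H0.
  assert (H1 := H m j Hm Hj x).
  assert (Hw := pow_1_plus_le (Rabs x) m (Rabs_pos x)).
  apply Rle_trans with (2 ^ m * (2 * B)).
  - apply Rle_trans with (2 ^ m * (1 + Rabs x ^ m) * Cmod (CDerive_n f j x)).
    + apply Rmult_le_compat_r; [apply Cmod_ge_0|exact Hw].
    + rewrite Rmult_assoc. apply Rmult_le_compat_l; [apply pow_le; lra|]. lra.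
  - apply Rmult_le_compat_r.
    + assert (HB := seminorm_le_pos _ _ _ H). lra.
    + apply Rle_pow; [lra|exact Hm].
Qed.

(** This is the space [O_M] of slowly increasing smooth functions: the growth exponent [K] may
    depend on the order of differentiation. *)
Definition multiplier (g : R -> C) : Prop :=
  Csmooth g /\ forall n, exists (A : R) (K : nat), 0 <= A /\ forall b, (b <= n)%nat -> forall x,
    Cmod (CDerive_n g b x) <= A * (1 + Rabs x) ^ K.

(** Continuity on the Schwartz space, expressed by seminorms. Smoothness is a separate clause
    because [CDerive_n] is total, so that bounds on its values do not imply differentiability. *)
Definition Scont (L : (R -> C) -> R -> C) : Prop :=
  (forall f, schwartz f -> Csmooth (L f)) /\
  forall N, exists (N' : nat) (M : R), 0 <= M /\ forall f B, schwartz f -> seminorm_le N' f B ->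
    seminorm_le N (L f) (M * B).

Lemma Scont_of_seminorms L : (forall f, schwartz f -> Csmooth (L f)) ->
  (forall a b, exists (N' : nat) (M : R), 0 <= M /\ forall f B, schwartz f -> seminorm_le N' f B ->
    forall x, Rabs x ^ a * Cmod (CDerive_n (L f) b x) <= M * B) -> Scont L.
Proof.
  intros HL H. split; [exact HL|]. intros N.
  (* A single natural number [K] serves both as seminorm index and, through [INR], as constant, so
     that finitely many pairs are merged by taking one maximum. *)
  set (P := fun a b K => forall f B, schwartz f -> seminorm_le K f B ->
    forall x, Rabs x ^ a * Cmod (CDerive_n (L f) b x) <= INR K * B).
  assert (dir : forall A B, exists C, (A <= C)%nat /\ (B <= C)%nat) by (intros A B; exists (Nat.max A B); split; [apply Nat.le_max_l|apply Nat.le_max_r]).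
  assert (mono : forall a b K K', P a b K -> (K <= K')%nat -> P a b K').
  { intros a b K K' HK HKK f B Hf HB x.
    assert (HB' := seminorm_le_weaken _ K _ _ B HKK (Rle_refl B) HB).
    eapply Rle_trans; [exact (HK f B Hf HB' x)|].
    apply Rmult_le_compat_r; [now apply seminorm_le_pos in HB|now apply le_INR]. }
  assert (HP : forall a b, exists K, P a b K).
  { intros a b. destruct (H a b) as [N' [M [HM HNM]]].
    destruct (INR_unbounded M) as [K HK]. exists (max N' K). intros f B Hf HB x.
    assert (HB' := seminorm_le_weaken _ N' _ _ B (Nat.le_max_l _ _) (Rle_refl B) HB).
    eapply Rle_trans; [exact (HNM f B Hf HB' x)|]. apply Rmult_le_compat_r; [now apply seminorm_le_pos in HB|].
    apply Rle_trans with (INR K); [lra|apply le_INR; lia]. }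
  destruct (finite_bound_directed le (fun a K => forall b, (b <= N)%nat -> P a b K) dir) with (N := N)
    as [K HK].
  - intros a A B HA HAB b Hb. exact (mono _ _ _ _ (HA b Hb) HAB).
  - intros a. apply (finite_bound_directed le (P a) dir); [|apply HP].
    intros b A B. apply mono.
  - exists K, (INR K). split; [apply pos_INR|]. intros f B Hf HB a b Ha Hb x. exact (HK a Ha b Hb f B Hf HB x).
Qed.

Lemma Scont_schwartz L f : Scont L -> schwartz f -> schwartz (L f).
Proof.
  intros [HL1 HL2] Hf. apply schwartz_of_seminorm; [now apply HL1|].
  intros N. destruct (HL2 N) as [N' [M [HM H]]].
  destruct (schwartz_seminorm f Hf N') as [B HB]. eauto.
Qed.

Lemma Scont_multiplier g : multiplier g -> Scont (fun f x => g x * f x)%C.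
Proof.
  intros [Sg Hg]. split.
  - intros f Hf. apply Csmooth_mult; [trivial|now apply schwartz_smooth].
  - intros N. destruct (Hg N) as [A [K [HA HK]]].
    exists (N + K)%nat, (2 ^ N * (A * (2 ^ (N + K) * 2))). split.
    { repeat apply Rmult_le_pos; trivial; try apply pow_le; lra. }
    intros f B Hf HB a b Ha Hb x.
    assert (Hw : 0 < (1 + Rabs x) ^ (a + K)) by (apply pow_lt; generalize (Rabs_pos x); lra).
    assert (Hw1 : 0 < (1 + Rabs x) ^ a) by (apply pow_lt; generalize (Rabs_pos x); lra).
    assert (Hw2 : 0 < (1 + Rabs x) ^ K) by (apply pow_lt; generalize (Rabs_pos x); lra).
    (* [F] bounds the derivatives of [f] at [x]. Of the weight in its denominator, the power [a]
       pays for [Rabs x ^ a] and the power [K] for the growth of [g]. *)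
    set (F := 2 ^ (N + K) * (2 * B) / (1 + Rabs x) ^ (a + K)).
    assert (L := Leibniz_bound b g f x (A * (1 + Rabs x) ^ K) F Sg (schwartz_smooth f Hf)).
    assert (HF : 0 <= F).
    { apply Rdiv_le_0_compat; [|exact Hw]. apply Rmult_le_pos; [apply pow_le; lra|].
      generalize (seminorm_le_pos _ _ _ HB); lra. }
    eapply Rle_trans.
    { apply Rmult_le_compat; [apply Rabs_pow_pos|apply Cmod_ge_0| |apply L].
      - apply pow_incr with (y := 1 + Rabs x). split; [apply Rabs_pos|lra].
      - intros i Hi. apply HK; lia.
      - intros i Hi. unfold F. apply Rle_div_r; [exact Hw|]. rewrite Rmult_comm.
        apply seminorm_le_weight; [trivial|lia|lia]. }
    replace ((1 + Rabs x) ^ a * (2 ^ b * (A * (1 + Rabs x) ^ K * F)))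
      with (2 ^ b * (A * (2 ^ (N + K) * 2)) * B).
    + apply Rmult_le_compat_r; [now apply seminorm_le_pos in HB|].
      apply Rmult_le_compat_r; [|apply Rle_pow; [lra|exact Hb]].
      repeat apply Rmult_le_pos; trivial; try apply pow_le; lra.
    + unfold F. rewrite (pow_add (1 + Rabs x)). field. split; lra.
Qed.

Lemma multiplier_schwartz f : schwartz f -> multiplier f.
Proof.
  intros Hf. split; [now apply schwartz_smooth|]. intros n.
  destruct (schwartz_seminorm f Hf n) as [B HB]. exists B, 0%nat.
  split; [now apply seminorm_le_pos in HB|]. intros b Hb x.
  specialize (HB 0%nat b (Nat.le_0_l _) Hb x). simpl in *. lra.
Qed.

Lemma CDerive_n_const c n : CDerive_n (fun _ => c) (S n) = fun _ => RtoC 0.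
Proof.
  induction n as [|n IH].
  - apply CDerive_n_1. intros; apply Cder_const.
  - replace (S (S n)) with (1 + S n)%nat by lia.
    rewrite <- CDerive_n_comp, IH. apply CDerive_n_1. intros; apply Cder_const.
Qed.

Lemma multiplier_linear c : multiplier (fun x => c * RtoC x)%C.
Proof.
  split; [apply Csmooth_scal, Csmooth_id|]. intros n. exists (Cmod c), 1%nat.
  split; [apply Cmod_ge_0|]. intros b _ x. simpl. rewrite Rmult_1_r.
  assert (0 <= Cmod c) by apply Cmod_ge_0. assert (0 <= Rabs x) by apply Rabs_pos.
  destruct b as [|[|b]].
  - rewrite CDerive_n_0, Cmod_mult, Cmod_R. nra.
  - rewrite (CDerive_n_1 _ (fun _ => (c * RtoC 1)%C)).
    + rewrite Cmult_1_r. nra.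
    + intros y. apply Cder_scal, Cder_id.
  - rewrite (CDerive_n_succ _ (fun _ => (c * RtoC 1)%C)).
    + rewrite CDerive_n_const, Cmod_0. nra.
    + intros y. apply Cder_scal, Cder_id.
Qed.

Lemma schwartz_mult f g : schwartz f -> schwartz g -> schwartz (fun x => f x * g x)%C.
Proof.
  intros Hf Hg. apply (Scont_schwartz (fun g x => f x * g x)%C); trivial.
  apply Scont_multiplier. now apply multiplier_schwartz.
Qed.

Lemma seminorm_le_affine N f B c e : schwartz f -> Rabs e = 1 -> seminorm_le N f B ->
  seminorm_le N (fun x => f (c + e * x)) ((1 + Rabs c) ^ N * (2 ^ N * (2 * B))).
Proof.
  intros Hf He HB a b Ha Hb x.
  rewrite CDerive_n_comp_affine, Cmod_mult, Cmod_R, <- RPow_abs, He, pow1, Rmult_1_l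
    by now apply schwartz_smooth.
  (* A Peetre-type inequality: translation by [c] costs only a polynomial factor in [c]. The
     polynomial growth of [conv T f] rests on this. *)
  assert (Hx : Rabs x <= (1 + Rabs c) * (1 + Rabs (c + e * x))).
  { assert (Rabs x = Rabs (e * x)) by (rewrite Rabs_mult, He; ring).
    assert (H2 := Rabs_triang (c + e * x) (- c)). rewrite Rabs_Ropp in H2.
    replace (c + e * x + - c) with (e * x) in H2 by ring.
    generalize (Rabs_pos c) (Rabs_pos (c + e * x)). nra. }
  apply Rle_trans with (((1 + Rabs c) * (1 + Rabs (c + e * x))) ^ a * Cmod (CDerive_n f b (c + e * x))).
  - apply Rmult_le_compat_r; [apply Cmod_ge_0|]. apply pow_incr. split; [apply Rabs_pos|exact Hx].
  - rewrite Rpow_mult_distr, Rmult_assoc. apply Rmult_le_compat.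
    + apply pow_le. generalize (Rabs_pos c); lra.
    + apply Rmult_le_pos; [apply pow_le; generalize (Rabs_pos (c + e * x)); lra|apply Cmod_ge_0].
    + apply Rle_pow; [generalize (Rabs_pos c); lra|exact Ha].
    + now apply seminorm_le_weight.
Qed.

Lemma schwartz_affine f c e : schwartz f -> Rabs e = 1 -> schwartz (fun x => f (c + e * x)).
Proof.
  intros Hf He. apply schwartz_of_seminorm.
  - apply Csmooth_comp_affine, schwartz_smooth, Hf.
  - intros N. destruct (schwartz_seminorm f Hf N) as [B HB].
    eexists. apply seminorm_le_affine; eauto.
Qed.

Lemma schwartz_decay f : schwartz f -> forall a, exists C0, 0 <= C0 /\
  forall x, Rabs x ^ a * Cmod (f x) <= C0 / (1 + x ^ 2).
Proof.
  intros Hf a. destruct (schwartz_seminorm f Hf (a + 2)) as [B HB].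
  exists (2 * B). split; [generalize (seminorm_le_pos _ _ _ HB); lra|].
  intros x. assert (H0 := HB a 0%nat ltac:(lia) ltac:(lia) x).
  assert (H2 := HB (a + 2)%nat 0%nat ltac:(lia) ltac:(lia) x).
  rewrite CDerive_n_0 in *. rewrite pow_add, pow2_abs in H2.
  assert (Hp := pow2_ge_0 x). apply (proj1 (Rle_div_r _ _ (1 + x ^ 2) ltac:(lra))). lra.
Qed.

Lemma decay_weight f : schwartz f -> forall a, exists C0, 0 <= C0 /\
  forall x, (1 + Rabs x) ^ a * Cmod (f x) <= C0 / (1 + x ^ 2).
Proof.
  intros Hf a. destruct (schwartz_decay f Hf 0) as [C0 [H0 HC0]].
  destruct (schwartz_decay f Hf a) as [C1 [H1 HC1]].
  assert (H2 : 0 < 2 ^ a) by (apply pow_lt; lra).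
  exists (2 ^ a * (C0 + C1)). split; [apply Rmult_le_pos; lra|]. intros x.
  apply Rle_trans with (2 ^ a * (1 + Rabs x ^ a) * Cmod (f x)).
  - apply Rmult_le_compat_r; [apply Cmod_ge_0|apply pow_1_plus_le, Rabs_pos].
  - specialize (HC0 x). specialize (HC1 x). simpl (Rabs x ^ 0) in HC0.
    replace (2 ^ a * (C0 + C1) / (1 + x ^ 2)) with
      (2 ^ a * (C0 / (1 + x ^ 2) + C1 / (1 + x ^ 2))) by (field; generalize (pow2_ge_0 x); lra).
    rewrite Rmult_assoc. apply Rmult_le_compat_l; lra.
Qed.

Lemma tempered_bound T : tempered T -> exists N M, 0 <= M /\ forall f B, schwartz f ->
  seminorm_le N f B -> Cmod (T f) <= M * B.
Proof.
  intros [_ [_ [N [M H]]]]. exists N, (Rabs M). split; [apply Rabs_pos|].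
  intros f B Hf HB. eapply Rle_trans; [apply (H f Hf B HB)|].
  apply Rmult_le_compat_r; [now apply seminorm_le_pos in HB|apply Rle_abs].
Qed.

Lemma tempered_minus T f g : tempered T -> schwartz f -> schwartz g ->
  T (fun x => f x - g x)%C = (T f - T g)%C.
Proof.
  intros [H1 [H2 _]] Hf Hg. rewrite Cminus_fun, H1, H2; trivial.
  - ring.
  - now apply schwartz_scal.
Qed.

(** * Absolutely convergent integrals over the line *)

Definition Ccont (g : R -> C) : Prop := forall x : R,
  continuous (U := R_UniformSpace) (fun y => Re (g y)) x /\
  continuous (U := R_UniformSpace) (fun y => Im (g y)) x.

Lemma Ccont_Cder f g : (forall x, Cder f x (g x)) -> Ccont f.
Proof.
  intros H x; split; apply (ex_derive_continuous (K := R_AbsRing) (V := R_NormedModule)).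
  - exists (Re (g x)). apply H.
  - exists (Im (g x)). apply H.
Qed.

Lemma Ccont_smooth f : Csmooth f -> Ccont f.
Proof. intros H. exact (Ccont_Cder _ _ (Cder_D f H)). Qed.

Lemma Ccont_plus f g : Ccont f -> Ccont g -> Ccont (fun x => f x + g x)%C.
Proof.
  intros Hf Hg x; destruct (Hf x), (Hg x); split; simpl;
  now apply (continuous_plus (K := R_AbsRing) (V := R_NormedModule)).
Qed.

Lemma Ccont_mult f g : Ccont f -> Ccont g -> Ccont (fun x => f x * g x)%C.
Proof.
  intros Hf Hg x; destruct (Hf x), (Hg x); split; simpl.
  - apply (continuous_minus (K := R_AbsRing) (V := R_NormedModule));
    now apply (continuous_mult (K := R_AbsRing)).
  - apply (continuous_plus (K := R_AbsRing) (V := R_NormedModule));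
    now apply (continuous_mult (K := R_AbsRing)).
Qed.

Lemma Ccont_const c : Ccont (fun _ => c).
Proof. intros x; split; apply continuous_const. Qed.

Lemma Lipschitz_continuous (f : R -> R) L : (forall x y, Rabs (f x - f y) <= L * Rabs (x - y)) ->
  forall x, continuous (U := R_UniformSpace) f x.
Proof.
  intros H x. apply continuity_pt_filterlim. intros eps Heps.
  assert (HL : 0 < Rabs L + 1) by (generalize (Rabs_pos L); lra).
  exists (eps / (Rabs L + 1)). split; [now apply Rdiv_lt_0_compat|].
  intros y [_ Hy]. simpl in *. unfold R_dist, Rdist in *.
  eapply Rle_lt_trans; [apply H|].
  apply Rle_lt_trans with ((Rabs L + 1) * Rabs (y - x)).
  - apply Rmult_le_compat_r; [apply Rabs_pos|]. generalize (Rle_abs L); lra.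
  - apply Rmult_lt_compat_l with (r := Rabs L + 1) in Hy; [|exact HL].
    replace ((Rabs L + 1) * (eps / (Rabs L + 1))) with eps in Hy by (field; lra). exact Hy.
Qed.

Lemma one_plus_sqr_pos x : 0 < 1 + x ^ 2.
Proof. generalize (pow2_ge_0 x); lra. Qed.

Lemma inv_sqr_is_RInt a b : is_RInt (fun x => / (1 + x ^ 2)) a b (atan b - atan a).
Proof.
  apply (is_RInt_derive atan (fun x => / (1 + x ^ 2))).
  - intros x _. apply is_derive_Reals.
    apply derivable_pt_lim_atan.
  - intros x _. apply (ex_derive_continuous (K := R_AbsRing) (V := R_NormedModule)).
    auto_derive. generalize (one_plus_sqr_pos x); lra.
Qed.

(** Comparison with [1/(1+x^2)]. Keeping the bound as a difference of [atan] values controls the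
    total mass and the tails at once. *)
Lemma RInt_bound_atan (g : R -> R) C0 a b : (forall x, continuous g x) ->
  (forall x, Rabs (g x) <= C0 / (1 + x ^ 2)) ->
  Rabs (RInt g a b) <= C0 * Rabs (atan b - atan a).
Proof.
  intros Hg HC.
  assert (W : forall a b, a <= b -> Rabs (RInt g a b) <= C0 * (atan b - atan a)).
  { clear a b. intros a b Hab.
    apply (norm_RInt_le (V := R_NormedModule) g (fun x => scal C0 (/ (1 + x ^ 2))) a b).
    - exact Hab.
    - intros x _. apply HC.
    - apply (RInt_correct (V := R_CompleteNormedModule)). apply (ex_RInt_continuous (V := R_CompleteNormedModule)). auto.
    - apply (is_RInt_scal (V := R_NormedModule)). apply inv_sqr_is_RInt. }
  destruct (Rle_dec a b) as [H|H].
  - rewrite (Rabs_pos_eq (atan b - atan a)); [now apply W|].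
    assert (atan a <= atan b) by (destruct H as [H| ->]; [left; now apply atan_increasing|lra]). lra.
  - assert (atan b < atan a) by (apply atan_increasing; lra).
    rewrite (Rabs_left (atan b - atan a)) by lra.
    rewrite <- (opp_RInt_swap (V := R_CompleteNormedModule)).
    + change (opp (RInt g b a)) with (- RInt g b a). rewrite Rabs_Ropp.
      replace (- (atan b - atan a)) with (atan a - atan b) by ring. apply W; lra.
    + apply (ex_RInt_continuous (V := R_CompleteNormedModule)). auto.
Qed.

(** For [a <= b], the integral of [1/(1+x^2)] outside [[a,b]]: the sum of [atan a + PI/2] and
    [PI/2 - atan b]. *)
Definition atan_tail (a b : R) : R := PI + atan a - atan b.

Lemma atan_tail_pos a b : 0 <= atan_tail a b.
Proof. unfold atan_tail. generalize (atan_bound a) (atan_bound b); lra. Qed.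

Lemma atan_tail_small eps : 0 < eps -> exists M, 0 < M /\
  forall a b, a < - M -> M < b -> atan_tail a b < eps.
Proof.
  (* Each of the two tails will be below [d <= eps/2]. The cap [PI/4] keeps [PI/2 - d] in
     [(0, PI/2)], where [tan] is positive and inverted by [atan]. *)
  intros He. set (d := Rmin (eps / 2) (PI / 4)).
  assert (Hd : 0 < d <= PI / 4 /\ d <= eps / 2).
  { unfold d. generalize PI_RGT_0 (Rmin_l (eps/2) (PI/4)) (Rmin_r (eps/2) (PI/4)). intros.
    split; [split; [apply Rmin_glb_lt; lra|lra]|lra]. }
  assert (Hp := PI_RGT_0).
  exists (tan (PI / 2 - d)). split; [apply tan_gt_0; lra|].
  assert (K : forall x, tan (PI / 2 - d) < x -> PI / 2 - d < atan x).
  { intros x Hx. apply atan_increasing in Hx. rewrite atan_tan in Hx; lra. }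
  intros a b Ha Hb. unfold atan_tail.
  assert (H1 := K b Hb). assert (H2 := K (- a) ltac:(lra)). rewrite atan_opp in H2. lra.
Qed.

Lemma is_RInt_gen_intro (g : R -> R) l : (forall x, continuous g x) ->
  (forall eps, 0 < eps -> exists M, forall a b, a < - M -> M < b -> Rabs (RInt g a b - l) < eps) ->
  is_RInt_gen g minfty pinfty l.
Proof.
  intros Hg H P [eps HP].
  destruct (H eps (cond_pos eps)) as [M HM].
  apply (Filter_prod _ _ _ (fun a => a < - M) (fun b => M < b)).
  - exists (- M); auto.
  - exists M; auto.
  - intros a b Ha Hb. exists (RInt g a b). split.
    + apply (RInt_correct (V := R_CompleteNormedModule)).
      apply (ex_RInt_continuous (V := R_CompleteNormedModule)). auto.
    + apply HP. now apply HM.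
Qed.

Lemma RInt_enlarge (g : R -> R) C0 a b a' b' : (forall x, continuous g x) ->
  (forall x, Rabs (g x) <= C0 / (1 + x ^ 2)) -> 
  Rabs (RInt g a' b' - RInt g a b) <= C0 * (Rabs (atan a - atan a') + Rabs (atan b' - atan b)).
Proof.
  intros Hg HC.
  assert (E : forall u v, ex_RInt g u v)
    by (intros; apply (ex_RInt_continuous (V := R_CompleteNormedModule)); auto).
  assert (E1 := RInt_Chasles (V := R_CompleteNormedModule) g a' a b' (E _ _) (E _ _)).
  assert (E2 := RInt_Chasles (V := R_CompleteNormedModule) g a b b' (E _ _) (E _ _)).
  unfold plus in E1, E2; simpl in E1, E2.
  replace (RInt g a' b' - RInt g a b) with (RInt g a' a + RInt g b b') by lra.
  eapply Rle_trans; [apply Rabs_triang|]. rewrite Rmult_plus_distr_l.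
  apply Rplus_le_compat; now apply RInt_bound_atan.
Qed.

Lemma decay_const_pos (g : R -> R) C0 : (forall x, Rabs (g x) <= C0 / (1 + x ^ 2)) -> 0 <= C0.
Proof.
  intros H. specialize (H 0). generalize (Rabs_pos (g 0)).
  replace (1 + 0 ^ 2) with 1 in H by ring. lra.
Qed.

Lemma RInt_gen_decay (g : R -> R) C0 : (forall x, continuous g x) ->
  (forall x, Rabs (g x) <= C0 / (1 + x ^ 2)) ->
  is_RInt_gen g minfty pinfty (RInt_gen g minfty pinfty) /\
  forall a b, Rabs (RInt_gen g minfty pinfty - RInt g a b) <= C0 * atan_tail a b.
Proof.
  intros Hg HC. assert (C0_pos := decay_const_pos g C0 HC).
  assert (HT : forall a b a' b', a' <= a -> b <= b' ->
    Rabs (RInt g a' b' - RInt g a b) <= C0 * atan_tail a b).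
  { intros a b a' b' Ha Hb. eapply Rle_trans; [now apply (RInt_enlarge g C0)|].
    apply Rmult_le_compat_l; [exact C0_pos|]. unfold atan_tail.
    assert (atan a' <= atan a) by (destruct Ha as [Q| ->]; [left; now apply atan_increasing|lra]).
    assert (atan b <= atan b') by (destruct Hb as [Q| ->]; [left; now apply atan_increasing|lra]).
    rewrite !Rabs_pos_eq by lra. generalize (atan_bound a') (atan_bound b'). lra. }
  assert (HS : forall eps, 0 < eps -> exists M, 0 < M /\ forall a b, a < - M -> M < b ->
    C0 * atan_tail a b < eps).
  { intros eps He. destruct (atan_tail_small (eps / (C0 + 1))) as [M [HM H]].
    - apply Rdiv_lt_0_compat; lra.
    - exists M. split; [exact HM|]. intros a b Ha Hb. specialize (H a b Ha Hb).
      assert (T0 := atan_tail_pos a b).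
      apply Rmult_lt_compat_l with (r := C0 + 1) in H; [|lra].
      replace ((C0 + 1) * (eps / (C0 + 1))) with eps in H by (field; lra). nra. }
  assert (EX : exists l, is_RInt_gen g minfty pinfty l).
  { destruct (proj1 (filterlim_locally_cauchy (U := R_CompleteSpace)
      (F := filter_prod minfty pinfty) (fun ab => RInt g (fst ab) (snd ab)))) as [l Hl].
    - intros eps. destruct (HS (eps / 2)) as [M [HM H]]; [generalize (cond_pos eps); lra|].
      exists (fun ab => fst ab < - M /\ M < snd ab). split.
      + apply (Filter_prod _ _ _ (fun a => a < - M) (fun b => M < b)).
        * exists (- M); auto.
        * exists M; auto.
        * auto.
      + intros [a b] [a' b'] [Ha Hb] [Ha' Hb']; simpl in *.
        (* Two intervals in the Cauchy criterion need not be nested, so both are compared with a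
           common enlargement. *)
        set (a'' := Rmin a a'). set (b'' := Rmax b b').
        assert (K1 := HT a b a'' b'' (Rmin_l _ _) (Rmax_l _ _)).
        assert (K2 := HT a' b' a'' b'' (Rmin_r _ _) (Rmax_r _ _)).
        assert (K3 := H a b Ha Hb). assert (K4 := H a' b' Ha' Hb').
        change (Rabs (RInt g a' b' - RInt g a b) < eps).
        replace (RInt g a' b' - RInt g a b) with
          ((RInt g a'' b'' - RInt g a b) - (RInt g a'' b'' - RInt g a' b')) by ring.
        eapply Rle_lt_trans; [apply Rabs_triang|]. rewrite Rabs_Ropp. lra.
    - exists l. apply is_RInt_gen_intro; [exact Hg|]. intros eps He.
      destruct (Hl (fun y => Rabs (y - l) < eps)) as [Q1 Q2 [M1 HQ1] [M2 HQ2] HQ].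
      + exists (mkposreal eps He). intros y Hy. exact Hy.
      + exists (Rmax (- M1) M2). intros a b Ha Hb. apply (HQ a b).
        * apply HQ1. generalize (Rmax_l (- M1) M2); lra.
        * apply HQ2. generalize (Rmax_r (- M1) M2); lra. }
  destruct EX as [l Hl].
  assert (El : RInt_gen g minfty pinfty = l) by (apply is_RInt_gen_unique; exact Hl).
  rewrite El. split; [exact Hl|]. intros a b.
  (* If the bound failed by [eps], enlarging the interval until its integral is within [eps] of [l]
     would contradict [HT]. *)
  apply Rnot_lt_le. intros Hlt.
  set (eps := Rabs (l - RInt g a b) - C0 * atan_tail a b).
  assert (He : 0 < eps) by (unfold eps; lra).
  destruct (Hl (fun y => Rabs (y - l) < eps)) as [Q1 Q2 [M1 HQ1] [M2 HQ2] HQ].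
  { exists (mkposreal eps He). intros y Hy. exact Hy. }
  set (a' := Rmin a (M1 - 1)). set (b' := Rmax b (M2 + 1)).
  destruct (HQ a' b') as [y [Hy1 Hy2]].
  { apply HQ1. unfold a'. generalize (Rmin_r a (M1 - 1)); lra. }
  { apply HQ2. unfold b'. generalize (Rmax_r b (M2 + 1)); lra. }
  simpl in Hy1. apply (is_RInt_unique (V := R_CompleteNormedModule)) in Hy1. subst y.
  assert (K := HT a b a' b' (Rmin_l _ _) (Rmax_l _ _)).
  assert (T := Rabs_triang (RInt g a' b' - RInt g a b) (l - RInt g a' b')).
  replace (RInt g a' b' - RInt g a b + (l - RInt g a' b')) with (l - RInt g a b) in T by ring.
  rewrite Rabs_minus_sym in Hy2. unfold eps in Hy2. lra.
Qed.

Definition CRInt (g : R -> C) (a b : R) : C :=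
  (RInt (fun x => Re (g x)) a b, RInt (fun x => Im (g x)) a b).

Definition decays (C0 : R) (g : R -> C) : Prop := forall x, Cmod (g x) <= C0 / (1 + x ^ 2).

Lemma decays_re C0 g : decays C0 g -> forall x, Rabs (Re (g x)) <= C0 / (1 + x ^ 2).
Proof. intros H x. eapply Rle_trans; [apply re_le_Cmod|apply H]. Qed.

Lemma decays_im C0 g : decays C0 g -> forall x, Rabs (Im (g x)) <= C0 / (1 + x ^ 2).
Proof. intros H x. eapply Rle_trans; [apply im_le_Cmod|apply H]. Qed.

Lemma CInt_correct g C0 : Ccont g -> decays C0 g ->
  is_CInt g minfty pinfty (CInt g minfty pinfty).
Proof.
  intros Hg HC. split.
  - exact (proj1 (RInt_gen_decay _ C0 (fun x => proj1 (Hg x)) (decays_re _ _ HC))).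
  - exact (proj1 (RInt_gen_decay _ C0 (fun x => proj2 (Hg x)) (decays_im _ _ HC))).
Qed.

Lemma CInt_tail g C0 a b : Ccont g -> decays C0 g ->
  Cmod (CInt g minfty pinfty - CRInt g a b)%C <= 2 * C0 * atan_tail a b.
Proof.
  intros Hg HC. eapply Rle_trans; [apply Cmod_le_sum|].
  assert (H1 := proj2 (RInt_gen_decay _ C0 (fun x => proj1 (Hg x)) (decays_re _ _ HC)) a b).
  assert (H2 := proj2 (RInt_gen_decay _ C0 (fun x => proj2 (Hg x)) (decays_im _ _ HC)) a b).
  replace (2 * C0 * atan_tail a b) with (C0 * atan_tail a b + C0 * atan_tail a b) by ring.
  apply Rplus_le_compat; [exact H1|exact H2].
Qed.

Lemma CRInt_bound g C0 a b : Ccont g -> decays C0 g -> Cmod (CRInt g a b) <= 2 * PI * C0.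
Proof.
  intros Hg HC. eapply Rle_trans; [apply Cmod_le_sum|].
  assert (H1 := RInt_bound_atan _ C0 a b (fun x => proj1 (Hg x)) (decays_re _ _ HC)).
  assert (H2 := RInt_bound_atan _ C0 a b (fun x => proj2 (Hg x)) (decays_im _ _ HC)).
  assert (HP := decay_const_pos _ _ (decays_re _ _ HC)).
  assert (Rabs (atan b - atan a) <= PI).
  { apply Rabs_le. generalize (atan_bound a) (atan_bound b). lra. }
  apply Rle_trans with (C0 * Rabs (atan b - atan a) + C0 * Rabs (atan b - atan a)).
  - apply Rplus_le_compat; [exact H1|exact H2].
  - nra.
Qed.

(** The tail estimate for the degenerate interval from 0 to 0, where [atan_tail 0 0] is [PI]. *)
Lemma CInt_bound g C0 : Ccont g -> decays C0 g -> Cmod (CInt g minfty pinfty) <= 2 * PI * C0.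
Proof.
  intros Hg HC. replace (CInt g minfty pinfty) with (CInt g minfty pinfty - CRInt g 0 0)%C.
  - eapply Rle_trans; [exact (CInt_tail g C0 0 0 Hg HC)|]. unfold atan_tail. right; ring.
  - unfold CRInt. rewrite !RInt_point. apply C_eq; simpl; unfold zero; simpl; ring.
Qed.

Lemma is_CInt_unique g Fa Fb {FFa : ProperFilter' Fa} {FFb : ProperFilter' Fb} z :
  is_CInt g Fa Fb z -> CInt g Fa Fb = z.
Proof.
  intros [H1 H2]. apply C_eq; simpl; now apply is_RInt_gen_unique.
Qed.

Lemma is_CInt_plus f g Fa Fb {FFa : Filter Fa} {FFb : Filter Fb} z w :
  is_CInt f Fa Fb z -> is_CInt g Fa Fb w -> is_CInt (fun x => f x + g x)%C Fa Fb (z + w)%C.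
Proof.
  intros [H1 H2] [H3 H4]; split; simpl.
  - now apply (is_RInt_gen_plus (V := R_NormedModule)).
  - now apply (is_RInt_gen_plus (V := R_NormedModule)).
Qed.

Lemma is_CInt_scal c f Fa Fb {FFa : Filter Fa} {FFb : Filter Fb} z :
  is_CInt f Fa Fb z -> is_CInt (fun x => c * f x)%C Fa Fb (c * z)%C.
Proof.
  intros [H1 H2]; destruct c as [u v]; split; simpl.
  - apply (is_RInt_gen_minus (V := R_NormedModule));
    now apply (is_RInt_gen_scal (V := R_NormedModule)).
  - apply (is_RInt_gen_plus (V := R_NormedModule));
    now apply (is_RInt_gen_scal (V := R_NormedModule)).
Qed.

Lemma Ccont_ex_RInt g a b : Ccont g ->
  ex_RInt (fun x => Re (g x)) a b /\ ex_RInt (fun x => Im (g x)) a b.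
Proof.
  intros Hg; split; apply (ex_RInt_continuous (V := R_CompleteNormedModule)); intros x _.
  - exact (proj1 (Hg x)).
  - exact (proj2 (Hg x)).
Qed.

Lemma CRInt_plus f g a b : Ccont f -> Ccont g ->
  CRInt (fun x => f x + g x)%C a b = (CRInt f a b + CRInt g a b)%C.
Proof.
  intros Hf Hg. destruct (Ccont_ex_RInt f a b Hf), (Ccont_ex_RInt g a b Hg).
  apply C_eq; simpl; now apply (RInt_plus (V := R_CompleteNormedModule)).
Qed.

Lemma CRInt_scal c f a b : Ccont f -> CRInt (fun x => c * f x)%C a b = (c * CRInt f a b)%C.
Proof.
  intros Hf. destruct (Ccont_ex_RInt f a b Hf) as [H1 H2]. destruct c as [u v].
  apply C_eq; simpl.
  - rewrite (RInt_minus (V := R_CompleteNormedModule) (fun x => u * fst (f x)) (fun x => v * snd (f x))).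
    + unfold minus, plus, opp; simpl.
      rewrite !(RInt_scal (V := R_CompleteNormedModule)) by assumption. reflexivity.
    + now apply (ex_RInt_scal (V := R_NormedModule)).
    + now apply (ex_RInt_scal (V := R_NormedModule)).
  - rewrite (RInt_plus (V := R_CompleteNormedModule) (fun x => u * snd (f x)) (fun x => v * fst (f x))).
    + unfold plus; simpl.
      rewrite !(RInt_scal (V := R_CompleteNormedModule)) by assumption. reflexivity.
    + now apply (ex_RInt_scal (V := R_NormedModule)).
    + now apply (ex_RInt_scal (V := R_NormedModule)).
Qed.

Lemma CRInt_Chasles g a b c : Ccont g -> (CRInt g a b + CRInt g b c)%C = CRInt g a c.
Proof.
  intros Hg. destruct (Ccont_ex_RInt g a b Hg), (Ccont_ex_RInt g b c Hg).
  apply C_eq; simpl; now apply (RInt_Chasles (V := R_CompleteNormedModule)).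
Qed.

Lemma CRInt_Cder F f a b : (forall x, Cder F x (f x)) -> Ccont f -> CRInt f a b = (F b - F a)%C.
Proof.
  intros HF Hf. apply C_eq; simpl; apply (is_RInt_unique (V := R_CompleteNormedModule)).
  - apply (is_RInt_derive (V := R_CompleteNormedModule) (fun x => Re (F x))).
    + intros x _; exact (proj1 (HF x)).
    + intros x _; exact (proj1 (Hf x)).
  - apply (is_RInt_derive (V := R_CompleteNormedModule) (fun x => Im (F x))).
    + intros x _; exact (proj2 (HF x)).
    + intros x _; exact (proj2 (Hf x)).
Qed.

Lemma is_CInt_intro g z : Ccont g ->
  (forall eps, 0 < eps -> exists M, forall a b, a < - M -> M < b ->
     Cmod (CRInt g a b - z)%C < eps) ->
  is_CInt g minfty pinfty z.
Proof.
  intros Hg H. split.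
  - apply (is_RInt_gen_intro _ _ (fun x => proj1 (Hg x))).
    intros eps He; destruct (H eps He) as [M HM]; exists M; intros a b Ha Hb.
    eapply Rle_lt_trans; [|exact (HM a b Ha Hb)]. exact (re_le_Cmod (CRInt g a b - z)%C).
  - apply (is_RInt_gen_intro _ _ (fun x => proj2 (Hg x))).
    intros eps He; destruct (H eps He) as [M HM]; exists M; intros a b Ha Hb.
    eapply Rle_lt_trans; [|exact (HM a b Ha Hb)]. exact (im_le_Cmod (CRInt g a b - z)%C).
Qed.

Lemma inv_sqr_small C0 eps : 0 <= C0 -> 0 < eps -> exists M, 0 < M /\
  forall x, M < Rabs x -> C0 / (1 + x ^ 2) < eps.
Proof.
  intros HC He. exists (C0 / eps + 1). split.
  { generalize (Rdiv_le_0_compat C0 eps HC He); lra. }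
  intros x Hx. assert (Hp := one_plus_sqr_pos x).
  assert (Hq := Rdiv_le_0_compat C0 eps HC He).
  assert (C0 / eps < 1 + x ^ 2) by (rewrite <- pow2_abs; nra).
  apply Rmult_lt_compat_r with (r := eps) in H; [|exact He].
  replace (C0 / eps * eps) with C0 in H by (field; lra).
  apply Rmult_lt_reg_r with (1 + x ^ 2); [exact Hp|].
  replace (C0 / (1 + x ^ 2) * (1 + x ^ 2)) with C0 by (field; lra). lra.
Qed.

Lemma is_CInt_Cder F f C0 : (forall x, Cder F x (f x)) -> Ccont f -> decays C0 F ->
  is_CInt f minfty pinfty (RtoC 0).
Proof.
  intros HF Hf HC. assert (C0_pos := decay_const_pos _ _ (decays_re _ _ HC)).
  apply is_CInt_intro; [exact Hf|]. intros eps He.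
  destruct (inv_sqr_small C0 (eps / 2) C0_pos ltac:(lra)) as [M [HM HS]].
  exists M. intros a b Ha Hb. rewrite (CRInt_Cder F) by trivial.
  replace (F b - F a - RtoC 0)%C with (F b + - F a)%C by ring.
  eapply Rle_lt_trans; [apply Cmod_triangle|]. rewrite Cmod_opp.
  assert (H1 := HC a). assert (H2 := HC b).
  assert (H3 := HS a). assert (H4 := HS b).
  rewrite Rabs_left in H3 by lra. rewrite Rabs_pos_eq in H4 by lra.
  specialize (H3 ltac:(lra)). specialize (H4 ltac:(lra)). lra.
Qed.

(** * Interchange of a tempered distribution with an integral *)

(** One constant plays the role of a norm. Decay gives absolute convergence with explicit tails; the
    Lipschitz bound gives continuity and makes [int_b^(b+h) g - h g(b)] of order [h^2]. *)
Definition lipdec (K : R) (g : R -> C) : Prop :=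
  decays K g /\ forall x y, Cmod (g x - g y)%C <= K * Rabs (x - y).

Lemma lipdec_pos K g : lipdec K g -> 0 <= K.
Proof.
  intros [H _]. exact (decay_const_pos _ _ (decays_re _ _ H)).
Qed.

Lemma lipdec_cont K g : lipdec K g -> Ccont g.
Proof.
  intros [_ H] x; split.
  - apply (Lipschitz_continuous _ K). intros u v. eapply Rle_trans; [|apply H].
    exact (re_le_Cmod (g u - g v)%C).
  - apply (Lipschitz_continuous _ K). intros u v. eapply Rle_trans; [|apply H].
    exact (im_le_Cmod (g u - g v)%C).
Qed.

Lemma decays_weaken K K' g : K <= K' -> decays K g -> decays K' g.
Proof.
  intros HK H x. eapply Rle_trans; [apply H|]. unfold Rdiv.
  apply Rmult_le_compat_r; [|exact HK]. left. apply Rinv_0_lt_compat, one_plus_sqr_pos.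
Qed.

Lemma lipdec_weaken K K' g : K <= K' -> lipdec K g -> lipdec K' g.
Proof.
  intros HK [H1 H2]. split; [now apply (decays_weaken K)|]. intros x y.
  eapply Rle_trans; [apply H2|]. apply Rmult_le_compat_r; [apply Rabs_pos|exact HK].
Qed.

Lemma decays_plus K L f g : decays K f -> decays L g -> decays (K + L) (fun x => f x + g x)%C.
Proof.
  intros Hf Hg x. eapply Rle_trans; [apply Cmod_triangle|].
  unfold Rdiv. rewrite Rmult_plus_distr_r. apply Rplus_le_compat; [apply Hf|apply Hg].
Qed.

Lemma decays_scal K c g : decays K g -> decays (Cmod c * K) (fun x => c * g x)%C.
Proof.
  intros Hg x. rewrite Cmod_mult. unfold Rdiv. rewrite Rmult_assoc.
  apply Rmult_le_compat_l; [apply Cmod_ge_0|apply Hg].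
Qed.

Lemma lipdec_plus K L f g : lipdec K f -> lipdec L g -> lipdec (K + L) (fun x => f x + g x)%C.
Proof.
  intros [F1 F2] [G1 G2]; split; [now apply decays_plus|]. intros x y.
  replace (f x + g x - (f y + g y))%C with ((f x - f y) + (g x - g y))%C by ring.
  eapply Rle_trans; [apply Cmod_triangle|]. rewrite Rmult_plus_distr_r.
  apply Rplus_le_compat; [apply F2|apply G2].
Qed.

Lemma lipdec_scal K c g : lipdec K g -> lipdec (Cmod c * K) (fun x => c * g x)%C.
Proof.
  intros [G1 G2]; split; [now apply decays_scal|]. intros x y.
  replace (c * g x - c * g y)%C with (c * (g x - g y))%C by ring.
  rewrite Cmod_mult, Rmult_assoc. apply Rmult_le_compat_l; [apply Cmod_ge_0|apply G2].
Qed.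

(* Point evaluation, integration over an interval or over the line, and the differences
   of these are all of this kind; the constant [c] records their size. *)
Definition bounded_functional (c : R) (J : (R -> C) -> C) : Prop :=
  (forall f g K L, lipdec K f -> lipdec L g -> J (fun x => f x + g x)%C = (J f + J g)%C) /\
  (forall z g K, lipdec K g -> J (fun x => z * g x)%C = (z * J g)%C) /\
  (forall g K, lipdec K g -> Cmod (J g) <= c * K).

Lemma bounded_functional_minus c J f g K L : bounded_functional c J -> lipdec K f -> lipdec L g ->
  J (fun x => f x - g x)%C = (J f - J g)%C.
Proof.
  intros [H1 [H2 _]] Hf Hg. rewrite Cminus_fun.
  rewrite (H1 f (fun x => - RtoC 1 * g x)%C K (Cmod (- RtoC 1) * L)).
  - rewrite (H2 _ g L) by trivial. ring.
  - exact Hf.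
  - now apply lipdec_scal.
Qed.

(** A quadratic remainder is the form in which Taylor estimates survive the application of a bounded
    functional; dividing by [h] leaves an error of order [h]. *)
Lemma Cder_of_remainder (F : R -> C) (t : R) (l : C) (M : R) :
  (forall h, Rabs h <= 1 -> Cmod (F (t + h)%R - F t - RtoC h * l)%C <= M * h ^ 2) -> Cder F t l.
Proof.
  intros H.
  assert (W : forall (f : R -> R) d, 
    (forall h, Rabs h <= 1 -> Rabs (f (t + h) - f t - h * d) <= M * h ^ 2) -> is_derive f t d).
  { clear. intros f d H. apply is_derive_Reals. intros eps He.
    assert (Hd : 0 < Rmin 1 (eps / (Rabs M + 1))).
    { apply Rmin_glb_lt; [lra|]. apply Rdiv_lt_0_compat; [lra|]. generalize (Rabs_pos M); lra. }
    exists (mkposreal _ Hd). simpl. intros h Hh0 Hh.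
    assert (Hh1 := Rlt_le_trans _ _ _ Hh (Rmin_l _ _)).
    assert (Hh2 := Rlt_le_trans _ _ _ Hh (Rmin_r _ _)).
    assert (Hp : 0 < Rabs h) by now apply Rabs_pos_lt.
    replace ((f (t + h) - f t) / h - d) with ((f (t + h) - f t - h * d) / h) by (field; trivial).
    unfold Rdiv. rewrite Rabs_mult, Rabs_inv.
    apply Rle_lt_trans with (Rabs M * Rabs h ^ 2 * / Rabs h).
    - apply Rmult_le_compat_r; [left; now apply Rinv_0_lt_compat|].
      eapply Rle_trans; [apply H; lra|]. rewrite pow2_abs.
      apply Rmult_le_compat_r; [apply pow2_ge_0|apply Rle_abs].
    - replace (Rabs M * Rabs h ^ 2 * / Rabs h) with (Rabs M * Rabs h) by (field; lra).
      assert (HM : 0 < Rabs M + 1) by (generalize (Rabs_pos M); lra).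
      apply Rmult_lt_compat_l with (r := Rabs M + 1) in Hh2; [|exact HM].
      replace ((Rabs M + 1) * (eps / (Rabs M + 1))) with eps in Hh2 by (field; lra). lra. }
  split; apply W; intros h Hh; (eapply Rle_trans; [|exact (H h Hh)]).
  - eapply Rle_trans; [|apply re_le_Cmod]. right; f_equal. simpl. unfold Re; ring.
  - eapply Rle_trans; [|apply im_le_Cmod]. right; f_equal. simpl. unfold Im; ring.
Qed.

(** Differentiation under [J]. The Taylor remainder in [t] is, as a function of [xi], again of class
    [lipdec] with constant [4 K h^2]: its decay comes from the decay of [D2], and its Lipschitz
    bound from Taylor applied to the difference of the kernels at two values of [xi]. *)
Lemma bounded_functional_der c J D0 D1 D2 t0 K : bounded_functional c J ->
  (forall xi t, Rabs (t - t0) <= 1 -> Cder (D0 xi) t (D1 xi t)) ->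
  (forall xi t, Rabs (t - t0) <= 1 -> Cder (D1 xi) t (D2 xi t)) ->
  (forall t, Rabs (t - t0) <= 1 -> lipdec K (fun xi => D0 xi t)) ->
  lipdec K (fun xi => D1 xi t0) ->
  (forall t, Rabs (t - t0) <= 1 -> lipdec K (fun xi => D2 xi t)) ->
  Cder (fun t => J (fun xi => D0 xi t)) t0 (J (fun xi => D1 xi t0)).
Proof.
  intros HJ H01 H12 L0 L1 L2.
  apply (Cder_of_remainder _ _ _ (c * (4 * K))). intros h Hh.
  assert (Hh' : Rabs (t0 + h - t0) <= 1) by (replace (t0 + h - t0) with h by ring; exact Hh).
  assert (H0 : Rabs (t0 - t0) <= 1) by (rewrite Rminus_diag, Rabs_R0; lra).
  assert (HI : forall x, Rmin t0 (t0 + h) <= x <= Rmax t0 (t0 + h) -> Rabs (x - t0) <= 1).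
  { intros x. revert Hh. unfold Rmin, Rmax, Rabs; repeat destruct Rle_dec; repeat destruct Rcase_abs; lra. }
  destruct HJ as [J1 [J2 J3]].
  rewrite <- (bounded_functional_minus c J _ _ K K); [|split; auto|auto|auto].
  rewrite <- (J2 h _ K L1).
  rewrite <- (bounded_functional_minus c J _ _ (K + Cmod (- RtoC 1) * K) (Cmod h * K));
    [|split; auto| |].
  - rewrite Rmult_assoc. apply J3. split.
    + intros xi.
      replace (RtoC h) with (RtoC (t0 + h - t0)) by (f_equal; ring).
      eapply Rle_trans; [apply (Taylor2_bound (D0 xi) (D1 xi) (D2 xi) (K / (1 + xi ^ 2)))|]; auto.
      * intros x Hx. apply (L2 x); auto.
      * replace (t0 + h - t0) with h by ring. rewrite pow2_abs. right; field.
        generalize (one_plus_sqr_pos xi); lra.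
    + intros x y.
      replace (D0 x (t0 + h)%R - D0 x t0 - h * D1 x t0 - (D0 y (t0 + h)%R - D0 y t0 - h * D1 y t0))%C
       with ((D0 x (t0 + h)%R - D0 y (t0 + h)%R) - (D0 x t0 - D0 y t0) - h * (D1 x t0 - D1 y t0))%C by ring.
      replace (RtoC h) with (RtoC (t0 + h - t0)) by (f_equal; ring).
      eapply Rle_trans; [apply (Taylor2_bound (fun t => D0 x t - D0 y t)%C
        (fun t => D1 x t - D1 y t)%C (fun t => D2 x t - D2 y t)%C (K * Rabs (x - y)))|].
      * intros u Hu. apply Cder_minus; auto.
      * intros u Hu. apply Cder_minus; auto.
      * intros u Hu. apply (L2 u); auto.
      * replace (t0 + h - t0) with h by ring. rewrite pow2_abs. right; ring.
  - rewrite Cminus_fun. apply lipdec_plus; [auto|]. apply lipdec_scal; auto.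
  - now apply lipdec_scal.
Qed.

(** [D j] is the j-th derivative in [t] of the integrand [D 0]. With [xi] the integration variable,
    the second clause says that [xi |-> D 0 xi] is Lipschitz and decaying as a map into the Schwartz
    space, seminorm by seminorm. *)
Definition lipdec_family (D : nat -> R -> R -> C) : Prop :=
  (forall j xi t, Cder (D j xi) t (D (S j) xi t)) /\
  (forall a j, exists K, forall t, lipdec K (fun xi => RtoC (Rabs t ^ a) * D j xi t)%C).

Lemma family_lipdec D j : lipdec_family D -> exists K, forall t, lipdec K (fun xi => D j xi t).
Proof.
  intros [_ H]. destruct (H 0%nat j) as [K HK]. exists K. intros t.
  replace (fun xi => D j xi t) with (fun xi => RtoC (Rabs t ^ 0) * D j xi t)%C; [auto|].
  apply functional_extensionality; intros; simpl; ring.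
Qed.

Lemma family_der D c J j t : lipdec_family D -> bounded_functional c J ->
  Cder (fun t => J (fun xi => D j xi t)) t (J (fun xi => D (S j) xi t)).
Proof.
  intros HD HJ. destruct (family_lipdec D j HD) as [K0 H0].
  destruct (family_lipdec D (S j) HD) as [K1 H1].
  destruct (family_lipdec D (S (S j)) HD) as [K2 H2].
  apply (bounded_functional_der c J (D j) (D (S j)) (D (S (S j))) t (Rmax K0 (Rmax K1 K2)) HJ).
  - intros; apply HD.
  - intros; apply HD.
  - intros; eapply lipdec_weaken; [|apply H0]. apply Rmax_l.
  - eapply lipdec_weaken; [|apply H1]. eapply Rle_trans; [apply Rmax_l|apply Rmax_r].
  - intros; eapply lipdec_weaken; [|apply H2]. eapply Rle_trans; [apply Rmax_r|apply Rmax_r].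
Qed.

Lemma family_smooth D c J : lipdec_family D -> bounded_functional c J ->
  Csmooth (fun t => J (fun xi => D 0%nat xi t)).
Proof.
  intros HD HJ. apply (Csmooth_class (fun f => exists j, f = fun t => J (fun xi => D j xi t))).
  - intros f [j ->]. exists (fun t => J (fun xi => D (S j) xi t)). split; [|eauto].
    intros t. now apply (family_der D c).
  - eauto.
Qed.

Lemma family_CDerive_n D c J n : lipdec_family D -> bounded_functional c J ->
  CDerive_n (fun t => J (fun xi => D 0%nat xi t)) n = fun t => J (fun xi => D n xi t).
Proof.
  intros HD HJ. induction n as [|n IH]; [apply CDerive_n_0|].
  replace (S n) with (1 + n)%nat by lia. rewrite <- CDerive_n_comp, IH.
  apply CDerive_n_1. intros t. now apply (family_der D c).
Qed.

(** By linearity the weight and the [t]-derivatives pass inside [J]. The constant [K] is chosen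
    before [J], so a small functional [J] produces a function of [t] that is small in the
    seminorms. *)
Lemma family_seminorm D N : lipdec_family D -> exists K, 0 <= K /\ forall c J, bounded_functional c J ->
  seminorm_le N (fun t => J (fun xi => D 0%nat xi t)) (c * K).
Proof.
  intros HD.
  destruct (finite_bound (fun a K => forall j, (j <= N)%nat -> forall t,
     lipdec K (fun xi => RtoC (Rabs t ^ a) * D j xi t)%C)) with (N := N) as [K HK].
  - intros n A B HA HAB j Hj t. eapply lipdec_weaken; eauto.
  - intros a. apply (finite_bound (fun j K => forall t,
      lipdec K (fun xi => RtoC (Rabs t ^ a) * D j xi t)%C)).
    + intros n A B HA HAB t. eapply lipdec_weaken; eauto.
    + intros j. apply HD.
  - exists K. split.
    { apply (lipdec_pos _ _ (HK 0%nat (Nat.le_0_l _) 0%nat (Nat.le_0_l _) 0)). }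
    intros c J HJ a b Ha Hb t. rewrite (family_CDerive_n D c) by trivial.
    destruct (family_lipdec D b HD) as [L HL].
    rewrite <- (Rabs_pos_eq (Rabs t ^ a)) by apply Rabs_pow_pos.
    rewrite <- Cmod_R, <- Cmod_mult. destruct HJ as [J1 [J2 J3]].
    rewrite <- (J2 (RtoC (Rabs t ^ a)) _ L) by auto. apply J3. now apply HK.
Qed.

Lemma family_schwartz D c J : lipdec_family D -> bounded_functional c J ->
  schwartz (fun t => J (fun xi => D 0%nat xi t)).
Proof.
  intros HD HJ. apply schwartz_of_seminorm; [now apply (family_smooth D c)|].
  intros N. destruct (family_seminorm D N HD) as [K [_ HK]]. eauto.
Qed.

Lemma bounded_CInt : bounded_functional (2 * PI) (fun g => CInt g minfty pinfty).
Proof.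
  split; [|split].
  - intros f g K L Hf Hg. apply is_CInt_unique; try typeclasses eauto.
    apply is_CInt_plus; try typeclasses eauto.
    + apply (CInt_correct f K); [eapply lipdec_cont; eauto|apply Hf].
    + apply (CInt_correct g L); [eapply lipdec_cont; eauto|apply Hg].
  - intros z g K Hg. apply is_CInt_unique; try typeclasses eauto.
    apply is_CInt_scal; try typeclasses eauto.
    apply (CInt_correct g K); [eapply lipdec_cont; eauto|apply Hg].
  - intros g K Hg. apply CInt_bound; [eapply lipdec_cont; eauto|apply Hg].
Qed.

Lemma bounded_CRInt a b : bounded_functional (2 * PI) (fun g => CRInt g a b).
Proof.
  split; [|split].
  - intros f g K L Hf Hg. apply CRInt_plus; eapply lipdec_cont; eauto.
  - intros z g K Hg. apply CRInt_scal; eapply lipdec_cont; eauto.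
  - intros g K Hg. apply CRInt_bound; [eapply lipdec_cont; eauto|apply Hg].
Qed.

Lemma bounded_eval x : bounded_functional 1 (fun g => g x).
Proof.
  split; [|split]; trivial. intros g K [Hg _]. rewrite Rmult_1_l.
  eapply Rle_trans; [apply Hg|]. assert (HK := decay_const_pos _ _ (decays_re _ _ Hg)).
  apply Rle_div_l; [apply one_plus_sqr_pos|]. generalize (pow2_ge_0 x). nra.
Qed.

(** The constant [e] is free rather than [c + d]: what matters are differences of functionals that
    nearly cancel. *)
Lemma bounded_minus c d e J J' : bounded_functional c J -> bounded_functional d J' ->
  (forall g K, lipdec K g -> Cmod (J g - J' g)%C <= e * K) ->
  bounded_functional e (fun g => J g - J' g)%C.
Proof.
  intros [H1 [H2 _]] [H3 [H4 _]] He. split; [|split].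
  - intros f g K L Hf Hg. rewrite (H1 f g K L), (H3 f g K L) by trivial. ring.
  - intros z g K Hg. rewrite (H2 z g K), (H4 z g K) by trivial. ring.
  - exact He.
Qed.

Lemma bounded_mult c z J : bounded_functional c J ->
  bounded_functional (Cmod z * c) (fun g => z * J g)%C.
Proof.
  intros [H1 [H2 H3]]. split; [|split].
  - intros f g K L Hf Hg. rewrite (H1 f g K L) by trivial. ring.
  - intros w g K Hg. rewrite (H2 w g K) by trivial. ring.
  - intros g K Hg. rewrite Cmod_mult, Rmult_assoc. apply Rmult_le_compat_l; [apply Cmod_ge_0|auto].
Qed.

Lemma CRInt_near g K b h : lipdec K g ->
  Cmod (CRInt g b (b + h) - RtoC h * g b)%C <= 2 * h ^ 2 * K.
Proof.
  intros Hg. assert (Hc := lipdec_cont _ _ Hg). assert (HK := lipdec_pos _ _ Hg).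
  assert (W : forall f : R -> R, (forall x, continuous f x) ->
    (forall x y, Rabs (f x - f y) <= K * Rabs (x - y)) ->
    Rabs (RInt f b (b + h) - h * f b) <= h ^ 2 * K).
  { clear -HK. intros f Hf HL.
    assert (E : RInt f b (b + h) - h * f b = RInt (fun x => f x - f b) b (b + h)).
    { rewrite (RInt_minus (V := R_CompleteNormedModule) f (fun _ => f b)).
      - rewrite RInt_const. unfold minus, plus, opp, scal; simpl. unfold mult; simpl. ring.
      - apply (ex_RInt_continuous (V := R_CompleteNormedModule)); auto.
      - apply (ex_RInt_const (V := R_NormedModule)). }
    rewrite E. clear E.
    assert (X : forall u v, ex_RInt (fun x => f x - f b) u v).
    { intros. apply (ex_RInt_continuous (V := R_CompleteNormedModule)). intros x _.
      apply (continuous_minus (K := R_AbsRing) (V := R_NormedModule)); [auto|apply continuous_const]. }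
    assert (B : forall x, Rmin b (b + h) <= x <= Rmax b (b + h) -> Rabs (f x - f b) <= K * Rabs h).
    { intros x Hx. eapply Rle_trans; [apply HL|]. apply Rmult_le_compat_l; [exact HK|].
      revert Hx. unfold Rmin, Rmax, Rabs; repeat destruct Rle_dec; repeat destruct Rcase_abs; lra. }
    replace (h ^ 2 * K) with (Rabs h * (K * Rabs h)) by (rewrite <- pow2_abs; ring).
    destruct (Rle_dec 0 h) as [Hh|Hh].
    - eapply Rle_trans.
      + apply (abs_RInt_le_const (fun x => f x - f b) b (b + h) (K * Rabs h)); [lra|apply X|].
        intros t Ht. apply B. rewrite Rmin_left, Rmax_right; lra.
      + replace (b + h - b) with h by ring. rewrite (Rabs_pos_eq h) by lra. lra.
    - rewrite <- (opp_RInt_swap (V := R_CompleteNormedModule)) by apply X.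
      change (opp ?a) with (- a). rewrite Rabs_Ropp. eapply Rle_trans.
      + apply (abs_RInt_le_const (fun x => f x - f b) (b + h) b (K * Rabs h)); [lra|apply X|].
        intros t Ht. apply B. rewrite Rmin_right, Rmax_left; lra.
      + replace (b - (b + h)) with (- h) by ring. rewrite (Rabs_left h) by lra. lra. }
  eapply Rle_trans; [apply Cmod_le_sum|].
  assert (H1 := W (fun x => Re (g x)) (fun x => proj1 (Hc x))
    (fun x y => Rle_trans _ _ _ (re_le_Cmod (g x - g y)%C) (proj2 Hg x y))).
  assert (H2 := W (fun x => Im (g x)) (fun x => proj2 (Hc x))
    (fun x y => Rle_trans _ _ _ (im_le_Cmod (g x - g y)%C) (proj2 Hg x y))).
  replace (2 * h ^ 2 * K) with (h ^ 2 * K + h ^ 2 * K) by ring.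
  apply Rplus_le_compat.
  - eapply Rle_trans; [|exact H1]. right; f_equal. simpl. unfold Re; ring.
  - eapply Rle_trans; [|exact H2]. right; f_equal. simpl. unfold Re, Im; ring.
Qed.

(* The interchange of [T] with the integral is the fundamental theorem of calculus:
   [b |-> T (int_0^b H)] has derivative [T (H b)], and the tails are small in every seminorm. *)
Lemma tempered_CInt T D : tempered T -> lipdec_family D ->
  is_CInt (fun xi => T (D 0%nat xi)) minfty pinfty
    (T (fun t => CInt (fun xi => D 0%nat xi t) minfty pinfty)).
Proof.
  intros HT HD.
  destruct (tempered_bound T HT) as [N [M [HM HTb]]].
  destruct (family_seminorm D N HD) as [K [HK HDb]].
  destruct (family_lipdec D 0%nat HD) as [L HL].
  (* [Th J] applies [J] in [xi] and then [T] in [t]. Evaluation, interval integrals and the integral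
     over the line become values of one additive bounded map, and the proof reduces to comparing
     these functionals on functions of class [lipdec]. *)
  set (Th := fun J => T (fun t => J (fun xi => D 0%nat xi t)) : C).
  assert (Thb : forall c J, bounded_functional c J -> Cmod (Th J) <= M * (c * K)).
  { intros c J HJ. apply HTb; [now apply (family_schwartz D c)|auto]. }
  assert (Thm : forall c d J J', bounded_functional c J -> bounded_functional d J' ->
    Th (fun g => J g - J' g)%C = (Th J - Th J')%C).
  { intros c d J J' HJ HJ'. unfold Th.
    apply (tempered_minus T (fun t => J (fun xi => D 0%nat xi t)) (fun t => J' (fun xi => D 0%nat xi t)));
    trivial; eapply family_schwartz; eauto. }
  assert (Ths : forall c z J, bounded_functional c J -> Th (fun g => z * J g)%C = (z * Th J)%C).
  { intros c z J HJ. unfold Th. apply (proj1 (proj2 HT)). eapply family_schwartz; eauto. }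
  assert (Hder : forall b, Cder (fun b => Th (fun g => CRInt g 0 b)) b (T (D 0%nat b))).
  { intros b. apply (Cder_of_remainder _ _ _ (M * (2 * K))). intros h Hh.
    change (T (D 0%nat b)) with (Th (fun g => g b)).
    (* This crude constant is there to make [Th] additive on the next difference; the bound of order
       [h^2] comes from [CRInt_near]. *)
    assert (B1 : bounded_functional (2 * PI + 2 * PI) (fun g => CRInt g 0 (b + h) - CRInt g 0 b)%C).
    { eapply bounded_minus; [apply bounded_CRInt|apply bounded_CRInt|].
      intros g K0 Hg. unfold Cminus. eapply Rle_trans; [apply Cmod_triangle|]. rewrite Cmod_opp, Rmult_plus_distr_r.
      apply Rplus_le_compat; apply bounded_CRInt; exact Hg. }
    rewrite <- (Thm (2 * PI) (2 * PI)) by apply bounded_CRInt.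
    rewrite <- (Ths 1) by apply bounded_eval.
    rewrite <- (Thm _ _ _ _ B1 (bounded_mult _ (RtoC h) _ (bounded_eval b))).
    eapply Rle_trans; [apply (Thb (2 * h ^ 2))|right; ring].
    eapply bounded_minus; [exact B1|apply bounded_mult, bounded_eval|].
    intros g K0 Hg. rewrite <- (CRInt_Chasles g 0 b (b + h)) by (eapply lipdec_cont; eauto).
    replace (CRInt g 0 b + CRInt g b (b + h) - CRInt g 0 b - RtoC h * g b)%C with
     (CRInt g b (b + h) - RtoC h * g b)%C by ring.
    now apply CRInt_near. }
  assert (Hcont : Ccont (fun xi => T (D 0%nat xi))).
  { assert (Hl : forall x y, Cmod (T (D 0%nat x) - T (D 0%nat y))%C <= M * K * Rabs (x - y)).
    { intros x y. change (Cmod (Th (fun g => g x) - Th (fun g => g y))%C <= M * K * Rabs (x - y)).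
      rewrite <- (Thm 1 1) by apply bounded_eval.
      eapply Rle_trans; [apply (Thb (Rabs (x - y)))|right; ring].
      eapply bounded_minus; [apply bounded_eval|apply bounded_eval|].
      intros g K0 [_ Hg]. rewrite Rmult_comm. apply Hg. }
    intros x; split; apply (Lipschitz_continuous _ (M * K)); intros u v;
    (eapply Rle_trans; [|apply Hl]).
    - exact (re_le_Cmod (T (D 0%nat u) - T (D 0%nat v))%C).
    - exact (im_le_Cmod (T (D 0%nat u) - T (D 0%nat v))%C). }
  apply is_CInt_intro; [exact Hcont|]. intros eps He.
  assert (HP : 0 <= M * (2 * K)) by nra.
  destruct (atan_tail_small (eps / (M * (2 * K) + 1))) as [A [HA HS]].
  { apply Rdiv_lt_0_compat; lra. }
  exists A. intros a b Ha Hb.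
  rewrite (CRInt_Cder _ _ a b Hder Hcont).
  change (T (fun t => CInt (fun xi => D 0%nat xi t) minfty pinfty)) with
    (Th (fun g => CInt g minfty pinfty)).
  (* By [Hder] this difference is the integral of [T (D 0 xi)] over [[a,b]]. Written as a single
     value of [Th], it differs from the claimed limit by a functional of size
     [2 * atan_tail a b]. *)
  assert (Eq : Th (fun g => CRInt g a b) = (Th (fun g => CRInt g 0%R b) - Th (fun g => CRInt g 0%R a))%C).
  { rewrite <- (Thm (2 * PI) (2 * PI)) by apply bounded_CRInt. unfold Th. f_equal.
    apply functional_extensionality; intros t.
    rewrite <- (CRInt_Chasles _ 0 a b) by (eapply lipdec_cont; apply HL). ring. }
  rewrite <- Eq. replace (Th (fun g => CRInt g a b) - Th (fun g => CInt g minfty pinfty))%C with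
    (- (Th (fun g => CInt g minfty pinfty) - Th (fun g => CRInt g a b)))%C by ring.
  rewrite Cmod_opp, <- (Thm (2 * PI) (2 * PI)) by (apply bounded_CRInt || apply bounded_CInt).
  eapply Rle_lt_trans; [apply (Thb (2 * atan_tail a b))|].
  - eapply bounded_minus; [apply bounded_CInt|apply bounded_CRInt|].
    intros g K0 Hg. replace (2 * atan_tail a b * K0) with (2 * K0 * atan_tail a b) by ring.
    apply CInt_tail; [eapply lipdec_cont; eauto|apply Hg].
  - specialize (HS a b Ha Hb). assert (T0 := atan_tail_pos a b).
    apply Rmult_lt_compat_l with (r := M * (2 * K) + 1) in HS; [|lra].
    replace ((M * (2 * K) + 1) * (eps / (M * (2 * K) + 1))) with eps in HS by (field; lra).
    nra.
Qed.

(** * The Fourier transform on the Schwartz space *)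

Lemma Cder_fourier_kernel xi y :
  Cder (fun y => Cexp (- Ci * RtoC (xi * y))%C) y (- Ci * RtoC xi * Cexp (- Ci * RtoC (xi * y)))%C.
Proof.
  replace (fun y => Cexp (- Ci * RtoC (xi * y))%C) with (fun y => Cexp ((- Ci * RtoC xi) * RtoC y)%C).
  - replace (- Ci * RtoC (xi * y))%C with ((- Ci * RtoC xi) * RtoC y)%C by (rewrite RtoC_mult; ring).
    apply Cder_Cexp.
  - apply functional_extensionality; intros z. f_equal. rewrite RtoC_mult; ring.
Qed.

Lemma Cder_fourier_kernel_freq xi y :
  Cder (fun xi => Cexp (- Ci * RtoC (xi * y))%C) xi (- Ci * RtoC y * Cexp (- Ci * RtoC (xi * y)))%C.
Proof.
  replace (fun xi => Cexp (- Ci * RtoC (xi * y))%C) with (fun xi => Cexp (- Ci * RtoC (y * xi))%C)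
    by (apply functional_extensionality; intros z; now rewrite Rmult_comm).
  rewrite (Rmult_comm xi y). apply Cder_fourier_kernel.
Qed.

Definition fourier_integrand (f : R -> C) (xi y : R) : C :=
  (Cexp (- Ci * RtoC (xi * y)) * f y)%C.

(** The constant grows linearly in [xi] because differentiating the kernel in [y] brings down the
    factor [-i xi]. A Schwartz factor in the frequency later absorbs this growth. *)
Lemma lipdec_fourier_integrand f : schwartz f -> exists K, 0 <= K /\
  forall xi, lipdec (K * (1 + Rabs xi)) (fourier_integrand f xi).
Proof.
  intros Hf. assert (Hf' := schwartz_CDerive_n 1 f Hf).
  destruct (schwartz_decay f Hf 0) as [K0 [P0 H0]].
  destruct (schwartz_decay _ Hf' 0) as [K1 [P1 H1]].
  exists (2 * (K0 + K1)). split; [lra|]. intros xi.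
  assert (Hxi := Rabs_pos xi).
  assert (B : forall K y, 0 <= K -> K / (1 + y ^ 2) <= K).
  { intros K y HK. apply Rle_div_l; [apply one_plus_sqr_pos|]. generalize (pow2_ge_0 y). nra. }
  split.
  - intros y. unfold fourier_integrand. rewrite Cmod_mult, Cmod_Cexp_imag, Rmult_1_l.
    specialize (H0 y). simpl (Rabs y ^ 0) in H0. rewrite Rmult_1_l in H0.
    eapply Rle_trans; [exact H0|]. unfold Rdiv.
    apply Rmult_le_compat_r; [left; apply Rinv_0_lt_compat, one_plus_sqr_pos|]. nra.
  - intros x y.
    replace (2 * (K0 + K1) * (1 + Rabs xi) * Rabs (x - y)) with
      (2 * ((K0 + K1) * (1 + Rabs xi)) * Rabs (x - y)) by ring.
    apply (Cder_bound (fourier_integrand f xi) (fun z =>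
       - Ci * RtoC xi * Cexp (- Ci * RtoC (xi * z)) * f z +
        Cexp (- Ci * RtoC (xi * z)) * CDerive_n f 1 z)%C).
    + intros z _. apply Cder_mult; [apply Cder_fourier_kernel|apply Cder_D, schwartz_smooth, Hf].
    + intros z _. eapply Rle_trans; [apply Cmod_triangle|].
      rewrite !Cmod_mult, Cmod_Cexp_imag, Cmod_opp, Cmod_Ci, Cmod_R.
      specialize (H0 z). specialize (H1 z). simpl (Rabs z ^ 0) in *.
      assert (B0 := B K0 z P0). assert (B1 := B K1 z P1). nra.
Qed.

(** The operator that becomes differentiation on the Fourier side. *)
Definition times_freq (f : R -> C) : R -> C := fun y => (- Ci * RtoC y * f y)%C.

Lemma Scont_times_freq : Scont times_freq.
Proof. apply (Scont_multiplier (fun y => - Ci * RtoC y)%C). apply multiplier_linear. Qed.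

Lemma schwartz_times_freq f : schwartz f -> schwartz (times_freq f).
Proof. apply Scont_schwartz, Scont_times_freq. Qed.

Lemma fourier_integrand_der f xi y :
  Cder (fun xi => fourier_integrand f xi y) xi (fourier_integrand (times_freq f) xi y).
Proof.
  eapply Cder_eq.
  - apply Cder_mult; [apply Cder_fourier_kernel_freq|apply Cder_const].
  - unfold fourier_integrand, times_freq. ring.
Qed.

Lemma fourier_der f xi : schwartz f -> Cder (fourier f) xi (fourier (times_freq f) xi).
Proof.
  intros Hf. assert (Hf1 := schwartz_times_freq f Hf). assert (Hf2 := schwartz_times_freq _ Hf1).
  destruct (lipdec_fourier_integrand f Hf) as [K0 [P0 H0]].
  destruct (lipdec_fourier_integrand _ Hf1) as [K1 [P1 H1]].
  destruct (lipdec_fourier_integrand _ Hf2) as [K2 [P2 H2]].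
  apply Cder_scal.
  (* The [lipdec] constants depend on the frequency, but differentiation is local: on
     [Rabs (t - xi) <= 1] one constant serves. *)
  assert (W : forall K t, 0 <= K -> K <= K0 + K1 + K2 -> Rabs (t - xi) <= 1 ->
    K * (1 + Rabs t) <= (K0 + K1 + K2) * (2 + Rabs xi)).
  { intros K t HK HKK Ht. assert (T := Rabs_triang (t - xi) xi).
    replace (t - xi + xi) with t in T by ring. generalize (Rabs_pos t) (Rabs_pos xi). nra. }
  apply (bounded_functional_der (2 * PI) (fun g => CInt g minfty pinfty)
    (fun y t => fourier_integrand f t y) (fun y t => fourier_integrand (times_freq f) t y)
    (fun y t => fourier_integrand (times_freq (times_freq f)) t y) xi
    ((K0 + K1 + K2) * (2 + Rabs xi)) bounded_CInt).
  - intros; apply fourier_integrand_der.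
  - intros; apply fourier_integrand_der.
  - intros t Ht. apply (lipdec_weaken _ _ _ (W K0 t P0 ltac:(lra) Ht) (H0 t)).
  - apply (lipdec_weaken _ _ _ (W K1 xi P1 ltac:(lra) ltac:(rewrite Rminus_diag, Rabs_R0; lra)) (H1 xi)).
  - intros t Ht. apply (lipdec_weaken _ _ _ (W K2 t P2 ltac:(lra) Ht) (H2 t)).
Qed.

Lemma fourier_smooth f : schwartz f -> Csmooth (fourier f).
Proof.
  intros Hf. apply (Csmooth_class (fun h => exists f, schwartz f /\ h = fourier f)); [|eauto].
  clear. intros h [f [Hf ->]]. exists (fourier (times_freq f)). split.
  - intros x. now apply fourier_der.
  - exists (times_freq f). split; [now apply schwartz_times_freq|reflexivity].
Qed.

Lemma CInt_fourier_integrand f xi : schwartz f ->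
  is_CInt (fourier_integrand f xi) minfty pinfty (CInt (fourier_integrand f xi) minfty pinfty).
Proof.
  intros Hf. destruct (lipdec_fourier_integrand f Hf) as [K [_ H]].
  apply (CInt_correct _ (K * (1 + Rabs xi))); [exact (lipdec_cont _ _ (H xi))|apply H].
Qed.

(** Integration by parts: [e^(-i xi z) f(z)] decays at both ends, so the integral of its derivative
    vanishes. *)
Lemma fourier_CDerive f : schwartz f ->
  fourier (CDerive_n f 1) = fun xi => (Ci * RtoC xi * fourier f xi)%C.
Proof.
  intros Hf. apply functional_extensionality; intros xi.
  assert (Hf' := schwartz_CDerive_n 1 f Hf).
  destruct (schwartz_decay f Hf 0) as [K0 [P0 H0]].
  assert (Z : is_CInt (fun z => - Ci * RtoC xi * fourier_integrand f xi z +
     fourier_integrand (CDerive_n f 1) xi z)%C minfty pinfty (RtoC 0)).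
  { apply (is_CInt_Cder (fourier_integrand f xi) _ K0).
    - intros z. eapply Cder_eq.
      + apply Cder_mult; [apply Cder_fourier_kernel|apply Cder_D, schwartz_smooth, Hf].
      + unfold fourier_integrand. ring.
    - destruct (lipdec_fourier_integrand f Hf) as [K [_ HK]].
      destruct (lipdec_fourier_integrand _ Hf') as [K' [_ HK']].
      apply Ccont_plus; [apply Ccont_mult; [apply Ccont_const|]|].
      + exact (lipdec_cont _ _ (HK xi)).
      + exact (lipdec_cont _ _ (HK' xi)).
    - intros z. unfold fourier_integrand. rewrite Cmod_mult, Cmod_Cexp_imag.
      specialize (H0 z). simpl in *. lra. }
  assert (Y := is_CInt_plus _ _ minfty pinfty _ _
    (is_CInt_scal (- Ci * RtoC xi)%C _ minfty pinfty _ (CInt_fourier_integrand f xi Hf))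
    (CInt_fourier_integrand _ xi Hf')).
  apply is_CInt_unique in Z; [|typeclasses eauto|typeclasses eauto].
  apply is_CInt_unique in Y; [|typeclasses eauto|typeclasses eauto].
  rewrite Z in Y. unfold fourier.
  change (fun y => (Cexp (- Ci * RtoC (xi * y)) * CDerive_n f 1 y)%C) with (fourier_integrand (CDerive_n f 1) xi).
  change (fun y => (Cexp (- Ci * RtoC (xi * y)) * f y)%C) with (fourier_integrand f xi).
  replace (CInt (fourier_integrand (CDerive_n f 1) xi) minfty pinfty)
   with (Ci * RtoC xi * CInt (fourier_integrand f xi) minfty pinfty)%C.
  - ring.
  - set (A := CInt (fourier_integrand f xi) minfty pinfty) in *.
    set (B := CInt (fourier_integrand (CDerive_n f 1) xi) minfty pinfty) in *.
    transitivity ((- Ci * RtoC xi * A + B) + Ci * RtoC xi * A)%C; [rewrite <- Y|]; ring.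
Qed.

Lemma fourier_CDerive_n f n : schwartz f ->
  fourier (CDerive_n f n) = fun xi => ((Ci * RtoC xi) ^ n * fourier f xi)%C.
Proof.
  intros Hf. induction n as [|n IH].
  - rewrite CDerive_n_0. apply functional_extensionality; intros xi; simpl; ring.
  - replace (S n) with (1 + n)%nat by lia. rewrite <- CDerive_n_comp.
    rewrite fourier_CDerive by now apply schwartz_CDerive_n.
    rewrite IH. apply functional_extensionality; intros xi; simpl; ring.
Qed.

Lemma Cmod_fourier f xi B : schwartz f -> seminorm_le 2 f B ->
  Cmod (fourier f xi) <= / sqrt (2 * PI) * (2 * PI * (2 * B)).
Proof.
  intros Hf HB. assert (Hp := PI_RGT_0).
  assert (0 < sqrt (2 * PI)) by (apply sqrt_lt_R0; lra).
  unfold fourier. rewrite Cmod_mult, Cmod_R, Rabs_pos_eq by (left; now apply Rinv_0_lt_compat).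
  apply Rmult_le_compat_l; [left; now apply Rinv_0_lt_compat|].
  destruct (lipdec_fourier_integrand f Hf) as [K [_ HK]].
  apply CInt_bound; [exact (lipdec_cont _ _ (HK xi))|].
  intros y. rewrite Cmod_mult, Cmod_Cexp_imag, Rmult_1_l.
  assert (H0 := HB 0%nat 0%nat ltac:(lia) ltac:(lia) y).
  assert (H2 := HB 2%nat 0%nat ltac:(lia) ltac:(lia) y).
  rewrite CDerive_n_0 in *. rewrite pow2_abs in H2. simpl (Rabs y ^ 0) in H0.
  apply (proj1 (Rle_div_r _ _ _ (one_plus_sqr_pos y))). lra.
Qed.

(** A power of the frequency is traded for a derivative of [f], a derivative for [times_freq]. Both
    inductions end at the sup bound [Cmod_fourier], the one place where the integral is
    estimated. *)
Lemma Scont_fourier : Scont fourier.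
Proof.
  apply Scont_of_seminorms; [apply fourier_smooth|]. intros a b.
  assert (Base : exists (N' : nat) (M : R), 0 <= M /\ forall f B, schwartz f -> seminorm_le N' f B ->
    forall x, Rabs x ^ a * Cmod (fourier f x) <= M * B).
  { induction a as [|a [N [M [HM IH]]]].
    - exists 2%nat, (/ sqrt (2 * PI) * (2 * PI * 2)). split.
      + assert (Hp := PI_RGT_0). assert (0 < sqrt (2 * PI)) by (apply sqrt_lt_R0; lra).
        apply Rmult_le_pos; [left; now apply Rinv_0_lt_compat|lra].
      + intros f B Hf HB x. simpl. rewrite Rmult_1_l.
        eapply Rle_trans; [now apply Cmod_fourier; eauto|right; ring].
    - exists (1 + N)%nat, M. split; [exact HM|]. intros f B Hf HB x.
      assert (H := IH (CDerive_n f 1) B (schwartz_CDerive_n 1 f Hf) (seminorm_le_CDerive_n N 1 f B HB) x).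
      rewrite fourier_CDerive, !Cmod_mult, Cmod_Ci, Cmod_R in H by trivial.
      simpl. lra. }
  induction b as [|b [N [M [HM IH]]]].
  - destruct Base as [N [M [HM H]]]. exists N, M. split; [exact HM|].
    intros f B Hf HB x. rewrite CDerive_n_0. now apply H.
  - destruct (proj2 Scont_times_freq N) as [N' [M' [HM' H']]].
    exists N', (M * M'). split; [now apply Rmult_le_pos|].
    intros f B Hf HB x.
    rewrite (CDerive_n_succ _ (fourier (times_freq f))) by (intros; now apply fourier_der).
    rewrite Rmult_assoc. apply IH; [now apply schwartz_times_freq|now apply H'].
Qed.

Lemma schwartz_fourier f : schwartz f -> schwartz (fourier f).
Proof. apply Scont_schwartz, Scont_fourier. Qed.

(** The j-th derivative in [t] of [g(t) e^(-i t xi) f(xi)]: each differentiation hits [g] or turns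
    [f] into [times_freq f]. Recursion on the pair of functions leaves the terms ungrouped and so
    avoids binomial coefficients. *)
Fixpoint exp_family (f g : R -> C) (j : nat) : R -> R -> C :=
  match j with
  | O => fun xi t => (g t * fourier_integrand f t xi)%C
  | S j => fun xi t => (exp_family f (CDerive_n g 1) j xi t + exp_family (times_freq f) g j xi t)%C
  end.

Lemma family_exp f g : schwartz f -> schwartz g -> lipdec_family (exp_family f g).
Proof.
  intros Hf Hg. split.
  - intros j; revert f g Hf Hg. induction j as [|j IH]; intros f g Hf Hg xi t.
    + simpl. apply (Cder_mult g (fun t => fourier_integrand f t xi)); [apply Cder_D, schwartz_smooth, Hg|].
      apply (fourier_integrand_der f t xi).
    + apply (Cder_plus (exp_family f (CDerive_n g 1) j xi) (exp_family (times_freq f) g j xi));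
      apply IH; trivial;
      [now apply schwartz_CDerive_n|now apply schwartz_times_freq].
  - intros a j; revert f g Hf Hg. induction j as [|j IH]; intros f g Hf Hg.
    + destruct (lipdec_fourier_integrand f Hf) as [K [HK H]].
      (* The index exceeds [a] by one to absorb the factor [1 + Rabs t] in the constant of
         [lipdec_fourier_integrand]. *)
      destruct (schwartz_seminorm g Hg (a + 1)) as [B HB].
      assert (HB0 := seminorm_le_pos _ _ _ HB).
      exists (K * (2 * B)). intros t. simpl.
      replace (fun xi => (RtoC (Rabs t ^ a) * (g t * fourier_integrand f t xi))%C) with
        (fun xi => (RtoC (Rabs t ^ a) * g t * fourier_integrand f t xi)%C)
        by (apply functional_extensionality; intros; ring).
      eapply lipdec_weaken; [|apply lipdec_scal, (H t)].
      rewrite Cmod_mult, Cmod_R, (Rabs_pos_eq (Rabs t ^ a)) by apply Rabs_pow_pos.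
      assert (H1 := HB a 0%nat ltac:(lia) ltac:(lia) t).
      assert (H2 := HB (a + 1)%nat 0%nat ltac:(lia) ltac:(lia) t).
      rewrite CDerive_n_0 in *. rewrite pow_add, pow_1 in H2.
      replace (Rabs t ^ a * Cmod (g t) * (K * (1 + Rabs t))) with
       (K * (Rabs t ^ a * Cmod (g t) + Rabs t ^ a * Rabs t * Cmod (g t))) by ring.
      apply Rmult_le_compat_l; [exact HK|lra].
    + destruct (IH f (CDerive_n g 1) Hf (schwartz_CDerive_n 1 g Hg)) as [K1 H1].
      destruct (IH (times_freq f) g (schwartz_times_freq f Hf) Hg) as [K2 H2].
      exists (K1 + K2). intros t. simpl.
      replace (fun xi => (RtoC (Rabs t ^ a) * (exp_family f (CDerive_n g 1) j xi t +
         exp_family (times_freq f) g j xi t))%C) with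
       (fun xi => (RtoC (Rabs t ^ a) * exp_family f (CDerive_n g 1) j xi t +
         RtoC (Rabs t ^ a) * exp_family (times_freq f) g j xi t)%C)
        by (apply functional_extensionality; intros; ring).
      apply lipdec_plus; auto.
Qed.

(** The pure exponential in [t] is not a test function; the Schwartz factor [g] makes it one. For
    Laplace transforms [g] is the cut-off exponential, for the multiplication formula it is a
    translate of a Schwartz function. *)
Lemma tempered_fourier T f g : tempered T -> schwartz f -> schwartz g ->
  is_CInt (fun xi => T (fun t => g t * fourier_integrand f t xi)%C) minfty pinfty
    (T (fun t => g t * (RtoC (sqrt (2 * PI)) * fourier f t))%C).
Proof.
  intros HT Hf Hg.
  assert (H := tempered_CInt T _ HT (family_exp f g Hf Hg)). simpl in H.
  replace (fun t => (g t * (RtoC (sqrt (2 * PI)) * fourier f t))%C) with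
    (fun t => CInt (fun xi => g t * fourier_integrand f t xi)%C minfty pinfty); [exact H|].
  apply functional_extensionality; intros t.
  rewrite (is_CInt_unique _ minfty pinfty _
    (is_CInt_scal (g t) _ minfty pinfty _ (CInt_fourier_integrand f t Hf))).
  f_equal. unfold fourier. fold (fourier_integrand f t).
  assert (0 < sqrt (2 * PI)) by (apply sqrt_lt_R0; generalize PI_RGT_0; lra).
  rewrite Cmult_assoc, <- RtoC_mult, Rinv_r by lra. rewrite Cmult_1_l. reflexivity.
Qed.

(** * Convolution integrands *)

Definition conv_family (phi f : R -> C) (j : nat) : R -> R -> C :=
  fun x t => (RtoC ((-1) ^ j) * CDerive_n f j (x - t) * phi x)%C.

Lemma family_conv phi f : schwartz phi -> schwartz f -> lipdec_family (conv_family phi f).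
Proof.
  intros Hphi Hf. split.
  - intros j x t. eapply Cder_eq.
    + apply Cder_mult; [|apply Cder_const]. apply Cder_scal.
      apply (Cder_comp (CDerive_n f j) (fun t => x - t) t (CDerive_n f (S j) (x - t)) (-1)).
      * apply Cder_CDerive_n, schwartz_smooth, Hf.
      * auto_derive; trivial; ring.
    + unfold conv_family. simpl. rewrite RtoC_mult. ring.
  - intros a j.
    (* The Lipschitz estimate in [x] differentiates [f] once more than the order [j] of the family,
       hence the extra index. *)
    destruct (schwartz_seminorm f Hf (a + j + 1)) as [B HB].
    assert (HB0 := seminorm_le_pos _ _ _ HB).
    set (F := 2 ^ (a + j + 1) * (2 * B)).
    assert (HF : 0 <= F) by (apply Rmult_le_pos; [apply pow_le|]; lra).
    destruct (decay_weight phi Hphi a) as [K0 [P0 H0]].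
    destruct (decay_weight _ (schwartz_CDerive_n 1 phi Hphi) a) as [K1 [P1 H1]].
    (* The weight in [t] is split between [x], where [phi] decays, and [x - t], where [f] does. *)
    assert (Hw : forall x t, Rabs t ^ a <= (1 + Rabs x) ^ a * (1 + Rabs (x - t)) ^ a).
    { intros x t. rewrite <- Rpow_mult_distr. apply pow_incr. split; [apply Rabs_pos|].
      assert (T := Rabs_triang x (- (x - t))). rewrite Rabs_Ropp in T.
      replace (x + - (x - t)) with t in T by ring.
      generalize (Rabs_pos x) (Rabs_pos (x - t)). nra. }
    assert (Hb : forall (chi : R -> C) K i x t, (i <= S j)%nat ->
      (1 + Rabs x) ^ a * Cmod (chi x) <= K / (1 + x ^ 2) ->
      Rabs t ^ a * (Cmod (CDerive_n f i (x - t)) * Cmod (chi x)) <= F * K / (1 + x ^ 2)).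
    { intros chi K i x t Hi HK.
      assert (H := seminorm_le_weight _ _ _ a i (x - t) HB ltac:(lia) ltac:(lia)). fold F in H.
      replace (F * K / (1 + x ^ 2)) with (F * (K / (1 + x ^ 2))) by (unfold Rdiv; ring).
      eapply Rle_trans; [apply Rmult_le_compat_r; [|apply (Hw x t)]|].
      - apply Rmult_le_pos; apply Cmod_ge_0.
      - replace ((1 + Rabs x) ^ a * (1 + Rabs (x - t)) ^ a *
          (Cmod (CDerive_n f i (x - t)) * Cmod (chi x))) with
          (((1 + Rabs (x - t)) ^ a * Cmod (CDerive_n f i (x - t))) * ((1 + Rabs x) ^ a * Cmod (chi x))) by ring.
        apply Rmult_le_compat; trivial.
        + apply Rmult_le_pos; [|apply Cmod_ge_0]. apply pow_le. generalize (Rabs_pos (x - t)); lra.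
        + apply Rmult_le_pos; [|apply Cmod_ge_0]. apply pow_le. generalize (Rabs_pos x); lra. }
    assert (Dn : forall K x, 0 <= K -> K / (1 + x ^ 2) <= K).
    { intros K y HK. apply Rle_div_l; [apply one_plus_sqr_pos|]. generalize (pow2_ge_0 y). nra. }
    assert (Sg : Cmod (RtoC ((-1) ^ j)) = 1).
    { rewrite Cmod_R, pow_1_abs. reflexivity. }
    exists (2 * (F * K0 + F * K1)). intros t.
    assert (Q0 : 0 <= F * K0) by now apply Rmult_le_pos.
    assert (Q1 : 0 <= F * K1) by now apply Rmult_le_pos.
    split.
    + intros x. unfold conv_family.
      rewrite !Cmod_mult, Sg, Cmod_R, Rabs_pos_eq, Rmult_1_l by apply Rabs_pow_pos.
      eapply Rle_trans; [apply (Hb phi K0 j x t); [lia|apply H0]|].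
      unfold Rdiv. apply Rmult_le_compat_r; [left; apply Rinv_0_lt_compat, one_plus_sqr_pos|lra].
    + intros x y.
      apply (Cder_bound (fun x => RtoC (Rabs t ^ a) * conv_family phi f j x t)%C
        (fun x => RtoC (Rabs t ^ a) * (RtoC ((-1) ^ j) * CDerive_n f (S j) (x - t) * phi x +
           RtoC ((-1) ^ j) * CDerive_n f j (x - t) * CDerive_n phi 1 x))%C).
      * intros z _. apply Cder_scal. apply Cder_mult; [|apply Cder_D, schwartz_smooth, Hphi].
        apply Cder_scal. eapply Cder_eq.
        -- apply (Cder_comp (CDerive_n f j) (fun x => x - t) z (CDerive_n f (S j) (z - t)) 1).
           ++ apply Cder_CDerive_n, schwartz_smooth, Hf.
           ++ auto_derive; trivial; ring.
        -- ring.
      * intros z _. rewrite Cmod_mult, Cmod_R, Rabs_pos_eq by apply Rabs_pow_pos.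
        eapply Rle_trans; [apply Rmult_le_compat_l; [apply Rabs_pow_pos|apply Cmod_triangle]|].
        rewrite !Cmod_mult, Sg, !Rmult_1_l, Rmult_plus_distr_l.
        assert (E0 := Hb phi K0 (S j) z t ltac:(lia) (H0 z)).
        assert (E1 := Hb (CDerive_n phi 1) K1 j z t ltac:(lia) (H1 z)).
        assert (D0 := Dn (F * K0) z Q0). assert (D1 := Dn (F * K1) z Q1). lra.
Qed.

Lemma tempered_conv T phi f : tempered T -> schwartz phi -> schwartz f ->
  is_CInt (fun x => conv T f x * phi x)%C minfty pinfty
    (T (fun t => CInt (fun x => f (x - t)%R * phi x)%C minfty pinfty)).
Proof.
  intros HT Hphi Hf.
  assert (H := tempered_CInt T _ HT (family_conv phi f Hphi Hf)).
  replace (fun x => (conv T f x * phi x)%C) with (fun x => T (conv_family phi f 0 x)).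
  - replace (fun t => CInt (fun x => f (x - t)%R * phi x)%C minfty pinfty) with
     (fun t => CInt (fun xi => conv_family phi f 0 xi t) minfty pinfty); [exact H|].
    apply functional_extensionality; intros t. f_equal. apply functional_extensionality; intros x.
    unfold conv_family. rewrite CDerive_n_0. simpl. ring.
  - apply functional_extensionality; intros x. unfold conv.
    rewrite Cmult_comm, <- (proj1 (proj2 HT)).
    + f_equal. apply functional_extensionality; intros t.
      unfold conv_family. rewrite CDerive_n_0. simpl. ring.
    + replace (fun t => f (x - t)) with (fun t => f (x + (-1) * t))
        by (apply functional_extensionality; intros; f_equal; ring).
      apply schwartz_affine; [exact Hf|]. rewrite Rabs_left; lra.
Qed.

(** * A smooth cutoff at the origin *)

(** The n-th power of [y/n <= exp (y/n)]. *)
Lemma pow_le_exp n y : 0 <= y -> y ^ n <= INR n ^ n * exp y.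
Proof.
  intros Hy. destruct n as [|n].
  - simpl. rewrite Rmult_1_l. generalize (exp_ineq1_le y). lra.
  - set (m := S n). assert (Hm : 0 < INR m) by (apply lt_0_INR; unfold m; lia).
    assert (E : forall i z, exp z ^ i = exp (INR i * z)).
    { intros i z. induction i as [|i IH].
      - simpl. now rewrite Rmult_0_l, exp_0.
      - rewrite S_INR. simpl pow. rewrite IH, <- exp_plus. f_equal. ring. }
    replace y with (INR m * (y / INR m)) at 1 2 by (field; lra).
    rewrite Rpow_mult_distr, <- E. apply Rmult_le_compat_l; [apply pow_le; lra|].
    assert (H0 : 0 <= y / INR m) by (apply Rdiv_le_0_compat; lra).
    apply pow_incr. split; [exact H0|]. generalize (exp_ineq1_le (y / INR m)). lra.
Qed.

(** The powers of [1/x] are included so that the linear span of the family is closed under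
    differentiation. *)
Definition flat (k : nat) (x : R) : R :=
  if Rle_dec x 0 then 0 else (/ x) ^ k * exp (- / x).

Lemma flat_le_0 k x : x <= 0 -> flat k x = 0.
Proof. intros H. unfold flat. destruct Rle_dec; lra. Qed.

Lemma flat_pos x : 0 < x -> 0 < flat 0 x.
Proof. intros H. unfold flat. destruct Rle_dec; [lra|]. simpl. rewrite Rmult_1_l. apply exp_pos. Qed.

(** [pow_le_exp] with exponent [k + 2] at [1/x]. A quadratic bound is what [Cder_of_remainder]
    requires for a zero derivative at the origin. *)
Lemma flat_quadratic k : exists M, forall x, Rabs (flat k x) <= M * x ^ 2.
Proof.
  exists (INR (k + 2) ^ (k + 2)). intros x. unfold flat. destruct Rle_dec as [H|H].
  - rewrite Rabs_R0. apply Rmult_le_pos; [apply pow_le, pos_INR|apply pow2_ge_0].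
  - assert (Hx : 0 < / x) by (apply Rinv_0_lt_compat; lra).
    assert (P := pow_le_exp (k + 2) (/ x) ltac:(lra)).
    rewrite Rabs_pos_eq by (apply Rmult_le_pos; [apply pow_le; lra|left; apply exp_pos]).
    replace ((/ x) ^ k * exp (- / x)) with ((/ x) ^ (k + 2) * / exp (/ x) * x ^ 2).
    + apply Rmult_le_compat_r; [apply pow2_ge_0|].
      apply (proj2 (Rle_div_l _ _ _ (exp_pos (/ x)))). exact P.
    + rewrite pow_add, exp_Ropp, !pow_inv. field.
      repeat split; try lra; try apply pow_nonzero; try lra.
      generalize (exp_pos (/ x)); lra.
Qed.

Lemma flat_der k x : is_derive (flat k) x (- INR k * flat (k + 1) x + flat (k + 2) x).
Proof.
  destruct (Rlt_dec x 0) as [H|H]; [|destruct (Req_dec x 0) as [->|H0]].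
  - rewrite !flat_le_0 by lra.
    apply (is_derive_ext_loc (fun _ => 0)).
    + exists (mkposreal (- x) ltac:(lra)). intros y Hy. symmetry. apply flat_le_0.
      unfold ball in Hy; simpl in Hy. unfold AbsRing_ball, abs, minus, plus, opp in Hy; simpl in Hy.
      revert Hy. unfold Rabs; destruct Rcase_abs; lra.
    + eapply is_derive_eq; [apply (is_derive_const (K := R_AbsRing) (V := R_NormedModule))|].
      unfold zero; simpl; ring.
  - rewrite !flat_le_0 by lra. destruct (flat_quadratic k) as [M HM].
    destruct (Cder_of_remainder (fun y => RtoC (flat k y)) 0 (RtoC 0) M) as [Hd _].
    + intros h _. rewrite (flat_le_0 k 0), Rplus_0_l by lra.
      replace (RtoC (flat k h) - 0 - h * 0)%C with (RtoC (flat k h)) by ring.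
      rewrite Cmod_R. apply HM.
    + eapply is_derive_eq; [exact Hd|]. simpl. ring.
  - assert (Hx : 0 < x) by lra.
    apply (is_derive_ext_loc (fun y => (/ y) ^ k * exp (- / y))).
    + exists (mkposreal x Hx). intros y Hy. unfold flat. destruct Rle_dec as [Hy'|]; [|reflexivity].
      unfold ball in Hy; simpl in Hy. unfold AbsRing_ball, abs, minus, plus, opp in Hy; simpl in Hy.
      revert Hy. unfold Rabs; destruct Rcase_abs; lra.
    + unfold flat. destruct Rle_dec; [lra|]. auto_derive; [repeat split; lra|].
      rewrite !pow_add. destruct k as [|k].
      * simpl. field. lra.
      * simpl pred. replace ((/ x) ^ S k) with (/ x * (/ x) ^ k) by reflexivity.
        field. lra.
Qed.

Inductive flat_comb : (R -> C) -> Prop :=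
| flat_scal c k : flat_comb (fun x => c * RtoC (flat k x))%C
| flat_add f g : flat_comb f -> flat_comb g -> flat_comb (fun x => f x + g x)%C.

Lemma flat_smooth k : Csmooth (fun x => RtoC (flat k x)).
Proof.
  apply (Csmooth_class flat_comb).
  - intros f Hf. induction Hf as [c k0|f g _ [f' [Hf Cf]] _ [g' [Hg Cg]]].
    + exists (fun x => (- c * RtoC (INR k0)) * RtoC (flat (k0 + 1) x) + c * RtoC (flat (k0 + 2) x))%C.
      split; [|apply flat_add; apply flat_scal].
      intros x. eapply Cder_eq; [apply Cder_scal, Cder_RtoC, flat_der|].
      rewrite RtoC_plus, RtoC_mult, RtoC_opp. ring.
    + exists (fun x => f' x + g' x)%C. split; [|now apply flat_add].
      intros x. apply Cder_plus; auto.
  - replace (fun x => RtoC (flat k x)) with (fun x => (RtoC 1 * RtoC (flat k x))%C); [constructor|].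
    apply functional_extensionality; intros; ring.
Qed.

Lemma CDerive_n_ext_loc f g n x : locally (T := R_UniformSpace) x (fun t => f t = g t) ->
  CDerive_n f n x = CDerive_n g n x.
Proof.
  intros H. apply C_eq; simpl; apply Derive_n_ext_loc;
  (eapply filter_imp; [|exact H]); intros t Ht; now rewrite Ht.
Qed.

Lemma locally_lt (a x : R) : x < a -> locally (T := R_UniformSpace) x (fun t => t < a).
Proof. intros H. apply (open_lt a). exact H. Qed.

Lemma locally_gt (a x : R) : a < x -> locally (T := R_UniformSpace) x (fun t => a < t).
Proof. intros H. apply (open_gt a). exact H. Qed.

Lemma CDerive_n_lt f g a n x : (forall t, t < a -> f t = g t) -> x < a ->
  CDerive_n f n x = CDerive_n g n x.
Proof.
  intros H Hx. apply CDerive_n_ext_loc. eapply filter_imp; [|apply (locally_lt a x Hx)]. exact H.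
Qed.

Lemma CDerive_n_gt f g a n x : (forall t, a < t -> f t = g t) -> a < x ->
  CDerive_n f n x = CDerive_n g n x.
Proof.
  intros H Hx. apply CDerive_n_ext_loc. eapply filter_imp; [|apply (locally_gt a x Hx)]. exact H.
Qed.

Lemma Ccont_bounded f a b : Ccont f -> a <= b -> exists M, forall t, a <= t <= b -> Cmod (f t) <= M.
Proof.
  intros Hf Hab.
  destruct (continuity_ab_maj (fun t => Rabs (Re (f t)) + Rabs (Im (f t))) a b Hab) as [m [Hm _]].
  - intros c _. apply continuity_pt_plus; apply (continuity_pt_comp _ Rabs).
    + apply continuity_pt_filterlim. exact (proj1 (Hf c)).
    + apply Rcontinuity_abs.
    + apply continuity_pt_filterlim. exact (proj2 (Hf c)).
    + apply Rcontinuity_abs.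
  - eexists. intros t Ht. eapply Rle_trans; [apply Cmod_le_sum|]. apply (Hm t Ht).
Qed.

Lemma cutoff_exists : exists chi : R -> C, Csmooth chi /\
  (forall t, t <= -1 -> chi t = RtoC 0) /\ (forall t, - / 2 <= t -> chi t = RtoC 1) /\
  forall n, exists M, 0 <= M /\ forall i, (i <= n)%nat -> forall t, Cmod (CDerive_n chi i t) <= M.
Proof.
  (* A smooth bump, positive on [(-1, -1/2)] and zero elsewhere; its normalized primitive is the
     cutoff. Ending the transition at [-1/2] leaves a neighbourhood of [[0,+oo)] on which the cutoff
     is 1. *)
  set (b := fun x => flat 0 (1 + x) * flat 0 (- / 2 - x)).
  assert (Sb : Csmooth (fun x => RtoC (b x))).
  { replace (fun x => RtoC (b x)) with (fun x => RtoC (flat 0 (1 + 1 * x)) * RtoC (flat 0 (- / 2 + (-1) * x)))%C.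
    - apply Csmooth_mult; apply (Csmooth_comp_affine (fun x => RtoC (flat 0 x))); apply flat_smooth.
    - apply functional_extensionality; intros x. rewrite <- RtoC_mult. unfold b.
      f_equal. f_equal; f_equal; ring. }
  assert (Cb : forall x, continuous b x) by (intros x; exact (proj1 (Ccont_smooth _ Sb x))).
  assert (Ib : forall u v, ex_RInt b u v)
    by (intros; apply (ex_RInt_continuous (V := R_CompleteNormedModule)); auto).
  assert (Zb : forall x, x <= -1 \/ - / 2 <= x -> b x = 0).
  { intros x [Hx|Hx]; unfold b; [rewrite (flat_le_0 0 (1 + x))|rewrite (flat_le_0 0 (- / 2 - x))]; lra. }
  assert (Z0 : forall u v, (forall x, Rmin u v < x < Rmax u v -> b x = 0) -> RInt b u v = 0).
  { intros u v H. rewrite (RInt_ext b (fun _ => 0)).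
    - rewrite RInt_const. unfold scal; simpl. unfold mult; simpl; ring.
    - exact H. }
  set (I := RInt b (-1) (- / 2)).
  assert (HI : 0 < I).
  { apply RInt_gt_0; [lra| |].
    - intros x Hx. unfold b. apply Rmult_lt_0_compat; apply flat_pos; lra.
    - intros x _. apply Cb. }
  set (chi := fun t => RtoC (/ I * RInt b (-1) t)).
  assert (Dchi : forall t, Cder chi t (RtoC (/ I) * RtoC (b t))%C).
  { intros t. rewrite <- RtoC_mult. apply (Cder_RtoC (fun t => / I * RInt b (-1) t)).
    apply (is_derive_scal (fun t => RInt b (-1) t)).
    apply (is_derive_RInt (V := R_NormedModule) b _ (-1)).
    - exists (mkposreal 1 Rlt_0_1). intros y _. apply (RInt_correct (V := R_CompleteNormedModule)). auto.
    - apply Cb. }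
  assert (Schi : Csmooth chi).
  { apply (Csmooth_class (fun f => f = chi \/ Csmooth f)); [|now left].
    intros f [->|Hf].
    - exists (fun t => RtoC (/ I) * RtoC (b t))%C. split; [exact Dchi|right; now apply Csmooth_scal].
    - exists (CDerive_n f 1). split; [now apply Cder_D|right; now apply Csmooth_CDerive_n]. }
  assert (L : forall t, t <= -1 -> chi t = RtoC 0).
  { intros t Ht. unfold chi. rewrite Z0, Rmult_0_r; [reflexivity|].
    intros x Hx. apply Zb. left. rewrite Rmax_left in Hx; lra. }
  assert (G : forall t, - / 2 <= t -> chi t = RtoC 1).
  { intros t Ht. unfold chi.
    rewrite <- (RInt_Chasles (V := R_CompleteNormedModule) b (-1) (- / 2) t) by apply Ib.
    rewrite (Z0 (- / 2) t).
    - unfold plus; simpl. fold I. f_equal. field. lra.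
    - intros x Hx. apply Zb. right. rewrite Rmin_left in Hx; lra. }
  exists chi. do 3 (split; [assumption|]). intros n.
  destruct (finite_bound (fun i M => forall t, Cmod (CDerive_n chi i t) <= M)) with (N := n) as [M HM].
  - intros i A B HA HAB t. eapply Rle_trans; [apply HA|exact HAB].
  - intros i. destruct (Ccont_bounded (CDerive_n chi i) (-1) (- / 2)) as [M HM].
    + apply Ccont_smooth, Csmooth_CDerive_n, Schi.
    + lra.
    (* The compact transition interval gives [M]. Outside it the cutoff is locally the constant 0 or
       1, whose derivatives of every order have modulus at most 1. *)
    + exists (Rmax M 1). intros t.
      assert (K : forall c, Cmod c <= 1 -> Cmod (CDerive_n (fun _ => c) i t) <= 1).
      { intros c Hc. destruct i as [|i]; [now rewrite CDerive_n_0|].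
        rewrite CDerive_n_const, Cmod_0; lra. }
      destruct (Rlt_dec t (-1)) as [Ht|Ht]; [|destruct (Rlt_dec (- / 2) t) as [Ht'|Ht']].
      * rewrite (CDerive_n_lt chi (fun _ => RtoC 0) (-1)); [|intros; apply L; lra|exact Ht].
        eapply Rle_trans; [apply K; rewrite Cmod_0; lra|apply Rmax_r].
      * rewrite (CDerive_n_gt chi (fun _ => RtoC 1) (- / 2)); [|intros; apply G; lra|exact Ht'].
        eapply Rle_trans; [apply K; rewrite Cmod_1; lra|apply Rmax_r].
      * eapply Rle_trans; [apply HM; lra|apply Rmax_l].
  - exists M. split; [|exact HM].
    eapply Rle_trans; [apply Cmod_ge_0|apply (HM 0%nat (Nat.le_0_l _) 0)].
Qed.

Definition cutoff : R -> C := proj1_sig (constructive_indefinite_description _ cutoff_exists).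

Lemma cutoff_smooth : Csmooth cutoff.
Proof. unfold cutoff. destruct constructive_indefinite_description as [chi H]. apply H. Qed.

Lemma cutoff_0 t : t <= -1 -> cutoff t = RtoC 0.
Proof. unfold cutoff. destruct constructive_indefinite_description as [chi H]. apply H. Qed.

Lemma cutoff_1 t : - / 2 <= t -> cutoff t = RtoC 1.
Proof. unfold cutoff. destruct constructive_indefinite_description as [chi H]. apply H. Qed.

Lemma cutoff_bounded n : exists M, 0 <= M /\
  forall i, (i <= n)%nat -> forall t, Cmod (CDerive_n cutoff i t) <= M.
Proof. unfold cutoff. destruct constructive_indefinite_description as [chi H]. apply H. Qed.

(** * Distributions supported in the half-line and their Laplace transforms *)

(** At a fixed point the weight is a constant, so it can be absorbed into [g] before the Leibniz
    bound is applied. *)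
Lemma Leibniz_bound_weight w n f g x A B : 0 <= w -> Csmooth f -> Csmooth g ->
  (forall i, (i <= n)%nat -> Cmod (CDerive_n f i x) <= A) ->
  (forall i, (i <= n)%nat -> w * Cmod (CDerive_n g i x) <= B) ->
  w * Cmod (CDerive_n (fun y => f y * g y)%C n x) <= 2 ^ n * (A * B).
Proof.
  intros Hw Hf Hg HA HB.
  assert (E : forall h b, Csmooth h -> w * Cmod (CDerive_n h b x) = Cmod (CDerive_n (fun y => RtoC w * h y)%C b x)).
  { intros h b Hh. rewrite CDerive_n_scal, Cmod_mult, Cmod_R, (Rabs_pos_eq w) by trivial. reflexivity. }
  rewrite E by now apply Csmooth_mult.
  replace (fun y => (RtoC w * (f y * g y))%C) with (fun y => (f y * (RtoC w * g y))%C)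
    by (apply functional_extensionality; intros; ring).
  apply Leibniz_bound; trivial; [now apply Csmooth_scal|].
  intros i Hi. rewrite <- E by trivial. auto.
Qed.

(** Bounds on [g] are asked only for [t > -2], which contains the support of the cutoff with a
    margin; thus [g] may grow arbitrarily at [-oo], as decaying exponentials do. *)
Lemma cutoff_mult_seminorm N : exists M, 0 <= M /\ forall g B, Csmooth g -> 0 <= B ->
  (forall a j, (a <= N)%nat -> (j <= N)%nat -> forall t, - 2 < t ->
    Rabs t ^ a * Cmod (CDerive_n g j t) <= B) ->
  seminorm_le N (fun t => cutoff t * g t)%C (M * B).
Proof.
  destruct (cutoff_bounded N) as [A [HA HC]].
  assert (Pp : forall n, 0 < 2 ^ n) by (intros; apply pow_lt; lra).
  exists (2 ^ N * A). split; [apply Rmult_le_pos; [left; apply Pp|exact HA]|].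
  intros g B Hg HB H a b Ha Hb x. destruct (Rlt_dec x (-1)) as [Hx|Hx].
  - rewrite (CDerive_n_lt _ (fun _ => RtoC 0) (-1)).
    + replace (CDerive_n (fun _ => RtoC 0) b x) with (RtoC 0).
      * rewrite Cmod_0, Rmult_0_r. repeat apply Rmult_le_pos; trivial. left; apply Pp.
      * destruct b; [now rewrite CDerive_n_0|now rewrite CDerive_n_const].
    + intros t Ht. rewrite cutoff_0 by lra. ring.
    + exact Hx.
  - eapply Rle_trans; [apply (Leibniz_bound_weight _ b cutoff g x A B)|].
    + apply Rabs_pow_pos.
    + apply cutoff_smooth.
    + exact Hg.
    + intros i Hi. apply HC; lia.
    + intros i Hi. apply H; lia || lra.
    + rewrite <- Rmult_assoc. apply Rmult_le_compat_r; [exact HB|].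
      apply Rmult_le_compat_r; [exact HA|]. apply Rle_pow; [lra|exact Hb].
Qed.

Lemma schwartz_cutoff g : Csmooth g ->
  (forall a j, exists B, forall t, - 2 < t -> Rabs t ^ a * Cmod (CDerive_n g j t) <= B) ->
  schwartz (fun t => cutoff t * g t)%C.
Proof.
  intros Hg H. apply schwartz_of_seminorm; [apply Csmooth_mult; [apply cutoff_smooth|exact Hg]|].
  intros N.
  destruct (finite_bound (fun a B => forall j, (j <= N)%nat -> forall t, - 2 < t ->
     Rabs t ^ a * Cmod (CDerive_n g j t) <= B)) with (N := N) as [B HB].
  - intros a A B HA HAB j Hj t Ht. eapply Rle_trans; [now apply HA|exact HAB].
  - intros a. apply (finite_bound (fun j B => forall t, - 2 < t ->
      Rabs t ^ a * Cmod (CDerive_n g j t) <= B)).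
    + intros j A B HA HAB t Ht. eapply Rle_trans; [now apply HA|exact HAB].
    + intros j. apply H.
  - destruct (cutoff_mult_seminorm N) as [M [HM HMB]].
    exists (M * B). apply HMB; [exact Hg| |].
    + eapply Rle_trans; [|apply (HB 0%nat (Nat.le_0_l _) 0%nat (Nat.le_0_l _) 0); lra].
      apply Rmult_le_pos; [apply Rabs_pow_pos|apply Cmod_ge_0].
    + intros a j Ha Hj t Ht. now apply HB.
Qed.

Lemma Cmod_CDerive_n_one_minus f n x A : Csmooth f -> Cmod (CDerive_n f n x) <= A ->
  Cmod (CDerive_n (fun y => RtoC 1 + - RtoC 1 * f y)%C n x) <= 1 + A.
Proof.
  intros Hf H.
  rewrite (CDerive_n_plus (fun _ => RtoC 1) (fun y => - RtoC 1 * f y)%C n (Csmooth_const _) (Csmooth_scal _ _ Hf)).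
  rewrite CDerive_n_scal by exact Hf. eapply Rle_trans; [apply Cmod_triangle|]. apply Rplus_le_compat.
  - destruct n; [rewrite CDerive_n_0, Cmod_1; lra|rewrite CDerive_n_const, Cmod_0; lra].
  - rewrite Cmod_mult, Cmod_opp, Cmod_1, Rmult_1_l. exact H.
Qed.

(** [supported_nonneg] covers compact supports only. A translated cutoff splits [q] at [-R0] into a
    compactly supported part, killed by [T], and a remainder whose seminorms are [O(1/R0)]; then
    [R0] is taken large. *)
Lemma tempered_vanish T q delta : tempered T -> supported_nonneg T -> schwartz q -> 0 < delta ->
  (forall t, - delta < t -> q t = RtoC 0) -> T q = RtoC 0.
Proof.
  intros HT Hsupp Hq Hd Hzero.
  destruct (tempered_bound T HT) as [N [M [HM HTb]]].
  (* The spare power of [Rabs x], which is at least [R0] where the remainder lives, yields the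
     factor [1/R0]. *)
  destruct (schwartz_seminorm q Hq (N + 1)) as [B HB].
  assert (HB0 := seminorm_le_pos _ _ _ HB).
  destruct (cutoff_bounded N) as [A [HA HC]].
  assert (Sq := schwartz_smooth q Hq).
  set (P := 2 ^ N * ((1 + A) * B)).
  assert (HP : 0 <= P) by (unfold P; apply Rmult_le_pos; [apply pow_le; lra|nra]).
  assert (Key : forall R0, 1 <= R0 -> delta <= R0 -> Cmod (T q) <= M * (P / R0)).
  { intros R0 H1 HR.
    set (chi := fun t => cutoff (R0 + 1 * t)).
    assert (Schi : Csmooth chi) by apply Csmooth_comp_affine, cutoff_smooth.
    set (rho := fun t => (RtoC 1 + - RtoC 1 * chi t)%C).
    assert (Srho : Csmooth rho) by (apply Csmooth_plus; [apply Csmooth_const|now apply Csmooth_scal]).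
    assert (Z : T (fun t => chi t * q t)%C = RtoC 0).
    { apply Hsupp; [now apply Csmooth_mult|].
      exists (- R0 - 1), (- delta). split; [lra|]. intros t [Ht|Ht].
      - unfold chi. rewrite cutoff_0 by lra. ring.
      - rewrite Hzero by lra. ring. }
    assert (Cchi : forall n A i t, (forall i, (i <= n)%nat -> forall t, Cmod (CDerive_n cutoff i t) <= A) ->
      (i <= n)%nat -> Cmod (CDerive_n rho i t) <= 1 + A).
    { intros n A' i t HA' Hi. apply Cmod_CDerive_n_one_minus; [exact Schi|]. unfold chi.
      rewrite CDerive_n_comp_affine by apply cutoff_smooth.
      rewrite pow1, Cmult_1_l. now apply HA'. }
    assert (Cr : forall i t, (i <= N)%nat -> Cmod (CDerive_n rho i t) <= 1 + A).
    { intros i t Hi. now apply (Cchi N). }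
    assert (SB : seminorm_le N (fun t => rho t * q t)%C (P / R0)).
    { intros a b Ha Hb x. destruct (Rlt_dec (- R0 - / 2) x) as [Hx|Hx].
      - rewrite (CDerive_n_gt _ (fun _ => RtoC 0) (- R0 - / 2)).
        + replace (CDerive_n (fun _ => RtoC 0) b x) with (RtoC 0).
          * rewrite Cmod_0, Rmult_0_r. apply Rdiv_le_0_compat; lra.
          * destruct b; [now rewrite CDerive_n_0|now rewrite CDerive_n_const].
        + intros t Ht. unfold rho, chi. rewrite cutoff_1 by lra. ring.
        + exact Hx.
      - assert (Hax : R0 <= Rabs x) by (rewrite Rabs_left; lra).
        replace (P / R0) with (2 ^ N * ((1 + A) * (B / R0))) by (unfold P; field; lra).
        eapply Rle_trans; [apply (Leibniz_bound_weight _ b rho q x (1 + A) (B / R0))|]; trivial.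
        + apply Rabs_pow_pos.
        + intros i Hi. apply Cr; lia.
        + intros i Hi. apply (proj1 (Rle_div_r _ _ R0 ltac:(lra))).
          assert (H := HB (a + 1)%nat i ltac:(lia) ltac:(lia) x).
          rewrite pow_add, pow_1 in H. eapply Rle_trans; [|exact H].
          replace (Rabs x ^ a * Rabs x * Cmod (CDerive_n q i x)) with
            (Rabs x ^ a * Cmod (CDerive_n q i x) * Rabs x) by ring.
          apply Rmult_le_compat_l; [|exact Hax].
          apply Rmult_le_pos; [apply Rabs_pow_pos|apply Cmod_ge_0].
        + apply Rmult_le_compat_r; [|apply Rle_pow; [lra|exact Hb]].
          apply Rmult_le_pos; [lra|apply Rdiv_le_0_compat; lra]. }
    assert (Sc : forall t, q t = (chi t * q t + rho t * q t)%C) by (intros; unfold rho; ring).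
    assert (Sr : schwartz (fun t => rho t * q t)%C).
    { apply (Scont_schwartz (fun q t => rho t * q t)%C); [|exact Hq]. apply Scont_multiplier.
      split; [exact Srho|]. intros n. destruct (cutoff_bounded n) as [A' [HA' HC']].
      exists (1 + A'), 0%nat. split; [lra|]. intros i Hi t. simpl. rewrite Rmult_1_r.
      now apply (Cchi n). }
    assert (Scq : schwartz (fun t => chi t * q t)%C).
    { replace (fun t => (chi t * q t)%C) with (fun t => (q t - rho t * q t)%C).
      - now apply schwartz_minus.
      - apply functional_extensionality; intros t. unfold rho. ring. }
    rewrite (functional_extensionality _ _ Sc).
    rewrite (proj1 HT) by trivial. rewrite Z, Cplus_0_l. now apply HTb. }
  apply Cmod_eq_0. apply Rle_antisym; [|apply Cmod_ge_0].
  apply Rnot_lt_le. intros Hpos.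
  (* [Key] bounds [Cmod (T q) * R0] by [M * P]; this [R0] makes the product strictly larger. *)
  set (R0 := 1 + delta + M * P / Cmod (T q)).
  assert (Q : 0 <= M * P / Cmod (T q)) by (apply Rdiv_le_0_compat; [now apply Rmult_le_pos|exact Hpos]).
  assert (HR0 : 0 < R0) by (unfold R0; lra).
  assert (K := Key R0 ltac:(unfold R0; lra) ltac:(unfold R0; lra)).
  apply Rmult_le_compat_r with (r := R0) in K; [|lra].
  replace (M * (P / R0) * R0) with (M * P) in K by (field; lra).
  unfold R0 in K. rewrite Rmult_plus_distr_l in K.
  replace (Cmod (T q) * (M * P / Cmod (T q))) with (M * P) in K by (field; lra). nra.
Qed.

(** The function picked by [epsilon] and [h] both agree with [g] near [[0,+oo)], so
    [tempered_vanish] kills their difference. This removes the choice operator from all later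
    computations. *)
Lemma half_line_pairing_eq T g h delta : tempered T -> supported_nonneg T -> schwartz h ->
  0 < delta -> (forall t, - delta < t -> h t = g t) -> half_line_pairing T g = T h.
Proof.
  intros HT Hs Hh Hd Hg. unfold half_line_pairing.
  match goal with |- T (epsilon ?i ?Q) = _ => assert (HE := epsilon_spec i Q) end.
  match type of HE with _ -> ?Q (epsilon ?i _) => set (e := epsilon i Q) in * end.
  destruct HE as [He [d' [Hd' Hg']]]; [eauto|].
  assert (Z : T (fun t => e t - h t)%C = RtoC 0).
  { apply (tempered_vanish T _ (Rmin delta d')); trivial.
    - now apply schwartz_minus.
    - now apply Rmin_glb_lt.
    - intros t Ht. rewrite Hg, Hg'.
      + ring.
      + generalize (Rmin_r delta d'); lra.
      + generalize (Rmin_l delta d'); lra. }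
  rewrite tempered_minus in Z by trivial.
  replace (T e) with ((T e - T h) + T h)%C by ring. rewrite Z. ring.
Qed.

(** The explicit Schwartz representative of [e^(-s t)] near the half-line, for [Re s > 0]. *)
Definition cutoff_exp (s : C) : R -> C := fun t => (cutoff t * Cexp (- s * RtoC t))%C.

Lemma exp_decay_bound sigma a : 0 < sigma -> exists B, 0 <= B /\
  forall t, - 2 < t -> Rabs t ^ a * exp (- sigma * t) <= B.
Proof.
  intros Hs. set (B1 := INR a ^ a * (/ sigma) ^ a). set (B2 := 2 ^ a * exp (sigma * 2)).
  assert (H1 : 0 <= B1).
  { apply Rmult_le_pos; apply pow_le; [apply pos_INR|left; now apply Rinv_0_lt_compat]. }
  assert (H2 : 0 <= B2) by (apply Rmult_le_pos; [apply pow_le; lra|left; apply exp_pos]).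
  exists (B1 + B2). split; [lra|]. intros t Ht. destruct (Rle_dec 0 t) as [H|H].
  - rewrite Rabs_pos_eq by trivial.
    assert (P := pow_le_exp a (sigma * t) ltac:(nra)).
    rewrite Rpow_mult_distr in P.
    replace (- sigma * t) with (- (sigma * t)) by ring. rewrite exp_Ropp.
    assert (Hsa : 0 < sigma ^ a) by now apply pow_lt.
    assert (He := exp_pos (sigma * t)).
    assert (t ^ a * / exp (sigma * t) <= B1); [|lra].
    apply (proj2 (Rle_div_l _ _ _ He)). unfold B1. rewrite pow_inv.
    apply Rmult_le_reg_l with (sigma ^ a); [exact Hsa|].
    replace (sigma ^ a * (INR a ^ a * / sigma ^ a * exp (sigma * t))) with
      (INR a ^ a * exp (sigma * t)) by (field; lra). exact P.
  - assert (Rabs t ^ a * exp (- sigma * t) <= B2); [|lra].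
    apply Rmult_le_compat; [apply Rabs_pow_pos|left; apply exp_pos| |].
    + apply pow_incr. rewrite Rabs_left; lra.
    + destruct (Rle_lt_or_eq_dec (- sigma * t) (sigma * 2)) as [Hl|He]; [nra| |].
      * left. now apply exp_increasing.
      * rewrite He. lra.
Qed.

Lemma Re_opp_mult_RtoC s t : Re (- s * RtoC t)%C = - Re s * t.
Proof. simpl. unfold Re. ring. Qed.

Lemma schwartz_cutoff_exp s : 0 < Re s -> schwartz (cutoff_exp s).
Proof.
  intros Hs. apply schwartz_cutoff; [apply Csmooth_Cexp|]. intros a j.
  destruct (exp_decay_bound (Re s) a Hs) as [B [HB H]].
  exists (Cmod (- s) ^ j * B). intros t Ht.
  rewrite CDerive_n_Cexp, Cmod_mult, Cmod_pow, Cmod_Cexp, Re_opp_mult_RtoC.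
  specialize (H t Ht). apply Rmult_le_compat_l with (r := Cmod (- s) ^ j) in H; [lra|].
  apply pow_le, Cmod_ge_0.
Qed.

Lemma laplace_eq T s : tempered T -> supported_nonneg T -> 0 < Re s ->
  laplace T s = T (cutoff_exp s).
Proof.
  intros HT Hsp Hs. apply (half_line_pairing_eq T _ _ (/ 2) HT Hsp); [now apply schwartz_cutoff_exp|lra|].
  intros t Ht. unfold cutoff_exp. rewrite cutoff_1 by lra. ring.
Qed.

Lemma schwartz_shift f x : schwartz f -> schwartz (fun y => f (x + y)).
Proof.
  intros Hf. replace (fun y => f (x + y)) with (fun y => f (x + 1 * y))
    by (apply functional_extensionality; intros; f_equal; ring).
  apply schwartz_affine; [exact Hf|]. apply Rabs_R1.
Qed.

Lemma laplace_conv k kappa s : tempered k -> tempered kappa ->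
  supported_nonneg k -> supported_nonneg kappa -> 0 < Re s ->
  dist_conv k kappa (cutoff_exp s) = (laplace k s * laplace kappa s)%C.
Proof.
  intros Hk Hka Sk Ska Hs.
  assert (Hc := schwartz_cutoff_exp s Hs).
  rewrite (laplace_eq k), (laplace_eq kappa) by trivial. unfold dist_conv.
  (* If [x] and [y] exceed [-1/4], their sum exceeds [-1/2], where the cutoff is 1. There
     [cutoff_exp s (x + y)] factors, so the inner pairing is a multiple of [cutoff_exp s x]. *)
  rewrite (half_line_pairing_eq k _ (fun x => kappa (cutoff_exp s) * cutoff_exp s x)%C (/ 4)); trivial.
  - rewrite (proj1 (proj2 Hk)) by trivial. ring.
  - now apply schwartz_scal.
  - lra.
  - intros x Hx.
    assert (Z : kappa (fun y => cutoff_exp s (x + y)%R - Cexp (- s * RtoC x) * cutoff_exp s y)%C = RtoC 0).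
    { apply (tempered_vanish kappa _ (/ 4)); trivial.
      - apply (schwartz_minus (fun y => cutoff_exp s (x + y))).
        + now apply schwartz_shift.
        + now apply schwartz_scal.
      - lra.
      - intros y Hy. unfold cutoff_exp. rewrite !cutoff_1 by lra.
        rewrite RtoC_plus. replace (- s * (x + y))%C with (- s * x + - s * y)%C by ring.
        rewrite Cexp_plus. ring. }
    rewrite (tempered_minus kappa (fun y => cutoff_exp s (x + y))) in Z;
      [|trivial|now apply schwartz_shift|now apply schwartz_scal].
    rewrite (proj1 (proj2 Hka)) in Z by trivial.
    transitivity (Cexp (- s * RtoC x) * kappa (cutoff_exp s))%C.
    + unfold cutoff_exp at 2. rewrite cutoff_1 by lra. ring.
    + transitivity (kappa (fun y => cutoff_exp s (x + y)) -
        (kappa (fun y => cutoff_exp s (x + y)) - Cexp (- s * RtoC x) * kappa (cutoff_exp s)))%C; [ring|].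
      rewrite Z. ring.
Qed.

(** * Boundary values of Laplace transforms *)

Lemma is_RInt_gen_half (g F f : R -> R) : (forall x, is_derive F x (f x)) ->
  (forall x, continuous (U := R_UniformSpace) f x) -> (forall t, 0 < t -> g t = f t) ->
  (forall eps, 0 < eps -> exists M, forall b, M < b -> Rabs (F b) < eps) ->
  is_RInt_gen g (at_point 0) pinfty (- F 0).
Proof.
  intros HF Hf Hg Hlim P [eps HP].
  destruct (Hlim eps (cond_pos eps)) as [M HM].
  apply (Filter_prod _ _ _ (fun a => a = 0) (fun b => Rmax 0 M < b)).
  - reflexivity.
  - exists (Rmax 0 M). auto.
  - intros a b -> Hb. exists (F b - F 0). split; simpl.
    + assert (Hb0 : 0 < b) by (generalize (Rmax_l 0 M); lra).
      apply (is_RInt_ext f).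
      * intros x Hx. rewrite Rmin_left in Hx by lra. symmetry. apply Hg. lra.
      * apply (is_RInt_derive (V := R_CompleteNormedModule) F); auto.
    + apply HP. change (Rabs (F b - F 0 - - F 0) < eps).
      replace (F b - F 0 - - F 0) with (F b) by ring. apply HM. generalize (Rmax_r 0 M); lra.
Qed.

Lemma is_CInt_half (g F f : R -> C) : (forall x, Cder F x (f x)) -> Ccont f ->
  (forall t, 0 < t -> g t = f t) ->
  (forall eps, 0 < eps -> exists M, forall b, M < b -> Cmod (F b) < eps) ->
  is_CInt g (at_point 0) pinfty (- F 0)%C.
Proof.
  intros HF Hf Hg Hlim. split.
  - apply (is_RInt_gen_half _ (fun x => Re (F x)) (fun x => Re (f x))).
    + intros x; exact (proj1 (HF x)).
    + intros x; exact (proj1 (Hf x)).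
    + intros t Ht. now rewrite Hg.
    + intros eps He. destruct (Hlim eps He) as [M HM]. exists M. intros b Hb.
      eapply Rle_lt_trans; [apply re_le_Cmod|auto].
  - apply (is_RInt_gen_half _ (fun x => Im (F x)) (fun x => Im (f x))).
    + intros x; exact (proj2 (HF x)).
    + intros x; exact (proj2 (Hf x)).
    + intros t Ht. now rewrite Hg.
    + intros eps He. destruct (Hlim eps He) as [M HM]. exists M. intros b Hb.
      eapply Rle_lt_trans; [apply im_le_Cmod|auto].
Qed.

Definition monomial (n : nat) (t : R) : R := t ^ n / INR (fact n).

(* Antiderivatives of [t^(n-1) e^(-s t) / (n-1)!], obtained by integrating by parts. *)
Fixpoint gamma_primitive (s : C) (n : nat) (t : R) : C :=
  match n with
  | O => RtoC 0
  | S n => ((gamma_primitive s n t - RtoC (monomial n t) * Cexp (- s * RtoC t)) / s)%C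
  end.

Lemma monomial_0 t : monomial 0 t = 1.
Proof. unfold monomial; simpl; field. Qed.

Lemma monomial_S_der n t : is_derive (monomial (S n)) t (monomial n t).
Proof.
  unfold monomial. assert (Hf := INR_fact_neq_0 n). assert (Hn := not_0_INR (S n) ltac:(lia)).
  replace (fact (S n)) with (S n * fact n)%nat by reflexivity. rewrite mult_INR.
  auto_derive; [exact I|].
  change (match n with O => 1 | S _ => INR n + 1 end) with (INR (S n)).
  field. split; assumption.
Qed.

Lemma gamma_primitive_der s n t : s <> RtoC 0 ->
  Cder (gamma_primitive s (S n)) t (RtoC (monomial n t) * Cexp (- s * RtoC t))%C.
Proof.
  intros Hs. induction n as [|n IH].
  - replace (gamma_primitive s 1) with (fun t => (- / s) * Cexp (- s * RtoC t))%C.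
    + eapply Cder_eq; [apply Cder_scal, Cder_Cexp|]. rewrite monomial_0. field. exact Hs.
    + apply functional_extensionality; intros x. cbn [gamma_primitive]. rewrite monomial_0. field. exact Hs.
  - replace (gamma_primitive s (S (S n))) with
      (fun t => (/ s) * (gamma_primitive s (S n) t - RtoC (monomial (S n) t) * Cexp (- s * RtoC t)))%C.
    + eapply Cder_eq.
      * apply Cder_scal. apply (Cder_minus (gamma_primitive s (S n))); [exact IH|].
        apply Cder_mult; [apply Cder_RtoC, monomial_S_der|apply Cder_Cexp].
      * cbv beta. field. exact Hs.
    + apply functional_extensionality; intros x. unfold Cdiv.
      change (gamma_primitive s (S (S n)) x) with
       ((gamma_primitive s (S n) x - RtoC (monomial (S n) x) * Cexp (- s * RtoC x)) / s)%C.
      unfold Cdiv. ring.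
Qed.

(** At 0 all monomials but the constant one vanish, so after the first step the recursion only
    divides by [s]. *)
Lemma gamma_primitive_0 s n : s <> RtoC 0 -> gamma_primitive s (S n) 0 = (- / s ^ S n)%C.
Proof.
  intros Hs. induction n as [|n IH].
  - cbn [gamma_primitive]. rewrite monomial_0. replace (- s * RtoC 0)%C with (RtoC 0) by ring.
    rewrite Cexp_0. change (s ^ 1)%C with (s * 1)%C. field. exact Hs.
  - change (gamma_primitive s (S (S n)) 0) with
       ((gamma_primitive s (S n) 0 - RtoC (monomial (S n) 0) * Cexp (- s * RtoC 0)) / s)%C.
    rewrite IH. replace (monomial (S n) 0) with 0 by (unfold monomial, Rdiv; rewrite pow_i by lia; ring).
    change ((s ^ S (S n))%C) with (s * s ^ S n)%C. field. split; [|exact Hs]. 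
    exact (Cpow_nz s (S n) Hs).
Qed.

Lemma gamma_primitive_decay s n : 0 < Re s -> exists B, 0 <= B /\ forall t, 1 <= t ->
  Cmod (gamma_primitive s n t) <= B / t.
Proof.
  intros Hs. assert (Hs0 : s <> RtoC 0) by (intros ->; simpl in Hs; lra).
  assert (Hm : 0 < Cmod s) by now apply Cmod_gt_0.
  induction n as [|n [B [HB IH]]].
  - exists 0. split; [lra|]. intros t Ht. simpl. rewrite Cmod_0. apply Rdiv_le_0_compat; lra.
  (* One power more than the monomial of degree [n] contains: the spare one becomes the factor
     [1/t]. *)
  - destruct (exp_decay_bound (Re s) (n + 1) Hs) as [B' [HB' H']].
    assert (Hf : 0 < INR (fact n)) by apply INR_fact_lt_0.
    exists ((B + B' / INR (fact n)) / Cmod s). split.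
    { apply Rdiv_le_0_compat; [|exact Hm]. assert (0 <= B' / INR (fact n)) by now apply Rdiv_le_0_compat. lra. }
    intros t Ht. simpl. rewrite Cmod_div by trivial.
    replace ((B + B' / INR (fact n)) / Cmod s / t) with ((B / t + B' / INR (fact n) / t) / Cmod s)
      by (field; repeat split; lra).
    apply Rmult_le_compat_r; [left; now apply Rinv_0_lt_compat|].
    unfold Cminus. eapply Rle_trans; [apply Cmod_triangle|]. rewrite Cmod_opp.
    apply Rplus_le_compat; [now apply IH|].
    rewrite Cmod_mult, Cmod_Cexp, Cmod_R, Re_opp_mult_RtoC.
    unfold monomial. specialize (H' t ltac:(lra)).
    rewrite Rabs_pos_eq in H' by lra. rewrite pow_add, pow_1 in H'.
    rewrite Rabs_pos_eq by (apply Rdiv_le_0_compat; [apply pow_le|]; lra).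
    replace (B' / INR (fact n) / t) with (B' / t / INR (fact n)) by (field; split; lra).
    replace (t ^ n / INR (fact n) * exp (- Re s * t)) with (t ^ n * exp (- Re s * t) / INR (fact n))
      by (field; lra).
    apply Rmult_le_compat_r; [left; now apply Rinv_0_lt_compat|].
    apply (proj1 (Rle_div_r _ _ t ltac:(lra))). lra.
Qed.

Lemma t_plus_cutoff_exp n s : (1 <= n)%nat -> 0 < Re s -> t_plus n (cutoff_exp s) = (/ s ^ n)%C.
Proof.
  intros Hn Hs. assert (Hs0 : s <> RtoC 0) by (intros ->; simpl in Hs; lra).
  destruct n as [|n]; [lia|]. unfold t_plus. replace (S n - 1)%nat with n by lia.
  replace (/ s ^ S n)%C with (- gamma_primitive s (S n) 0)%C by (rewrite gamma_primitive_0 by trivial; ring).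
  apply is_CInt_unique; try typeclasses eauto.
  apply (is_CInt_half _ _ (fun t => RtoC (monomial n t) * Cexp (- s * RtoC t))%C).
  - intros t. now apply gamma_primitive_der.
  - apply Ccont_mult; [|apply Ccont_smooth, Csmooth_Cexp].
    destruct n as [|n].
    + replace (fun x => RtoC (monomial 0 x)) with (fun _ : R => RtoC (1 / 1)) by reflexivity.
      apply Ccont_const.
    + apply (Ccont_Cder _ (fun x => RtoC (monomial n x))). intros x. apply Cder_RtoC, monomial_S_der.
  - intros t Ht. unfold cutoff_exp. rewrite cutoff_1 by lra. unfold monomial. ring.
  - intros eps He. destruct (gamma_primitive_decay s (S n) Hs) as [B [HB H]].
    exists (Rmax 1 (B / eps)). intros b Hb.
    assert (H1 := Rmax_l 1 (B / eps)). assert (H2 := Rmax_r 1 (B / eps)).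
    eapply Rle_lt_trans; [apply H; lra|].
    apply (proj2 (Rlt_div_l _ _ b ltac:(lra))).
    assert (B / eps < b) by lra. apply (Rlt_div_l _ _ eps He) in H0. lra.
Qed.

Lemma fourier_plus f g : schwartz f -> schwartz g ->
  fourier (fun x => f x + g x)%C = fun xi => (fourier f xi + fourier g xi)%C.
Proof.
  intros Hf Hg. apply functional_extensionality; intros xi.
  assert (E := is_CInt_plus _ _ minfty pinfty _ _ (CInt_fourier_integrand f xi Hf) (CInt_fourier_integrand g xi Hg)).
  apply is_CInt_unique in E; [|typeclasses eauto|typeclasses eauto].
  unfold fourier. fold (fourier_integrand f xi). fold (fourier_integrand g xi).
  rewrite <- Cmult_plus_distr_l, <- E. f_equal. f_equal.
  apply functional_extensionality; intros y. unfold fourier_integrand. ring.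
Qed.

Lemma fourier_scal c f : schwartz f -> fourier (fun x => c * f x)%C = fun xi => (c * fourier f xi)%C.
Proof.
  intros Hf. apply functional_extensionality; intros xi.
  assert (E := is_CInt_scal c _ minfty pinfty _ (CInt_fourier_integrand f xi Hf)).
  apply is_CInt_unique in E; [|typeclasses eauto|typeclasses eauto].
  unfold fourier. fold (fourier_integrand f xi).
  transitivity (RtoC (/ sqrt (2 * PI)) * (c * CInt (fourier_integrand f xi) minfty pinfty))%C; [|ring].
  rewrite <- E. f_equal. f_equal.
  apply functional_extensionality; intros y. unfold fourier_integrand. ring.
Qed.

(** The factor undoes the normalization of [fourier], since the Laplace transform pairs with the
    bare exponential. *)
Definition symbol (T : functional) : functional := fun phi =>
  T (fun t => RtoC (sqrt (2 * PI)) * fourier phi t)%C.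

Lemma tempered_symbol T : tempered T -> tempered (symbol T).
Proof.
  intros HT. unfold symbol. split; [|split].
  - intros phi chi Hphi Hchi. rewrite <- (proj1 HT) by (apply schwartz_scal; now apply schwartz_fourier).
    f_equal. rewrite fourier_plus by trivial. apply functional_extensionality; intros; ring.
  - intros c phi Hphi. rewrite <- (proj1 (proj2 HT)) by (apply schwartz_scal; now apply schwartz_fourier).
    f_equal. rewrite fourier_scal by trivial. apply functional_extensionality; intros; ring.
  - destruct (tempered_bound T HT) as [N [M [HM HTb]]].
    destruct (proj2 Scont_fourier N) as [N' [M' [HM' HF]]].
    exists N', (M * (Cmod (RtoC (sqrt (2 * PI))) * M')). intros phi Hphi B HB.
    replace (M * (Cmod (RtoC (sqrt (2 * PI))) * M') * B) with (M * (Cmod (RtoC (sqrt (2 * PI))) * (M' * B))) by ring.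
    apply HTb.
    + apply schwartz_scal; now apply schwartz_fourier.
    + apply seminorm_le_scal; [now apply fourier_smooth|]. now apply HF.
Qed.

Lemma multiplier_cutoff : multiplier cutoff.
Proof.
  split; [apply cutoff_smooth|]. intros n. destruct (cutoff_bounded n) as [M [HM H]].
  exists M, 0%nat. split; [exact HM|]. intros b Hb x. simpl. rewrite Rmult_1_r. now apply H.
Qed.

Lemma schwartz_cutoff_mult f : schwartz f -> schwartz (fun t => cutoff t * f t)%C.
Proof. apply (Scont_schwartz (fun f t => cutoff t * f t)%C). apply Scont_multiplier, multiplier_cutoff. Qed.

Lemma tempered_cutoff_mult T f : tempered T -> supported_nonneg T -> schwartz f ->
  T (fun t => cutoff t * f t)%C = T f.
Proof.
  intros HT Hs Hf. assert (Hc := schwartz_cutoff_mult f Hf).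
  assert (Z : T (fun t => f t - cutoff t * f t)%C = RtoC 0).
  { apply (tempered_vanish T _ (/ 2)); trivial.
    - now apply schwartz_minus.
    - lra.
    - intros t Ht. rewrite cutoff_1 by lra. ring. }
  rewrite tempered_minus in Z by trivial.
  transitivity (T f - (T f - T (fun t => cutoff t * f t)))%C; [ring|]. rewrite Z. ring.
Qed.

(** For order 0 this is the mean value bound from the origin; each derivative carries a factor
    [sigma], and [sigma <= 1] reduces all of them to the first. The constant [exp 2] bounds
    [e^(-sigma t)] for [t > -2]. *)
Lemma Cexp_minus_1_bound sigma t i : 0 < sigma <= 1 -> - 2 < t ->
  Cmod (CDerive_n (fun t => Cexp (- RtoC sigma * RtoC t) - RtoC 1)%C i t) <=
  2 * sigma * exp 2 * (1 + Rabs t).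
Proof.
  intros Hs Ht. assert (Hat := Rabs_pos t).
  assert (E : forall u, - 2 < u -> Cmod (- RtoC sigma * Cexp (- RtoC sigma * RtoC u))%C <= sigma * exp 2).
  { intros u Hu. rewrite Cmod_mult, Cmod_opp, Cmod_R, Rabs_pos_eq, Cmod_Cexp, Re_opp_mult_RtoC by lra.
    apply Rmult_le_compat_l; [lra|].
    simpl. destruct (Rle_lt_or_eq_dec (- sigma * u) 2) as [Hl|He]; [nra| |].
    - left. now apply exp_increasing.
    - rewrite He. lra. }
  assert (Ep := exp_pos 2).
  assert (D1 : forall u, Cder (fun t => Cexp (- RtoC sigma * RtoC t) - RtoC 1)%C u
     (- RtoC sigma * Cexp (- RtoC sigma * RtoC u))%C).
  { intros u. eapply Cder_eq; [apply Cder_minus; [apply Cder_Cexp|apply Cder_const]|ring]. }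
  destruct i as [|i].
  - rewrite CDerive_n_0.
    replace (Cexp (- RtoC sigma * RtoC t) - RtoC 1)%C with
      ((Cexp (- RtoC sigma * RtoC t) - RtoC 1) - (Cexp (- RtoC sigma * RtoC 0) - RtoC 1))%C.
    + eapply Rle_trans; [apply (Cder_bound (fun t => Cexp (- RtoC sigma * RtoC t) - RtoC 1)%C
        (fun u => - RtoC sigma * Cexp (- RtoC sigma * RtoC u))%C (sigma * exp 2) 0 t)|].
      * intros x _. apply D1.
      * intros x Hx. apply E. revert Hx. unfold Rmin; destruct Rle_dec; lra.
      * rewrite Rminus_0_r. assert (0 <= sigma * exp 2) by nra. nra.
    + replace (- RtoC sigma * RtoC 0)%C with (RtoC 0) by ring. rewrite Cexp_0. ring.
  - rewrite (CDerive_n_succ _ _ i D1).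
    rewrite CDerive_n_scal by apply Csmooth_Cexp.
    rewrite CDerive_n_Cexp.
    replace (- RtoC sigma * ((- RtoC sigma) ^ i * Cexp (- RtoC sigma * RtoC t)))%C with
      ((- RtoC sigma) ^ i * (- RtoC sigma * Cexp (- RtoC sigma * RtoC t)))%C by ring.
    rewrite Cmod_mult, Cmod_pow, Cmod_opp, Cmod_R, Rabs_pos_eq by lra.
    assert (P : sigma ^ i <= 1) by (rewrite <- (pow1 i); apply pow_incr; lra).
    assert (P0 : 0 <= sigma ^ i) by (apply pow_le; lra).
    specialize (E t Ht). assert (E0 := Cmod_ge_0 (- RtoC sigma * Cexp (- RtoC sigma * RtoC t))%C).
    assert (0 <= sigma * exp 2) by nra.
    apply Rle_trans with (1 * (sigma * exp 2)); [now apply Rmult_le_compat|]. nra.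
Qed.

(** Since [e^(-sigma t)] is not close to 1 at [-oo], the cutoff is first inserted into [T f] as
    well, which the support of [T] permits. The difference becomes
    [cutoff * (e^(-sigma t) - 1) * f], of order [sigma] in every seminorm. *)
Lemma tempered_exp_limit T f : tempered T -> supported_nonneg T -> schwartz f ->
  exists K, forall sigma, 0 < sigma <= 1 ->
    Cmod (T (fun t => cutoff_exp (RtoC sigma) t * f t) - T f)%C <= K * sigma.
Proof.
  intros HT Hs Hf. destruct (tempered_bound T HT) as [N [M [HM HTb]]].
  destruct (cutoff_mult_seminorm N) as [A [HA HAb]].
  destruct (schwartz_seminorm f Hf (N + 1)) as [B HB].
  assert (HB0 := seminorm_le_pos _ _ _ HB).
  set (F := 2 ^ (N + 1) * (2 * B)).
  assert (HF : 0 <= F) by (apply Rmult_le_pos; [apply pow_le|]; lra).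
  exists (M * (A * (2 ^ N * (2 * exp 2 * F)))). intros sigma Hsig.
  set (e := fun t => (Cexp (- RtoC sigma * RtoC t) - RtoC 1)%C).
  assert (Se : Csmooth e).
  { unfold e. rewrite (Cminus_fun (fun t => Cexp (- RtoC sigma * RtoC t)) (fun _ => RtoC 1)).
    apply Csmooth_plus; [apply Csmooth_Cexp|apply Csmooth_const]. }
  assert (Hce : schwartz (fun t => cutoff_exp (RtoC sigma) t * f t)%C).
  { apply schwartz_mult; [apply schwartz_cutoff_exp; simpl; lra|exact Hf]. }
  assert (Hc := schwartz_cutoff_mult f Hf).
  rewrite <- (tempered_cutoff_mult T f HT Hs Hf), <- tempered_minus by trivial.
  assert (Eq : (fun t => cutoff_exp (RtoC sigma) t * f t - cutoff t * f t)%C =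
    (fun t => cutoff t * (e t * f t))%C).
  { apply functional_extensionality; intros t. unfold cutoff_exp, e. ring. }
  replace (M * (A * (2 ^ N * (2 * exp 2 * F))) * sigma) with
    (M * (A * (2 ^ N * (2 * sigma * exp 2 * F)))) by ring.
  assert (Ep := exp_pos 2).
  apply HTb; [now apply schwartz_minus|]. rewrite Eq. apply HAb.
  - apply Csmooth_mult; [exact Se|now apply schwartz_smooth].
  - apply Rmult_le_pos; [apply pow_le; lra|]. apply Rmult_le_pos; [nra|exact HF].
  - intros a j Ha Hj t Ht. assert (Hat := Rabs_pos t).
    eapply Rle_trans.
    + apply (Leibniz_bound_weight (Rabs t ^ a) j e f t (2 * sigma * exp 2 * (1 + Rabs t)) (F / (1 + Rabs t))).
      * apply Rabs_pow_pos.
      * exact Se.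
      * now apply schwartz_smooth.
      * intros i Hi. now apply Cexp_minus_1_bound.
      (* The linear growth of the derivatives of [e] is paid by one extra weight on [f]. *)
      * intros i Hi. apply (proj1 (Rle_div_r _ _ (1 + Rabs t) ltac:(lra))).
        eapply Rle_trans; [|apply (seminorm_le_weight _ _ _ (a + 1) i t HB); lia].
        rewrite pow_add, pow_1.
        replace ((1 + Rabs t) ^ a * (1 + Rabs t) * Cmod (CDerive_n f i t)) with
          ((1 + Rabs t) ^ a * (Cmod (CDerive_n f i t) * (1 + Rabs t))) by ring.
        rewrite Rmult_assoc. apply Rmult_le_compat_r.
        -- apply Rmult_le_pos; [apply Cmod_ge_0|lra].
        -- apply pow_incr. lra.
    + replace (2 * sigma * exp 2 * (1 + Rabs t) * (F / (1 + Rabs t))) with (2 * sigma * exp 2 * F)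
        by (field; lra).
      apply Rmult_le_compat_r; [apply Rmult_le_pos; [nra|exact HF]|]. apply Rle_pow; [lra|exact Hj].
Qed.

Lemma boundary_value_laplace T G : tempered T -> supported_nonneg T ->
  (forall s, 0 < Re s -> G s = laplace T s) -> is_boundary_value G (symbol T).
Proof.
  intros HT Hs HG. split; [now apply tempered_symbol|]. intros phi Hphi.
  assert (HF : schwartz (fun t => RtoC (sqrt (2 * PI)) * fourier phi t)%C)
    by (apply schwartz_scal; now apply schwartz_fourier).
  (* The exponential at [sigma + i xi] splits into a damping factor and an oscillating one;
     integrating the latter against [phi] before applying [T] gives this value. *)
  exists (fun sigma => T (fun t => cutoff_exp (RtoC sigma) t * (RtoC (sqrt (2 * PI)) * fourier phi t))%C).
  split.
  - intros sigma Hsig.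
    assert (Hc : schwartz (cutoff_exp (RtoC sigma))) by (apply schwartz_cutoff_exp; exact Hsig).
    assert (H := tempered_fourier T phi _ HT Hphi Hc).
    replace (fun xi => (G (sigma, xi) * phi xi)%C) with
     (fun xi => T (fun t => cutoff_exp (RtoC sigma) t * fourier_integrand phi t xi)%C); [exact H|].
    apply functional_extensionality; intros xi.
    assert (Hsx : 0 < Re (sigma, xi)) by exact Hsig.
    rewrite HG, laplace_eq, Cmult_comm, <- (proj1 (proj2 HT)) by (trivial; now apply schwartz_cutoff_exp).
    f_equal. apply functional_extensionality; intros t. unfold cutoff_exp, fourier_integrand.
    replace (- (sigma, xi) * RtoC t)%C with (- RtoC sigma * RtoC t + - Ci * RtoC (t * xi))%C.
    + rewrite Cexp_plus. ring.
    + apply C_eq; simpl; ring.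
  - destruct (tempered_exp_limit T _ HT Hs HF) as [K HK].
    intros P [eps HP].
    assert (HK1 : 0 < Rabs K + 1) by (generalize (Rabs_pos K); lra).
    assert (Hd : 0 < Rmin 1 (eps / (Rabs K + 1))).
    { apply Rmin_glb_lt; [lra|]. apply Rdiv_lt_0_compat; [apply cond_pos|exact HK1]. }
    exists (mkposreal _ Hd). intros sigma Hball Hsig. apply HP.
    (* Neighbourhoods in [C] are those of the product structure; this passes from the modulus to
       them. *)
    apply C_NormedModule_mixin_compat1.
    change (Rabs (sigma - 0) < Rmin 1 (eps / (Rabs K + 1))) in Hball.
    rewrite Rminus_0_r, Rabs_pos_eq in Hball by lra.
    assert (H1 := Rlt_le_trans _ _ _ Hball (Rmin_l _ _)).
    assert (H2 := Rlt_le_trans _ _ _ Hball (Rmin_r _ _)).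
    eapply Rle_lt_trans; [apply (HK sigma); lra|].
    apply Rmult_lt_compat_l with (r := Rabs K + 1) in H2; [|exact HK1].
    replace ((Rabs K + 1) * (eps / (Rabs K + 1))) with (pos eps) in H2 by (field; lra).
    generalize (Rle_abs K). nra.
Qed.

(** * Convolution with a Schwartz function and its Fourier transform *)

Lemma is_RInt_gen_subst (G psi dpsi : R -> R) l :
  (forall x, continuous (U := R_UniformSpace) G x) ->
  (forall x, is_derive psi x (dpsi x)) -> (forall x, continuous (U := R_UniformSpace) dpsi x) ->
  (forall M, exists t, forall a, a < t -> psi a < M) ->
  (forall M, exists t, forall a, t < a -> M < psi a) ->
  is_RInt_gen G minfty pinfty l ->
  is_RInt_gen (fun t => dpsi t * G (psi t)) minfty pinfty l.
Proof.
  intros HG Hpsi Hdpsi Hm Hp H P HP.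
  destruct (H P HP) as [Q1 Q2 [M1 HQ1] [M2 HQ2] HQ].
  destruct (Hm M1) as [t1 H1]. destruct (Hp M2) as [t2 H2].
  apply (Filter_prod _ _ _ (fun a => a < t1) (fun b => t2 < b)).
  - exists t1; auto.
  - exists t2; auto.
  - intros a b Ha Hb. destruct (HQ (psi a) (psi b)) as [y [Hy1 Hy2]]; [auto|auto|].
    exists y. split; [|exact Hy2]. simpl in *.
    rewrite <- (is_RInt_unique (V := R_CompleteNormedModule) _ _ _ _ Hy1).
    apply (is_RInt_comp (V := R_CompleteNormedModule) G psi dpsi).
    + intros x _. apply HG.
    + intros x _. split; [apply Hpsi|apply Hdpsi].
Qed.

Lemma is_CInt_subst (G : R -> C) (psi dpsi : R -> R) z : Ccont G ->
  (forall x, is_derive psi x (dpsi x)) -> (forall x, continuous (U := R_UniformSpace) dpsi x) ->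
  (forall M, exists t, forall a, a < t -> psi a < M) ->
  (forall M, exists t, forall a, t < a -> M < psi a) ->
  is_CInt G minfty pinfty z ->
  is_CInt (fun t => RtoC (dpsi t) * G (psi t))%C minfty pinfty z.
Proof.
  intros HG Hpsi Hdpsi Hm Hp [H1 H2]. split.
  - replace (fun x => Re (RtoC (dpsi x) * G (psi x))%C) with (fun x => dpsi x * Re (G (psi x)))
      by (apply functional_extensionality; intros; simpl; unfold Re; ring).
    apply (is_RInt_gen_subst (fun y => Re (G y)) psi dpsi); trivial. intros x; exact (proj1 (HG x)).
  - replace (fun x => Im (RtoC (dpsi x) * G (psi x))%C) with (fun x => dpsi x * Im (G (psi x)))
      by (apply functional_extensionality; intros; simpl; unfold Im; ring).
    apply (is_RInt_gen_subst (fun y => Im (G y)) psi dpsi); trivial. intros x; exact (proj2 (HG x)).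
Qed.

Lemma Ccont_fourier_integrand f xi : schwartz f -> Ccont (fourier_integrand f xi).
Proof.
  intros Hf. destruct (lipdec_fourier_integrand f Hf) as [K [_ HK]]. exact (lipdec_cont _ _ (HK xi)).
Qed.

Lemma fourier_shift f t xi : schwartz f ->
  fourier (fun x => f (x - t)) xi = (Cexp (- Ci * RtoC (t * xi)) * fourier f xi)%C.
Proof.
  intros Hf.
  assert (H := is_CInt_subst _ (fun x => x - t) (fun _ => 1) _ (Ccont_fourier_integrand f xi Hf)
    ltac:(intros x; auto_derive; trivial; ring) ltac:(intros; apply continuous_const)
    ltac:(intros M; exists (M + t); intros; lra) ltac:(intros M; exists (M + t); intros; lra)
    (CInt_fourier_integrand f xi Hf)).
  apply (is_CInt_scal (Cexp (- Ci * RtoC (t * xi)))) in H; try typeclasses eauto.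
  apply is_CInt_unique in H; try typeclasses eauto.
  unfold fourier. fold (fourier_integrand f xi).
  transitivity (RtoC (/ sqrt (2 * PI)) * (Cexp (- Ci * RtoC (t * xi)) * CInt (fourier_integrand f xi) minfty pinfty))%C; [|ring].
  rewrite <- H. f_equal. f_equal. apply functional_extensionality; intros x. unfold fourier_integrand.
  rewrite Cmult_1_l, Cmult_assoc, <- Cexp_plus. f_equal. f_equal.
  rewrite <- Cmult_plus_distr_l, <- RtoC_plus. f_equal. f_equal. ring.
Qed.

Lemma is_dist_of_fun_CInt g A K : Ccont g -> 0 <= A ->
  (forall x, Cmod (g x) <= A * (1 + Rabs x) ^ K) ->
  is_dist_of_fun g (fun phi => CInt (fun x => g x * phi x)%C minfty pinfty).
Proof.
  intros Hg HA HK.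
  (* Of the [K + 2] weights on [phi], [K] compensate the growth of [g] and two give
     integrability. *)
  assert (HD : forall phi B, schwartz phi -> seminorm_le (K + 2) phi B ->
    decays (A * (2 ^ (K + 2) * (2 * B))) (fun x => g x * phi x)%C).
  { intros phi B Hphi HB x. rewrite Cmod_mult.
    apply (proj1 (Rle_div_r _ _ _ (one_plus_sqr_pos x))).
    assert (H := seminorm_le_weight _ _ _ (K + 2) 0 x HB ltac:(lia) ltac:(lia)).
    rewrite CDerive_n_0 in H. rewrite pow_add in H.
    assert (Hx := Rabs_pos x). assert (Hp := Cmod_ge_0 (phi x)).
    assert (Hw : 1 + x ^ 2 <= (1 + Rabs x) ^ 2) by (rewrite <- pow2_abs; nra).
    assert (Hw0 : 0 <= (1 + Rabs x) ^ K) by (apply pow_le; lra).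
    apply Rle_trans with (A * (1 + Rabs x) ^ K * Cmod (phi x) * (1 + Rabs x) ^ 2).
    - apply Rmult_le_compat; trivial.
      + apply Rmult_le_pos; apply Cmod_ge_0.
      + left; apply one_plus_sqr_pos.
      + apply Rmult_le_compat_r; trivial.
    - replace (A * (1 + Rabs x) ^ K * Cmod (phi x) * (1 + Rabs x) ^ 2) with
       (A * ((1 + Rabs x) ^ K * (1 + Rabs x) ^ 2 * Cmod (phi x))) by ring.
      now apply Rmult_le_compat_l. }
  assert (HC : forall phi, schwartz phi -> Ccont (fun x => g x * phi x)%C).
  { intros phi Hphi. apply Ccont_mult; [exact Hg|]. apply Ccont_smooth, schwartz_smooth, Hphi. }
  assert (HI : forall phi, schwartz phi -> is_CInt (fun x => g x * phi x)%C minfty pinfty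
    (CInt (fun x => g x * phi x)%C minfty pinfty)).
  { intros phi Hphi. destruct (schwartz_seminorm phi Hphi (K + 2)) as [B HB].
    eapply CInt_correct; eauto. }
  split; [|exact HI]. split; [|split].
  - intros phi chi Hphi Hchi.
    assert (H := is_CInt_plus _ _ minfty pinfty _ _ (HI phi Hphi) (HI chi Hchi)).
    apply is_CInt_unique in H; try typeclasses eauto. rewrite <- H. f_equal.
    apply functional_extensionality; intros; ring.
  - intros c phi Hphi.
    assert (H := is_CInt_scal c _ minfty pinfty _ (HI phi Hphi)).
    apply is_CInt_unique in H; try typeclasses eauto. rewrite <- H. f_equal.
    apply functional_extensionality; intros; ring.
  - exists (K + 2)%nat, (2 * PI * (A * (2 ^ (K + 2) * 2))). intros phi Hphi B HB.
    eapply Rle_trans; [apply (CInt_bound _ _ (HC phi Hphi) (HD phi B Hphi HB))|]. right; ring.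
Qed.

(** The constant function 1 viewed as a distribution. With it as [T], interchanging [T] and an
    integral means exchanging the order of two integrals. *)
Lemma tempered_CInt_functional : tempered (fun phi => CInt phi minfty pinfty).
Proof.
  replace (fun phi => CInt phi minfty pinfty) with
    (fun phi => CInt (fun x => RtoC 1 * phi x)%C minfty pinfty).
  - apply (is_dist_of_fun_CInt (fun _ => RtoC 1) 1 0); [apply Ccont_const|lra|].
    intros x. rewrite Cmod_1. simpl. lra.
  - apply functional_extensionality; intros phi. f_equal.
    apply functional_extensionality; intros; ring.
Qed.

(** Fubini for [f(x - t) e^(-i x xi) phi(xi)], obtained from [tempered_fourier] with integration as
    the functional. Integrating in [x] first, the translation by [t] becomes the factor
    [e^(-i t xi)], so the remaining integral is a Fourier transform at [t]. *)
Lemma fourier_multiplication f phi t : schwartz f -> schwartz phi ->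
  CInt (fun x => f (x - t)%R * fourier phi x)%C minfty pinfty =
  (RtoC (sqrt (2 * PI)) * fourier (fun xi => fourier f xi * phi xi) t)%C.
Proof.
  intros Hf Hphi.
  assert (Hr : RtoC (sqrt (2 * PI)) <> RtoC 0).
  { intros H. apply RtoC_inj in H. assert (0 < sqrt (2 * PI)) by (apply sqrt_lt_R0; generalize PI_RGT_0; lra). lra. }
  assert (Hri : (RtoC (sqrt (2 * PI)) * RtoC (/ sqrt (2 * PI)) = 1)%C).
  { rewrite RtoC_inv by (intros H; apply Hr; now rewrite H). field. exact Hr. }
  set (ft := fun x => f (x - t)).
  assert (Hft : schwartz ft).
  { unfold ft. replace (fun x => f (x - t)) with (fun x => f (- t + 1 * x)).
    - apply schwartz_affine; [exact Hf|apply Rabs_R1].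
    - apply functional_extensionality; intros; f_equal; ring. }
  assert (H := tempered_fourier _ phi ft tempered_CInt_functional Hphi Hft). cbv beta in H.
  assert (Hprod : schwartz (fun xi => fourier f xi * phi xi)%C)
    by (apply schwartz_mult; [now apply schwartz_fourier|exact Hphi]).
  assert (E1 : (fun xi => CInt (fun x => ft x * fourier_integrand phi x xi)%C minfty pinfty) =
    (fun xi => RtoC (sqrt (2 * PI)) * fourier_integrand (fun xi => fourier f xi * phi xi)%C t xi)%C).
  { apply functional_extensionality; intros xi.
    assert (Y := is_CInt_scal (phi xi) _ minfty pinfty _ (CInt_fourier_integrand ft xi Hft)).
    apply is_CInt_unique in Y; try typeclasses eauto.
    transitivity (phi xi * CInt (fourier_integrand ft xi) minfty pinfty)%C.
    - rewrite <- Y. f_equal. apply functional_extensionality; intros x. unfold fourier_integrand.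
      rewrite (Rmult_comm xi x). ring.
    - transitivity (phi xi * (RtoC (sqrt (2 * PI)) * fourier ft xi))%C.
      + f_equal. unfold fourier. fold (fourier_integrand ft xi).
        rewrite Cmult_assoc, Hri. ring.
      + unfold ft. rewrite fourier_shift by exact Hf. unfold fourier_integrand. ring. }
  rewrite E1 in H. apply is_CInt_unique in H; try typeclasses eauto.
  assert (Y := is_CInt_scal (RtoC (sqrt (2 * PI))) _ minfty pinfty _ (CInt_fourier_integrand _ t Hprod)).
  apply is_CInt_unique in Y; try typeclasses eauto. rewrite Y in H.
  assert (Hf2 : schwartz (fun x => ft x * fourier phi x)%C)
    by (apply schwartz_mult; [exact Hft|now apply schwartz_fourier]).
  assert (E2 : CInt (fun x => ft x * (RtoC (sqrt (2 * PI)) * fourier phi x))%C minfty pinfty =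
     (RtoC (sqrt (2 * PI)) * CInt (fun x => ft x * fourier phi x)%C minfty pinfty)%C).
  { rewrite <- (proj1 (proj2 tempered_CInt_functional)) by exact Hf2. f_equal.
    apply functional_extensionality; intros; ring. }
  rewrite E2 in H. unfold ft in H.
  unfold fourier at 2. fold (fourier_integrand (fun xi => fourier f xi * phi xi)%C t).
  rewrite Cmult_assoc, Hri, Cmult_1_l.
  transitivity (RtoC (/ sqrt (2 * PI)) * (RtoC (sqrt (2 * PI)) *
    CInt (fun x => f (x - t)%R * fourier phi x)%C minfty pinfty))%C.
  - rewrite Cmult_assoc, (Cmult_comm (RtoC (/ _))), Hri. ring.
  - rewrite <- H. rewrite Cmult_assoc, (Cmult_comm (RtoC (/ _))), Hri. ring.
Qed.

Lemma conv_reflection (f : R -> C) (y : R) : (fun t => f (y - t)) = (fun t => f (y + (-1) * t)).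
Proof. apply functional_extensionality; intros; f_equal; ring. Qed.

Lemma Rabs_m1 : Rabs (-1) = 1.
Proof. rewrite Rabs_left; lra. Qed.

(** The translate of [f] by [y] has seminorms of polynomial size in [y], by [seminorm_le_affine]. *)
Lemma conv_growth T f : tempered T -> schwartz f -> exists A K, 0 <= A /\
  forall y, Cmod (conv T f y) <= A * (1 + Rabs y) ^ K.
Proof.
  intros HT Hf. destruct (tempered_bound T HT) as [N [M [HM HTb]]].
  destruct (schwartz_seminorm f Hf N) as [B HB].
  exists (M * (2 ^ N * (2 * B))), N. split.
  { apply Rmult_le_pos; [exact HM|]. apply Rmult_le_pos; [apply pow_le; lra|].
    generalize (seminorm_le_pos _ _ _ HB); lra. }
  intros y. unfold conv. rewrite conv_reflection.
  eapply Rle_trans; [apply HTb|].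
  - apply schwartz_affine; [exact Hf|apply Rabs_m1].
  - apply seminorm_le_affine; [exact Hf|apply Rabs_m1|exact HB].
  - right; ring.
Qed.

(** The Taylor remainder of the translates of [f] must be of order [h^2] in every seminorm up to
    [N]. For fixed [t], each weighted derivative is therefore expanded in the translation parameter,
    the second derivative being a translate of a derivative of [f'']. *)
Lemma conv_der T f y : tempered T -> schwartz f -> Cder (conv T f) y (conv T (CDerive_n f 1) y).
Proof.
  intros HT Hf. destruct (tempered_bound T HT) as [N [M [HM HTb]]].
  assert (Hf1 := schwartz_CDerive_n 1 f Hf). assert (Hf2 := schwartz_CDerive_n 2 f Hf).
  destruct (schwartz_seminorm _ Hf2 N) as [B HB].
  assert (HB0 := seminorm_le_pos _ _ _ HB).
  set (F := 2 ^ N * (2 * B)).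
  assert (HF : 0 <= F) by (apply Rmult_le_pos; [apply pow_le|]; lra).
  (* [P] bounds the seminorms of the translates of [f''] by every [x] between [y] and [y + h], for
     which [1 + Rabs x <= 2 + Rabs y]. *)
  set (P := (2 + Rabs y) ^ N * F).
  assert (Hr : forall g z, schwartz g -> schwartz (fun t => g (z + (-1) * t)))
    by (intros g z Hg; apply schwartz_affine; [exact Hg|apply Rabs_m1]).
  apply (Cder_of_remainder _ _ _ (M * (4 * P))). intros h Hh. unfold conv.
  rewrite !conv_reflection.
  assert (S1 := Hr f (y + h) Hf). assert (S2 := Hr f y Hf). assert (S3 := Hr _ y Hf1).
  rewrite <- (tempered_minus T _ _ HT S1 S2).
  rewrite <- (proj1 (proj2 HT) (RtoC h) _ S3).
  rewrite <- (tempered_minus T _ _ HT (schwartz_minus _ _ S1 S2) (schwartz_scal (RtoC h) _ S3)).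
  rewrite Rmult_assoc. apply HTb.
  { apply schwartz_minus; [now apply schwartz_minus|now apply schwartz_scal]. }
  intros a b Ha Hb t.
  assert (Sf := schwartz_smooth f Hf).
  assert (E : CDerive_n (fun t => f (y + h + (-1) * t)%R - f (y + (-1) * t)%R -
      RtoC h * CDerive_n f 1 (y + (-1) * t)%R)%C b =
    (fun t => RtoC ((-1) ^ b) * (CDerive_n f b (y + h + (-1) * t)%R - CDerive_n f b (y + (-1) * t)%R -
      RtoC h * CDerive_n f (S b) (y + (-1) * t)%R))%C).
  { assert (Q1 := schwartz_smooth _ S1). assert (Q2 := schwartz_smooth _ S2). assert (Q3 := schwartz_smooth _ S3).
    replace (fun t => f (y + h + (-1) * t)%R - f (y + (-1) * t)%R -
      RtoC h * CDerive_n f 1 (y + (-1) * t)%R)%C with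
     (fun t => f (y + h + (-1) * t)%R + ((- RtoC 1) * f (y + (-1) * t)%R +
      (- RtoC h) * CDerive_n f 1 (y + (-1) * t)%R))%C
      by (apply functional_extensionality; intros; ring).
    rewrite (CDerive_n_plus (fun t => f (y + h + (-1) * t)) _ b Q1
      (Csmooth_plus _ _ (Csmooth_scal _ _ Q2) (Csmooth_scal _ _ Q3))).
    rewrite (CDerive_n_plus _ _ b (Csmooth_scal (- RtoC 1) _ Q2) (Csmooth_scal (- RtoC h) _ Q3)).
    rewrite (CDerive_n_scal _ _ b Q2), (CDerive_n_scal _ _ b Q3).
    rewrite !CDerive_n_comp_affine by (trivial; now apply Csmooth_CDerive_n).
    apply functional_extensionality; intros u. rewrite (CDerive_n_S f b). ring. }
  rewrite E, Cmod_mult, Cmod_R, pow_1_abs, Rmult_1_l.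
  rewrite <- (Rabs_pos_eq (Rabs t ^ a)) by apply Rabs_pow_pos.
  rewrite <- Cmod_R, <- Cmod_mult.
  replace (RtoC (Rabs t ^ a) * (CDerive_n f b (y + h + (-1) * t)%R - CDerive_n f b (y + (-1) * t)%R -
      RtoC h * CDerive_n f (S b) (y + (-1) * t)%R))%C with
   (RtoC (Rabs t ^ a) * CDerive_n f b (y + h + (-1) * t)%R - RtoC (Rabs t ^ a) * CDerive_n f b (y + (-1) * t)%R -
      RtoC (y + h - y) * (RtoC (Rabs t ^ a) * CDerive_n f (S b) (y + (-1) * t)%R))%C
    by (replace (y + h - y) with h by ring; ring).
  assert (Dc : forall j x, Cder (fun z => RtoC (Rabs t ^ a) * CDerive_n f j (z + (-1) * t)%R)%C x
     (RtoC (Rabs t ^ a) * CDerive_n f (S j) (x + (-1) * t)%R)%C).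
  { intros j x. apply Cder_scal. eapply Cder_eq.
    - apply (Cder_comp (CDerive_n f j) (fun z => z + (-1) * t) x (CDerive_n f (S j) (x + (-1) * t)) 1).
      + now apply Cder_CDerive_n.
      + auto_derive; trivial; ring.
    - ring. }
  eapply Rle_trans; [apply (Taylor2_bound
    (fun z => RtoC (Rabs t ^ a) * CDerive_n f b (z + (-1) * t)%R)%C
    (fun z => RtoC (Rabs t ^ a) * CDerive_n f (S b) (z + (-1) * t)%R)%C
    (fun z => RtoC (Rabs t ^ a) * CDerive_n f (S (S b)) (z + (-1) * t)%R)%C P)|].
  - intros x _. apply Dc.
  - intros x _. apply Dc.
  - intros x Hx.
    assert (Hxy : 1 + Rabs x <= 2 + Rabs y).
    { assert (Rabs (x - y) <= 1).
      { revert Hx Hh. unfold Rmin, Rmax, Rabs; repeat destruct Rle_dec; repeat destruct Rcase_abs; lra. }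
      assert (T0 := Rabs_triang (x - y) y). replace (x - y + y) with x in T0 by ring. lra. }
    assert (L := seminorm_le_affine N _ B x (-1) Hf2 Rabs_m1 HB a b Ha Hb t).
    rewrite CDerive_n_comp_affine, CDerive_n_comp, Cmod_mult, Cmod_R, pow_1_abs, Rmult_1_l in L
      by now apply Csmooth_CDerive_n.
    rewrite Cmod_mult, Cmod_R, Rabs_pos_eq by apply Rabs_pow_pos.
    replace (S (S b)) with (b + 2)%nat by lia.
    eapply Rle_trans; [exact L|]. unfold P. fold F. apply Rmult_le_compat_r; [exact HF|].
    apply pow_incr. generalize (Rabs_pos x); lra.
  - replace (y + h - y) with h by ring. rewrite pow2_abs. lra.
Qed.

Lemma conv_CDerive_n T f n : tempered T -> schwartz f ->
  CDerive_n (conv T f) n = conv T (CDerive_n f n).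
Proof.
  intros HT Hf. induction n as [|n IH]; [now rewrite !CDerive_n_0|].
  replace (S n) with (1 + n)%nat by lia. rewrite <- !CDerive_n_comp, IH.
  apply CDerive_n_1. intros x. apply conv_der; [exact HT|now apply schwartz_CDerive_n].
Qed.

Lemma is_dist_of_fun_conv T f : tempered T -> schwartz f ->
  is_dist_of_fun (conv T f) (fun phi => CInt (fun x => conv T f x * phi x)%C minfty pinfty).
Proof.
  intros HT Hf. destruct (conv_growth T f HT Hf) as [A [K [HA HK]]].
  apply (is_dist_of_fun_CInt _ A K); trivial.
  apply (Ccont_Cder _ (conv T (CDerive_n f 1))). intros x. now apply conv_der.
Qed.

Lemma fourier_conv T f phi : tempered T -> schwartz f -> schwartz phi ->
  CInt (fun x => conv T f x * fourier phi x)%C minfty pinfty =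
  symbol T (fun xi => fourier f xi * phi xi)%C.
Proof.
  intros HT Hf Hphi. apply is_CInt_unique; try typeclasses eauto.
  unfold symbol.
  replace (fun t => (RtoC (sqrt (2 * PI)) * fourier (fun xi => fourier f xi * phi xi)%C t)%C) with
    (fun t => CInt (fun x => f (x - t)%R * fourier phi x)%C minfty pinfty).
  - apply tempered_conv; trivial. now apply schwartz_fourier.
  - apply functional_extensionality; intros t. now apply fourier_multiplication.
Qed.

(** * Removal of the weight and the spectral relations *)

Lemma weighted_fourier_eq psi omega f u : smooth psi -> (forall y, exists t, psi t = y) ->
  (forall t, 0 < Derive psi t) -> (forall t, 0 < omega t) -> schwartz f ->
  (forall t, u t = (f (psi t) / RtoC (omega t))%C) ->
  weighted_fourier psi omega u = fourier f.
Proof.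
  intros Hpsi Hsurj Hincr Homega Hf Hu. apply functional_extensionality; intros xi.
  assert (Dpsi : forall x, is_derive psi x (Derive psi x)) by (intros x; apply Derive_correct, (Hpsi 1%nat)).
  assert (Cpsi : forall x, continuous (U := R_UniformSpace) (Derive psi) x).
  { intros x. apply (ex_derive_continuous (K := R_AbsRing) (V := R_NormedModule)). apply (Hpsi 2%nat). }
  assert (mono : forall x y, x < y -> psi x < psi y).
  { intros x y Hxy. apply (incr_function psi m_infty p_infty (Derive psi)); simpl; trivial.
    intros z _ _. apply Hincr. }
  assert (H := is_CInt_subst _ psi (Derive psi) (CInt (fourier_integrand f xi) minfty pinfty) (Ccont_fourier_integrand f xi Hf) Dpsi Cpsi).
  unfold weighted_fourier, fourier. fold (fourier_integrand f xi). f_equal.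
  apply is_CInt_unique; try typeclasses eauto.
  replace (fun t => (Cexp (- Ci * RtoC (xi * psi t)) * (RtoC (omega t) * u t * RtoC (Derive psi t)))%C)
    with (fun t => (RtoC (Derive psi t) * fourier_integrand f xi (psi t))%C).
  - apply H.
    (* Surjectivity provides a preimage of [M], and monotonicity makes it a threshold: [psi] tends
       to both infinities, as the substitution requires. *)
    + intros M. destruct (Hsurj M) as [t <-]. exists t. intros a Ha. now apply mono.
    + intros M. destruct (Hsurj M) as [t <-]. exists t. intros a Ha. now apply mono.
    + now apply CInt_fourier_integrand.
  - apply functional_extensionality; intros t. rewrite Hu. unfold fourier_integrand. field.
    intros E. apply RtoC_inj in E. generalize (Homega t). lra.
Qed.

Lemma inverse_spec psi : (forall y, exists t, psi t = y) -> forall y, psi (inverse psi y) = y.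
Proof. intros H y. unfold inverse. apply epsilon_spec, H. Qed.

Theorem theorem3p16 (psi omega : R -> R)
  (omega_smooth : smooth omega) (omega_pos : forall t, 0 < omega t)
  (psi_smooth : smooth psi)
  (psi_surj : forall y, exists t, psi t = y)
  (psi_incr : forall t, 0 < Derive psi t)
  (n : nat) (n_pos : (1 <= n)%nat)
  (u : R -> C) (u_schwartz : weighted_schwartz psi omega u)
  (k kappa : functional) (k_kappa : admissible_pair n k kappa)
  (Phi : C -> C)
  (Phi_def : forall s : C, 0 < Re s -> Phi s = laplace kappa s) :
  (exists K : functional,
     is_boundary_value (fun s => (/ (s ^ n * Phi s))%C) K /\
     is_weighted_fourier psi omega (weyl_sonine_integral psi omega k u)
       (dist_mul (weighted_fourier psi omega u) K)) /\
  (exists F : functional,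
     is_boundary_value Phi F /\
     is_weighted_fourier psi omega (weyl_sonine_derivative psi omega n kappa u)
       (dist_mul (weighted_fourier psi omega u)
          (dist_mul (fun xi => ((Ci * RtoC xi) ^ n)%C) F))).
Proof.
  destruct k_kappa as [[Tk Tka] [[Sk Ska] [Hconv _]]].
  destruct u_schwartz as [f [Hf Hu]].
  assert (Hw : weighted_fourier psi omega u = fourier f) by now apply weighted_fourier_eq.
  assert (omega_nz : forall t, RtoC (omega t) <> RtoC 0).
  { intros t E. apply RtoC_inj in E. generalize (omega_pos t). lra. }
  assert (Hq : Q_inv psi (M_op omega u) = f).
  { apply functional_extensionality; intros y. unfold Q_inv, M_op.
    rewrite Hu, (inverse_spec psi psi_surj). field. apply omega_nz. }
  (* The extended transform starts with [Q^-1 M], which undoes the outer [M^-1 Q] of both weighted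
     operators and leaves their unweighted cores. *)
  assert (Hback : forall g, Q_inv psi (M_op omega (M_inv omega (Q_op psi g))) = g).
  { intros g. apply functional_extensionality; intros y. unfold Q_inv, M_op, M_inv, Q_op.
    rewrite (inverse_spec psi psi_surj), RtoC_inv; [field; apply omega_nz|].
    generalize (omega_pos (inverse psi y)). lra. }
  rewrite Hw. split.
  - exists (symbol k). split.
    + apply boundary_value_laplace; trivial. intros s Hs.
      assert (E : (laplace k s * laplace kappa s = / s ^ n)%C).
      { rewrite <- laplace_conv, Hconv by (trivial; now apply schwartz_cutoff_exp).
        now apply t_plus_cutoff_exp. }
      assert (Hs0 : (s ^ n <> 0)%C) by (apply Cpow_nz; intros ->; simpl in Hs; lra).
      rewrite Phi_def by trivial.
      assert (E1 : (s ^ n * (laplace k s * laplace kappa s) = 1)%C) by (rewrite E; field; trivial).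
      (* The Sonine relation itself excludes zeros of the symbol in the open half-plane, so the
         quotient in the statement is a genuine inverse there. *)
      assert (Hka0 : laplace kappa s <> RtoC 0).
      { intros Z. rewrite Z in E1. apply C1_nz. rewrite <- E1. ring. }
      transitivity (laplace k s * (s ^ n * laplace kappa s) / (s ^ n * laplace kappa s))%C.
      * replace (laplace k s * (s ^ n * laplace kappa s))%C with (RtoC 1) by (rewrite <- E1; ring).
        field. split; trivial.
      * field. split; trivial.
    + unfold is_weighted_fourier, weyl_sonine_integral. rewrite Hback, Hq.
      eexists. split; [now apply is_dist_of_fun_conv|].
      intros phi Hphi. unfold dist_fourier, dist_mul. now apply fourier_conv.
  - exists (symbol kappa). split.
    + now apply boundary_value_laplace.
    + unfold is_weighted_fourier, weyl_sonine_derivative. rewrite Hback, Hq.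
      rewrite conv_CDerive_n by trivial.
      assert (Hfn := schwartz_CDerive_n n f Hf).
      eexists. split; [now apply is_dist_of_fun_conv|].
      intros phi Hphi. unfold dist_fourier, dist_mul. rewrite fourier_conv by trivial.
      (* Both multipliers act on the test function, so after the power [(i xi)^n] is extracted from
         the transform of the n-th derivative, the two sides differ by the order of the factors. *)
      f_equal. rewrite fourier_CDerive_n by trivial.
      apply functional_extensionality; intros xi. ring.
Qed.
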